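(* Let $1<p<\infty$, let $q$ be the conjugate exponent ($\frac1p+\frac1q=1$), let $\alpha>-1/p$ and $\beta=\alpha p/q$. Let $\{a_k\}\subset\mathbb B^n$. If there exist $c_1,c_2>0$ with $c_1c_2<1$ such that $$K\Bigl(\{a_k\},\tfrac{n+1}{p}+\alpha,\tfrac{n+1}{q}+\beta\Bigr)\le c_1^q\quad\text{and}\quad K\Bigl(\{a_k\},\tfrac{n+1}{q}+\beta,\tfrac{n+1}{p}+\alpha\Bigr)\le c_2^p,$$ then $\{a_k\}$ is an interpolating sequence for $B^p_\alpha$.
   Context: $\mathbb B^n$ is the unit ball of $\mathbb C^n$, $z\bar w=\sum_jz_j\bar w_j$. For $r,s>0$, $K(\{a_k\},r,s)=\sup_k\sum_{j\ne k}\frac{(1-|a_k|^2)^r(1-|a_j|^2)^s}{|1-\bar a_k a_j|^{r+s}}$. $B^p_\alpha$ is the space of holomorphic $f$ on $\mathbb B^n$ with $\|f\|_{p,\alpha}^p=\int_{\mathbb B^n}(1-|z|^2)^{\alpha p}|f|^p\,dm<\infty$. For $\gamma\in\mathbb R$, $\ell^p_\gamma(\{a_k\})$ is the space of sequences $v$ with $\sum_k((1-|a_k|^2)^\gamma|v_k|)^p<\infty$. A sequence is interpolating for $B^p_\alpha$ if for every $v\in\ell^p_{\frac{n+1}{p}+\alpha}(\{a_k\})$ there is $f\in B^p_\alpha$ with $f(a_k)=v_k$ for all $k$. *)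

(* Defs.v *)
From HB Require Import structures.
From mathcomp Require Import all_boot all_order all_algebra.
From mathcomp Require Import all_classical all_reals all_analysis.
From mathcomp Require Import complex.

Set Implicit Arguments.
Unset Strict Implicit.
Unset Printing Implicit Defensive.

Import Order.TTheory GRing.Theory Num.Theory.
Local Open Scope ring_scope.
Local Open Scope classical_set_scope.

Section Defs.
Variable R : realType.

Definition cmod (z : R[i]) : R :=
  Num.sqrt (complex.Re z ^+ 2 + complex.Im z ^+ 2).

Definition cconj (z : R[i]) : R[i] := conjc z.

Definition cinner (n : nat) (z w : 'I_n -> R[i]) : R[i] :=
  \sum_(j < n) z j * cconj (w j).

Definition sqnorm (n : nat) (z : 'I_n -> R[i]) : R :=
  \sum_(j < n) cmod (z j) ^+ 2.
Definition vnorm (n : nat) (z : 'I_n -> R[i]) : R := Num.sqrt (sqnorm z).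

Definition in_ball (n : nat) (z : 'I_n -> R[i]) : bool := sqnorm z < 1.

Definition holomorphic_ball (n : nat) (f : ('I_n -> R[i]) -> R[i]) : Prop :=
  forall z, in_ball z ->
  exists c : 'I_n -> R[i], forall eps : R, 0 < eps ->
  exists2 delta : R, 0 < delta & forall h : 'I_n -> R[i], vnorm h < delta ->
    cmod (f (fun j => z j + h j) - f z - \sum_(j < n) c j * h j)
      <= eps * vnorm h.

(* Iterated Lebesgue integral over C^m (each complex coordinate integrated
   over its real and imaginary parts, w.r.t. 1-dimensional Lebesgue measure),
   of a nonnegative extended-real function.  Coordinates are stored in
   w : nat -> R[i]; coordinates >= m are frozen at their current values. *)
Definition upd (w : nat -> R[i]) (i : nat) (c : R[i]) : nat -> R[i] :=
  fun k => if k == i then c else w k.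

Fixpoint iter_int (m : nat) (g : (nat -> R[i]) -> \bar R) : \bar R :=
  match m with
  | 0 => g (fun _ => 0)
  | m'.+1 =>
    (\int[@lebesgue_measure R]_(x in [set: R])
      \int[@lebesgue_measure R]_(y in [set: R])
        iter_int m' (fun w => g (upd w m' (Complex x y))))%E
  end.

Definition vol_integral (n : nat) (F : ('I_n -> R[i]) -> \bar R) : \bar R :=
  iter_int n (fun w => F (fun j : 'I_n => w (nat_of_ord j))).

Definition Bnorm_p (n : nat) (p alpha : R) (f : ('I_n -> R[i]) -> R[i]) : \bar R :=
  vol_integral (fun z => if in_ball z then
      (((1 - sqnorm z) `^ (alpha * p)) * (cmod (f z) `^ p))%:E
    else 0%E).

Definition in_Bpa (n : nat) (p alpha : R) (f : ('I_n -> R[i]) -> R[i]) : Prop :=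
  holomorphic_ball f /\ (Bnorm_p p alpha f < +oo)%E.

Definition Kterm (n : nat) (a : nat -> 'I_n -> R[i]) (r s : R) (k j : nat) : R :=
  ((1 - sqnorm (a k)) `^ r) * ((1 - sqnorm (a j)) `^ s)
  / (cmod (1 - cinner (a j) (a k)) `^ (r + s)).

Definition Kconst (n : nat) (a : nat -> 'I_n -> R[i]) (r s : R) : \bar R :=
  ereal_sup [set (\sum_(j <oo | j != k) (Kterm a r s k j)%:E)%E | k in [set: nat]].

Definition in_lpgamma (n : nat) (a : nat -> 'I_n -> R[i]) (p gamma : R)
  (v : nat -> R[i]) : Prop :=
  (\sum_(k <oo) ((((1 - sqnorm (a k)) `^ gamma) * cmod (v k)) `^ p)%:E < +oo)%E.

Definition interpolating (n : nat) (p alpha : R) (a : nat -> 'I_n -> R[i]) : Prop :=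
  forall v : nat -> R[i], in_lpgamma a p ((n.+1)%:R / p + alpha) v ->
  exists f : ('I_n -> R[i]) -> R[i], in_Bpa p alpha f /\ forall k, f (a k) = v k.

End Defs.

(* Main.v *)
Require Import Defs.
From HB Require Import structures.
From mathcomp Require Import all_boot all_order all_algebra.
From mathcomp Require Import all_classical all_reals all_analysis.
From mathcomp Require Import complex measurable_realfun.
From mathcomp Require Import ring lra.
(** Put [l = n + 1 + alpha p], so that the two exponents of the theorem are [l / p] and [l / q],
    and look for the interpolating function in the form
      [f z = sum_j u_j (1 - |a_j|^2)^(l/q) (1 - <z, a_j>)^(-l)].
    With [y_k = (1 - |a_k|^2)^(l/p) v_k], the condition [f a_k = v_k] reads [u + T u = y], where the
    off-diagonal matrix [T] has entries of modulus [Kterm]. The two hypotheses bound its row and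
    column sums, so by Schur's test its norm on l^p is at most [c1 c2 < 1], and a Neumann series
    gives a solution [u] in l^p.

    To see that [f] is in the weighted Bergman space, Hoelder's inequality with the weights
    [(1 - |a_j|^2)^(n/(p q))] reduces the estimate to the Forelli-Rudin bound
      [int (1 - |z|^2)^s |1 - <z, a>|^-(n+1+s+c) dm(z) <= C (1 - |a|^2)^(-c)]   ([s > -1], [c > 0])
    and its discrete analogue for sums over the points [a_j]. A unitary change of variables brings
    [a] to the last coordinate axis; integrating out the other coordinates leaves a planar
    integral. The discrete analogue follows because the hypothesis on [K] forces the non-isotropic
    neighbourhoods of the [a_j] to have bounded overlap. *)

Set Implicit Arguments.
Unset Strict Implicit.
Unset Printing Implicit Defensive.
Import Order.TTheory GRing.Theory Num.Theory.
Import numFieldNormedType.Exports.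
Local Open Scope ring_scope.
Local Open Scope classical_set_scope.

(** * Iterated integrals over finitely many real coordinates *)

(** The volume is given as an iterated integral, so unitary invariance has to come from translation
    invariance on the line. A vector is moved to an axis by phases and real plane rotations; each of
    these acts on the real coordinates by rotations of two of them; such a rotation is a product of
    three shears; and a shear translates one coordinate by an amount that does not depend on it.
    Tonelli's theorem makes that coordinate the innermost one. The first hypothesis has one more
    use. Its row at [a 0] gives [sum_j (1 - |a_j|^2)^(l/q) < oo]. Since [u] is bounded, the
    coefficients of the kernels are then absolutely summable, and [f] is holomorphic by termwise
    expansion. The powers are principal branches, because [1 - <z, a_j>] has positive real part on
    the ball. *)

Section Integration.
Variable R : realType.
Implicit Types (w : nat -> R) (g h : (nat -> R) -> \bar R) (s t : seq nat).

Local Notation mu := (@lebesgue_measure R).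

Import HBNNSimple.

(** The integral of a nonnegative function is a supremum over the simple functions below it, which
    gives monotonicity for arbitrary functions. The integrand of [Bnorm_p] is compared with its
    majorant in this way. *)
Lemma le_integral_nonneg d (T : measurableType d) (m : {measure set T -> \bar R})
    (f1 f2 : T -> \bar R) :
  (forall x, 0 <= f1 x)%E -> (forall x, f1 x <= f2 x)%E ->
  (\int[m]_x f1 x <= \int[m]_x f2 x)%E.
Proof.
move=> f10 f12; rewrite !ge0_integralTE//; last first.
  by move=> x; exact: le_trans (f12 x).
apply: ereal_sup_le => _ [h /= hf1 <-].
by exists h => // x; exact: le_trans (f12 x).
Qed.

Lemma lebesgue_measure_shift (c : R) (A : set R) : measurable A ->
  pushforward mu ((fun x => x + c) : measurableTypeR R -> measurableTypeR R) A = mu A.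
Proof.
move=> mA; apply/esym/lebesgue_measure_unique => //=.
- exact: measurable_funD.
- move=> _ _ [[a b]] _ <-; rewrite /pushforward.
  rewrite (_ : _ @^-1` _ = `](a - c)%R, (b - c)%R]%classic); last first.
    by apply/seteqP; split=> x /=; rewrite !in_itv/= ltrBlDr lerBrDr.
  rewrite !lebesgue_measure_itv/= !lte_fin ltrD2r.
  by rewrite -!EFinB opprB addrA subrK.
Qed.

Lemma integral_shift (f : R -> \bar R) (c : R) :
  measurable_fun setT f -> (forall x, 0 <= f x)%E ->
  (\int[mu]_x f (x + c)%R = \int[mu]_x f x)%E.
Proof.
move=> mf f0.
have mS : measurable_fun setT ((fun x => x + c) : measurableTypeR R -> measurableTypeR R).
  exact: measurable_funD.
rewrite (_ : [set: R] = (fun x : R => x + c) @^-1` setT)//.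
rewrite -(@ge0_integral_pushforward _ _ (measurableTypeR R) (measurableTypeR R) _
  (fun x => x + c) mS mu setT f)//=.
apply: (@eq_measure_integral _ (measurableTypeR R) R setT) => A mA _.
exact: lebesgue_measure_shift.
Qed.

(** Points live in [nat -> R] in every dimension, so that integrals over different lists of
    coordinates compose and can be permuted; coordinates outside the list act as parameters. *)
Definition rupd w (k : nat) (x : R) : nat -> R := fun i => if i == k then x else w i.

Definition cint (k : nat) g w : \bar R := (\int[mu]_x g (rupd w k x))%E.

Definition iint s g := foldr cint g s.

(* Measurability is tested along arbitrary coordinatewise measurable maps into [nat -> R], so
   that no sigma-algebra on [nat -> R] is needed. *)
Definition tame g := forall d (T : measurableType d) (phi : T -> nat -> R),
  (forall k, measurable_fun setT (phi ^~ k)) -> measurable_fun setT (g \o phi).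

Lemma rupdE w k x : rupd w k x k = x.
Proof. by rewrite /rupd eqxx. Qed.

Lemma rupdNE w k x i : i != k -> rupd w k x i = w i.
Proof. by rewrite /rupd => /negbTE ->. Qed.

Lemma rupdC w k l x y : k != l ->
  rupd (rupd w k x) l y = rupd (rupd w l y) k x.
Proof.
move=> kl; apply/funext => i; rewrite /rupd.
by case: eqP => [->|//]; rewrite eq_sym (negbTE kl).
Qed.

Lemma tame_comp g (S : (nat -> R) -> nat -> R) :
  (forall k, forall d (T : measurableType d) (phi : T -> nat -> R),
    (forall k, measurable_fun setT (phi ^~ k)) -> measurable_fun setT (fun x => S (phi x) k)) ->
  tame g -> tame (g \o S).
Proof. by move=> mS tg d T phi mphi; apply: (tg _ _ (S \o phi)) => k; exact: mS. Qed.

Lemma tame_rupd_pair d (T : measurableType d) (phi : T -> nat -> R) k i :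
  (forall k, measurable_fun setT (phi ^~ k)) ->
  measurable_fun setT (fun tx : T * R => rupd (phi tx.1) k tx.2 i).
Proof.
move=> mphi; rewrite /rupd; case: eqP => _; first exact: measurable_snd.
exact: (@measurableT_comp _ _ _ _ _ _ (phi ^~ i) setT (@fst T R) (mphi i) measurable_fst).
Qed.

Lemma tame_measurable1 g w k : tame g -> measurable_fun setT (fun x : R => g (rupd w k x)).
Proof.
move=> tg; apply: (tg _ _ (fun x => rupd w k x)) => i.
by rewrite /rupd; case: eqP.
Qed.

Lemma tame_measurable2 g w k l : tame g ->
  measurable_fun setT (fun z : R * R => g (rupd (rupd w k z.1) l z.2)).
Proof.
move=> tg; apply: (tg _ _ (fun z => rupd (rupd w k z.1) l z.2)) => i.
rewrite /rupd; case: eqP => _; first exact: measurable_snd.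
by case: (i == k); [exact: measurable_fst | exact: measurable_cst].
Qed.

Lemma cint_ge0 k g : (forall w, 0 <= g w)%E -> forall w, (0 <= cint k g w)%E.
Proof. by move=> g0 w; apply: integral_ge0. Qed.

Lemma iint_ge0 s g : (forall w, 0 <= g w)%E -> forall w, (0 <= iint s g w)%E.
Proof. by move=> g0; elim: s => //= k s; exact: cint_ge0. Qed.

Lemma cint_tame k g : (forall w, 0 <= g w)%E -> tame g -> tame (cint k g).
Proof.
move=> g0 tg d T phi mphi.
apply: (@measurable_fun_fubini_tonelli_F _ _ T (measurableTypeR R) R mu
  (fun tx => g (rupd (phi tx.1) k tx.2))) => //.
apply: (tg _ _ (fun tx : T * R => rupd (phi tx.1) k tx.2)) => i.
exact: tame_rupd_pair.
Qed.

Lemma iint_tame s g : (forall w, 0 <= g w)%E -> tame g -> tame (iint s g).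
Proof.
move=> g0 tg; elim: s => //= k s IH; apply: cint_tame => //; exact: iint_ge0.
Qed.

Lemma cintC k l g : (forall w, 0 <= g w)%E -> tame g ->
  cint k (cint l g) = cint l (cint k g).
Proof.
move=> g0 tg; have [->//|kl] := eqVneq k l.
apply/funext => w; rewrite /cint.
have := @fubini_tonelli _ _ (measurableTypeR R) (measurableTypeR R) R mu mu
  (fun z => g (rupd (rupd w k z.1) l z.2)) (tame_measurable2 _ _ _ tg) (fun=> g0 _).
move=> /= ->; apply: eq_integral => y _; apply: eq_integral => x _.
by rewrite rupdC.
Qed.

Lemma le_cint k g h : (forall w, 0 <= g w)%E -> (forall w, g w <= h w)%E ->
  forall w, (cint k g w <= cint k h w)%E.
Proof. by move=> g0 gh w; apply: le_integral_nonneg. Qed.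

Lemma le_iint s g h : (forall w, 0 <= g w)%E -> (forall w, g w <= h w)%E ->
  forall w, (iint s g w <= iint s h w)%E.
Proof.
move=> g0 gh; elim: s => //= k s IH; apply: le_cint => //; exact: iint_ge0.
Qed.

Lemma iint_cat s t g : iint (s ++ t) g = iint s (iint t g).
Proof. exact: foldr_cat. Qed.

Lemma iint_cint s k g : (forall w, 0 <= g w)%E -> tame g ->
  iint s (cint k g) = cint k (iint s g).
Proof.
move=> g0 tg; elim: s => //= l s ->; rewrite cintC//; last exact: iint_tame.
exact: iint_ge0.
Qed.

Lemma perm_iint s t g : (forall w, 0 <= g w)%E -> tame g ->
  perm_eq s t -> iint s g = iint t g.
Proof.
move=> g0 tg; elim: s t => [|k s IH] t st.
  by have := perm_size st; case: t st.
have kt : k \in t by rewrite -(perm_mem st) mem_head.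
case/splitPr: kt st => t1 t2 st.
have st' : perm_eq s (t1 ++ t2).
  by rewrite -(perm_cons k) (perm_trans st)// -[k :: t2]cat1s perm_catCA.
rewrite iint_cat/= (IH _ st') iint_cat iint_cint//; last exact: iint_tame.
exact: iint_ge0.
Qed.

Lemma eq_iint s g h : g =1 h -> iint s g = iint s h.
Proof. by move=> /funext ->. Qed.

Lemma iintZ s g (c : R) : 0 <= c -> (forall w, 0 <= g w)%E -> tame g ->
  forall w, (iint s (fun w => c%:E * g w) w = c%:E * iint s g w)%E.
Proof.
move=> c0 g0 tg; elim: s => //= k s IH w.
rewrite /cint; under eq_integral do rewrite IH.
rewrite ge0_integralZl_EFin//; first by move=> x _; exact: iint_ge0.
apply: tame_measurable1; exact: iint_tame.
Qed.

Lemma iint_series s (g : nat -> (nat -> R) -> \bar R) :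
  (forall i w, 0 <= g i w)%E -> (forall i, tame (g i)) ->
  forall w, (iint s (fun w => \sum_(i <oo) g i w) w = \sum_(i <oo) iint s (g i) w)%E.
Proof.
move=> g0 tg; elim: s => //= k s IH w.
rewrite /cint; under eq_integral do rewrite IH.
rewrite integral_nneseries// => i *; last exact: iint_ge0.
apply: tame_measurable1; exact: iint_tame.
Qed.

Definition shear k l (c : R) w := rupd w k (w k + c * w l).

Lemma tame_shear k l c g : tame g -> tame (g \o shear k l c).
Proof.
apply: tame_comp => i d T phi mphi; rewrite /shear /rupd; case: eqP => _ //.
by apply: measurable_funD => //; apply: measurable_funM.
Qed.

(** With the other coordinates frozen, the shear is a translation in coordinate [k]. *)
Lemma cint_shear k l c g : k != l -> (forall w, 0 <= g w)%E -> tame g ->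
  cint k (g \o shear k l c) = cint k g.
Proof.
move=> kl g0 tg; apply/funext => w; rewrite /cint /=.
under eq_integral => x _.
  rewrite (_ : shear k l c _ = rupd w k (x + c * w l)); last first.
    rewrite /shear rupdE rupdNE 1?eq_sym//; apply/funext => i.
    by rewrite /rupd; case: eqP.
  over.
rewrite (@integral_shift (fun x => g (rupd w k x)))//.
exact: tame_measurable1.
Qed.

Lemma iint_shear s k l c g : k \in s -> k != l -> (forall w, 0 <= g w)%E -> tame g ->
  iint s (g \o shear k l c) = iint s g.
Proof.
(* Move [k] to the end of the list, where its integral is the innermost one. *)
move=> ks kl g0 tg; have ss : perm_eq s (rcons (rem k s) k).
  by rewrite perm_sym perm_rcons perm_sym perm_to_rem.
rewrite (perm_iint _ _ ss)//; [|by move=> w; exact: g0|exact: tame_shear].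
rewrite [RHS](perm_iint _ _ ss)//.
by rewrite -!cats1 !iint_cat/= cint_shear.
Qed.

Definition prot k l (c d : R) w :=
  rupd (rupd w k (c * w k - d * w l)) l (d * w k + c * w l).

(* Here [e] is minus the tangent of the half angle; hence the exclusion of the angle pi. *)
Lemma rot_shear k l (c d : R) : k != l -> c ^+ 2 + d ^+ 2 = 1 -> 0 <= c ->
  let e := - (d / (1 + c)) in
  prot k l c d = shear k l e \o shear l k d \o shear k l e.
Proof.
move=> kl cd c0 e; apply/funext => w; apply/funext => i.
have c1 : 1 + c != 0 by rewrite gt_eqF// ltr_pwDl.
have lk : l != k by rewrite eq_sym.
have de : d * e = c - 1.
  have -> : d * e = - (d ^+ 2 / (1 + c)) by rewrite /e; ring.
  have -> : d ^+ 2 = (1 - c) * (1 + c) by nra.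
  by rewrite mulfK// opprB.
have [->|il] := eqVneq i l.
  rewrite /prot /= /shear !(rupdNE _ _ lk, rupdNE _ _ kl, rupdE).
  have -> : c = 1 + d * e by rewrite de subrKC.
  ring.
have [->|ik] := eqVneq i k.
  rewrite /prot /= /shear !(rupdNE _ _ lk, rupdNE _ _ kl, rupdE).
  have ce : (1 + c) * e = - d by rewrite /e mulrN mulrCA divff ?mulr1.
  transitivity (w k + w l * (e + e + e * (d * e)) + (d * e) * w k); last by ring.
  rewrite de.
  have -> : e + e + e * (c - 1) = (1 + c) * e by ring.
  rewrite ce; ring.
by rewrite /prot /= /shear !rupdNE.
Qed.

Lemma tame_rot k l c d g : tame g -> tame (g \o prot k l c d).
Proof.
apply: tame_comp => i e T phi mphi; rewrite /prot /rupd.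
case: eqP => _; first by apply: measurable_funD; apply: measurable_funM.
by case: eqP => _ //; apply: measurable_funB; apply: measurable_funM.
Qed.

Lemma iint_rot s k l c d g : k \in s -> l \in s -> k != l ->
  c ^+ 2 + d ^+ 2 = 1 -> 0 <= c -> (forall w, 0 <= g w)%E -> tame g ->
  iint s (g \o prot k l c d) = iint s g.
Proof.
move=> ks ls kl cd c0 g0 tg; have lk : l != k by rewrite eq_sym.
have ts m m' e : tame (g \o shear m m' e) by exact: tame_shear.
rewrite rot_shear//; set e := - _.
have -> : g \o (shear k l e \o shear l k d \o shear k l e) =
  ((g \o shear k l e) \o shear l k d) \o shear k l e by [].
have g0' (S : (nat -> R) -> nat -> R) w : (0 <= (g \o S) w)%E by exact: g0.
rewrite (iint_shear _ ks kl (g0' _)); last exact: (tame_shear _ _ _ (ts _ _ _)).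
by rewrite (iint_shear _ ls lk (g0' _))// iint_shear.
Qed.

End Integration.

(** * Unitary invariance *)

Section ComplexCoordinates.
Variable R : realType.
Implicit Types (w : nat -> R).

Local Notation C := R[i].

Lemma neq_double_doubleS (k l : nat) : k.*2 != l.*2.+1.
Proof. by apply/eqP => /(congr1 odd); rewrite /= !odd_double. Qed.

(** The order is that of [iter_int]: the last complex coordinate is outermost, its real part before
    its imaginary part. *)
Fixpoint coords (m : nat) : seq nat :=
  if m is m'.+1 then [:: m'.*2, m'.*2.+1 & coords m'] else [::].

Definition vec n w : 'I_n -> C := fun j => Complex (w j.*2) (w j.*2.+1).

(** [iter_int] substitutes the outer variables into the integrand and ends at the zero vector, while
    [iint] carries them in [w]. Reading the coordinates below [m] from [u] and the others from [w]
    makes the induction go through. *)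
Lemma iter_int_iint m (G : (nat -> C) -> \bar R) w :
  iter_int m (fun u => G (fun k => if (k < m)%N then u k
                                   else Complex (w k.*2) (w k.*2.+1))) =
  iint (coords m) (fun w => G (fun k => Complex (w k.*2) (w k.*2.+1))) w.
Proof.
elim: m w => [//|m IH] w /=; rewrite /cint.
apply: eq_integral => x _; apply: eq_integral => y _.
rewrite -IH; congr iter_int; apply/funext => u; congr G; apply/funext => k.
rewrite /upd ltnS leq_eqVlt; have [->|km] /= := eqVneq k m.
  rewrite ltnn; congr Complex; last by rewrite rupdE.
  by rewrite rupdNE ?rupdE// neq_ltn ltnSn.
case: ifP => // _; congr Complex; rewrite !rupdNE//;
  by move=> *; rewrite ?eqSS ?(inj_eq double_inj)// ?neq_double_doubleS// eq_sym neq_double_doubleS.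
Qed.

Lemma vol_integralE n (F : ('I_n -> C) -> \bar R) :
  vol_integral F = iint (coords n) (fun w => F (vec w)) (fun=> 0).
Proof.
rewrite -(iter_int_iint n (fun u => F (fun j : 'I_n => u j))) /vol_integral.
by congr iter_int; apply/funext => u; congr F; apply/funext => j; rewrite ltn_ord.
Qed.

Lemma coords_even n (j : 'I_n) : (j : nat).*2 \in coords n.
Proof.
case: j => j /=; elim: n => //= n IH; rewrite ltnS leq_eqVlt !inE => /orP[/eqP->|/IH->].
  by rewrite eqxx.
by rewrite !orbT.
Qed.

Lemma coords_odd n (j : 'I_n) : (j : nat).*2.+1 \in coords n.
Proof.
case: j => j /=; elim: n => //= n IH; rewrite ltnS leq_eqVlt !inE => /orP[/eqP->|/IH->].
  by rewrite eqxx orbT.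
by rewrite !orbT.
Qed.

Definition phase n (c d : R) (i : 'I_n) (z : 'I_n -> C) : 'I_n -> C :=
  fun k => if k == i then Complex c d * z k else z k.

Definition givens n (c d : R) (i j : 'I_n) (z : 'I_n -> C) : 'I_n -> C :=
  fun k => if k == i then c%:C%C * z i - d%:C%C * z j
           else if k == j then d%:C%C * z i + c%:C%C * z j else z k.

Lemma cmod2E (z : C) : cmod z ^+ 2 = complex.Re z ^+ 2 + complex.Im z ^+ 2.
Proof. by rewrite sqr_sqrtr// addr_ge0// sqr_ge0. Qed.

Lemma vec_phase n (c d : R) (i : 'I_n) w :
  vec (prot (i : nat).*2 (i : nat).*2.+1 c d w) = phase c d i (vec w).
Proof.
have ii : (i : nat).*2 != (i : nat).*2.+1 by rewrite neq_ltn ltnSn.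
apply/funext => k; rewrite /vec /phase /prot.
have [->|ki] := eqVneq k i.
  rewrite (rupdNE _ _ ii) !rupdE.
  by apply/eqP; rewrite eq_complex/=; apply/andP; split; apply/eqP; ring.
have ki' : (k : nat) != i by [].
congr Complex; rewrite !rupdNE//;
  by move=> *; rewrite ?eqSS ?(inj_eq double_inj)// ?neq_double_doubleS// eq_sym neq_double_doubleS.
Qed.

(** The coefficients are real, so real and imaginary parts are rotated separately by the same
    angle. *)
Lemma vec_givens n (c d : R) (i j : 'I_n) w : i != j ->
  vec (prot (i : nat).*2 (j : nat).*2 c d (prot (i : nat).*2.+1 (j : nat).*2.+1 c d w)) =
  givens c d i j (vec w).
Proof.
move=> ij; have ij' : (i : nat) != j by [].
have eo := neq_double_doubleS.
have oe (k l : nat) : k.*2.+1 != l.*2 by rewrite eq_sym.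
have ee (k l : nat) : k != l -> k.*2 != l.*2 by rewrite (inj_eq double_inj).
have oo (k l : nat) : k != l -> k.*2.+1 != l.*2.+1 by rewrite eqSS (inj_eq double_inj).
have ji' : (j : nat) != i by rewrite eq_sym.
apply/funext => k; rewrite /vec /givens /prot.
have [->|ki] := eqVneq k i.
  rewrite !(rupdE, rupdNE _ _ (eo _ _), rupdNE _ _ (oe _ _), rupdNE _ _ (ee _ _ ij'), rupdNE _ _ (oo _ _ ij'), rupdNE _ _ (ee _ _ ji'), rupdNE _ _ (oo _ _ ji')).
  by apply/eqP; rewrite eq_complex/=; apply/andP; split; apply/eqP; ring.
have [->|kj] := eqVneq k j.
  rewrite !(rupdE, rupdNE _ _ (eo _ _), rupdNE _ _ (oe _ _), rupdNE _ _ (ee _ _ ij'), rupdNE _ _ (oo _ _ ij'), rupdNE _ _ (ee _ _ ji'), rupdNE _ _ (oo _ _ ji')).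
  by apply/eqP; rewrite eq_complex/=; apply/andP; split; apply/eqP; ring.
have ki' : (k : nat) != i by [].
have kj' : (k : nat) != j by [].
by rewrite !(rupdNE _ _ (eo _ _), rupdNE _ _ (oe _ _), rupdNE _ _ (ee _ _ ki'), rupdNE _ _ (oo _ _ ki'), rupdNE _ _ (ee _ _ kj'), rupdNE _ _ (oo _ _ kj')).
Qed.

Lemma sqnorm_phase n (c d : R) (i : 'I_n) z : c ^+ 2 + d ^+ 2 = 1 ->
  sqnorm (phase c d i z) = sqnorm z.
Proof.
move=> cd; apply: eq_bigr => k _; rewrite /phase; case: eqP => // _.
rewrite !cmod2E; case: (z k) => x y /=.
by rewrite -[RHS]mul1r -cd; ring.
Qed.

Lemma cinner_phase n (c d : R) (i : 'I_n) z a :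
  cinner (phase c d i z) a = cinner z (phase c (- d) i a).
Proof.
apply: eq_bigr => k _; rewrite /phase; case: eqP => // _.
rewrite /cconj rmorphM /= opprK; ring.
Qed.

Lemma big_two n (i j : 'I_n) (V : zmodType) (F : 'I_n -> V) : i != j ->
  \sum_k F k = F i + F j + \sum_(k | (k != i) && (k != j)) F k.
Proof. by move=> ij; rewrite (bigD1 i)//= (bigD1 j)/= 1?eq_sym// addrA. Qed.

Lemma sqnorm_givens n (c d : R) (i j : 'I_n) z : i != j -> c ^+ 2 + d ^+ 2 = 1 ->
  sqnorm (givens c d i j z) = sqnorm z.
Proof.
move=> ij cd; rewrite /sqnorm !(big_two _ ij); congr (_ + _); last first.
  by apply: eq_bigr => k /andP[ki kj]; rewrite /givens (negbTE ki) (negbTE kj).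
rewrite /givens !eqxx eq_sym (negbTE ij) !cmod2E.
case: (z i) (z j) => x y [x' y'] /=.
rewrite -[RHS]mul1r -cd; ring.
Qed.

Lemma cinner_givens n (c d : R) (i j : 'I_n) z a : i != j ->
  cinner (givens c d i j z) a = cinner z (givens c (- d) i j a).
Proof.
move=> ij; rewrite /cinner !(big_two _ ij); congr (_ + _); last first.
  by apply: eq_bigr => k /andP[ki kj]; rewrite /givens (negbTE ki) (negbTE kj).
rewrite /givens !eqxx eq_sym (negbTE ij) /cconj.
case: (z i) (z j) (a i) (a j) => x y [x' y'] [u v] [u' v'].
by apply/eqP; rewrite eq_complex/=; apply/andP; split; apply/eqP; ring.
Qed.

(** The angle serves to annihilate one coordinate. The equation is homogeneous in [(c, d)], so the
    sign can be chosen with [0 <= c], as [iint_rot] requires. *)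
Lemma exists_angle (p q : R) : exists c d, [/\ 0 <= c, c ^+ 2 + d ^+ 2 = 1 & d * p = c * q].
Proof.
pose r := Num.sqrt (p ^+ 2 + q ^+ 2).
have r2 : r ^+ 2 = p ^+ 2 + q ^+ 2 by rewrite sqr_sqrtr// addr_ge0// sqr_ge0.
have [r0|rn0] := eqVneq r 0.
  have : p ^+ 2 + q ^+ 2 == 0 by rewrite -r2 r0 expr0n.
  rewrite paddr_eq0 ?sqr_ge0// !sqrf_eq0 => /andP[/eqP-> /eqP->].
  by exists 1, 0; rewrite ler01 expr1n expr0n addr0 !mulr0.
have rp : 0 < r by rewrite lt_def rn0 sqrtr_ge0.
have r2n0 : r ^+ 2 != 0 by rewrite sqrf_eq0.
have [p0|p0] := leP 0 p.
  exists (p / r), (q / r); split; first by rewrite divr_ge0// ltW.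
    by rewrite !expr_div_n -mulrDl -r2 divff.
  by rewrite mulrAC [q * p]mulrC mulrAC.
exists (- p / r), (- q / r); split; first by rewrite divr_ge0// ltW// oppr_gt0.
  by rewrite !expr_div_n !sqrrN -mulrDl -r2 divff.
by rewrite mulrAC mulNr [q * p]mulrC -mulNr mulrAC.
Qed.

(** * Rotating a vector to a coordinate axis *)

Section Reduction.
Variable n : nat.
Implicit Types (a b z : 'I_n -> C).

Let integrand (phi : R -> C -> \bar R) a w := phi (sqnorm (vec w : 'I_n -> C)) (cinner (vec w) a).

(** A substitute for unitary equivalence of [a] and [b]: it records only the consequence for
    integrals of functions of [|z|^2] and [<z, a>]. *)
Definition equi a b := sqnorm a = sqnorm b /\
  forall phi, (forall x y, 0 <= phi x y)%E -> (forall b, tame (integrand phi b)) ->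
  iint (coords n) (integrand phi a) = iint (coords n) (integrand phi b).

Lemma equi_trans a b c : equi a b -> equi b c -> equi a c.
Proof. by move=> [nab ab] [nbc bc]; split => [|phi p0 tp]; rewrite (nab, ab)// bc. Qed.

Lemma equi_phase a (c d : R) (i : 'I_n) : 0 <= c -> c ^+ 2 + d ^+ 2 = 1 ->
  equi a (phase c (- d) i a).
Proof.
move=> c0 cd; split; first by rewrite sqnorm_phase// sqrrN.
move=> phi p0 tp.
have ii : (i : nat).*2 != (i : nat).*2.+1 by rewrite neq_ltn ltnSn.
rewrite -(iint_rot (coords_even i) (coords_odd i) ii cd c0 _ (tp a)); last by move=> w; exact: p0.
apply: eq_iint => w; rewrite /integrand /= vec_phase sqnorm_phase// cinner_phase//.
Qed.

Lemma equi_givens a (c d : R) (i j : 'I_n) : i != j -> 0 <= c -> c ^+ 2 + d ^+ 2 = 1 ->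
  equi a (givens c (- d) i j a).
Proof.
move=> ij c0 cd; split; first by rewrite sqnorm_givens// sqrrN.
move=> phi p0 tp.
have ij1 : (i : nat).*2 != (j : nat).*2 by rewrite (inj_eq double_inj).
have ij2 : (i : nat).*2.+1 != (j : nat).*2.+1 by rewrite eqSS.
rewrite -(iint_rot (coords_even i) (coords_even j) ij1 cd c0 _ (tp a)); last by move=> w; exact: p0.
rewrite -(iint_rot (coords_odd i) (coords_odd j) ij2 cd c0 _ (tame_rot _ _ _ _ (tp a))); last by move=> w; exact: p0.
apply: eq_iint => w; rewrite /integrand /= vec_givens// sqnorm_givens// cinner_givens//.
Qed.

(** The last clause preserves the zeros and the real coordinates obtained before. *)
Lemma equi_real a (i : 'I_n) : exists b, [/\ equi a b, complex.Im (b i) = 0 &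
  forall k, a k = 0 \/ k != i -> b k = a k].
Proof.
have [c [d [c0 cd dc]]] := exists_angle (complex.Re (a i)) (complex.Im (a i)).
exists (phase c (- d) i a); split; first exact: equi_phase.
  rewrite /phase eqxx; case: (a i) dc => x y /= <-; ring.
by move=> k [ak|ki]; rewrite /phase ?ak ?mulr0 ?if_same// (negbTE ki).
Qed.

(** Two phases make coordinates [i] and [j] real; a real rotation in their plane then moves
    everything into coordinate [i]. *)
Lemma equi_kill a (i j : 'I_n) : i != j -> exists b, [/\ equi a b, b j = 0 &
  forall k, k != i -> a k = 0 -> b k = 0].
Proof.
move=> ij; have [a1 [aa1 im1 za1]] := equi_real a i.
have [a2 [aa2 im2 za2]] := equi_real a1 j.
have im1' : complex.Im (a2 i) = 0 by rewrite za2 ?ij//; right.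
have [c [d [c0 cd dc]]] := exists_angle (complex.Re (a2 i)) (complex.Re (a2 j)).
have bj : givens c (- d) i j a2 j = 0.
  rewrite /givens eqxx eq_sym (negbTE ij).
  case: (a2 i) (a2 j) im1' im2 dc => x y [x' y'] /= -> -> dc.
  by apply/eqP; rewrite eq_complex/=; apply/andP; split; apply/eqP; rewrite ?mulNr ?dc; ring.
exists (givens c (- d) i j a2); split => //.
- exact: (equi_trans aa1 (equi_trans aa2 (equi_givens _ ij c0 cd))).
- move=> k ki ak; have [->//|kj] := eqVneq k j.
  rewrite /givens (negbTE ki) (negbTE kj).
  have a1k : a1 k = 0 by rewrite za1 ?ak//; left.
  by rewrite za2 ?a1k//; left.
Qed.

Lemma equi_axis (i : 'I_n) a : exists2 r : R, 0 <= r &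
  equi a (fun k => if k == i then r%:C%C else 0).
Proof.
have [b [ab b0]] : exists b, equi a b /\ forall k, k != i -> b k = 0.
  suff [b [ab b0]] : exists b, equi a b /\ forall k, k \in rem i (enum 'I_n) -> b k = 0.
    exists b; split => // k ki; apply: b0.
    by rewrite mem_rem_uniq ?enum_uniq// inE ki mem_enum.
  have : i \notin rem i (enum 'I_n) by rewrite mem_rem_uniqF ?enum_uniq.
  elim: (rem i _) => [|j t IH]; first by exists a; split; first by split.
  rewrite inE negb_or => /andP[ij it]; have [b [ab b0]] := IH it.
  have [b' [bb' b'j b'0]] := equi_kill b ij.
  exists b'; split; first exact: equi_trans bb'.
  move=> k; rewrite inE => /predU1P[->//|kt].
  by apply: b'0; [apply: contraNneq it => <-|exact: b0].
have [b1 [bb1 im1 b1E]] := equi_real b i.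
have {}b0 k : k != i -> b1 k = 0 by move=> ki; rewrite b1E ?b0//; right.
have {bb1}ab := equi_trans ab bb1.
have b1i : b1 = fun k => if k == i then (complex.Re (b1 i))%:C%C else 0.
  apply/funext => k; have [->|/b0//] := eqVneq k i.
  by case: (b1 i) im1 => x y /= ->.
have [r0|r0] := leP 0 (complex.Re (b1 i)).
  by exists (complex.Re (b1 i)) => //; rewrite -b1i.
exists (- complex.Re (b1 i)); first by rewrite oppr_ge0 ltW.
(* A sign change is a half turn, which [iint_rot] excludes; it is performed as two quarter turns. *)
have e1 : 0 ^+ 2 + 1 ^+ 2 = 1 :> R by rewrite expr0n expr1n add0r.
have := equi_trans ab (equi_trans (equi_phase _ i (lexx 0) e1) (equi_phase _ i (lexx 0) e1)).
congr equi; apply/funext => k; rewrite /phase b1i; case: eqP => // _.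
by apply/eqP; rewrite eq_complex/= eqxx; apply/andP; split; apply/eqP; ring.
Qed.

End Reduction.

End ComplexCoordinates.

(** * One-dimensional integral estimates *)

Section RealEstimates.
Variable R : realType.
Local Notation mu := (@lebesgue_measure R).

Lemma powR_comparable (M r t s : R) : 1 <= M -> 0 < r -> r / M <= t -> t <= M * r ->
  t `^ s <= M `^ `|s| * r `^ s.
Proof.
move=> M1 r0 rt tr.
have M0 : 0 < M by rewrite (lt_le_trans ltr01).
have t0 : 0 < t by rewrite (lt_le_trans _ rt)// divr_gt0.
have pow_le (x y u : R) : 0 <= u -> 0 < x -> x <= y -> x `^ u <= y `^ u.
  move=> u0 x0 xy; apply: ge0_ler_powR => //; rewrite nnegrE ltW//; exact: lt_le_trans xy.
have [s0|s0] := leP 0 s.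
  by rewrite ger0_norm// -powRM ?(ltW M0) ?(ltW r0)//; exact: pow_le.
rewrite ltr0_norm//; move: (- s) (opprK s) s0 => u <-; rewrite oppr_lt0 => /ltW u0.
rewrite !powRN ler_pdivlMr ?powR_gt0// mulrC ler_pdivrMr ?powR_gt0//.
rewrite -powRM ?(ltW M0) ?(ltW t0)//; apply: pow_le => //.
by rewrite mulrC -ler_pdivrMr.
Qed.

Lemma nneseries_le_bound (u : nat -> \bar R) (B : \bar R) : (forall i, 0 <= u i)%E ->
  (forall n, \sum_(0 <= i < n) u i <= B)%E -> (\sum_(i <oo) u i <= B)%E.
Proof. by move=> u0 uB; apply: lime_le; [exact: is_cvg_nneseries|exact: nearW]. Qed.

Lemma le_nneseries_term (u : nat -> \bar R) k : (forall i, 0 <= u i)%E ->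
  (u k <= \sum_(i <oo) u i)%E.
Proof.
move=> u0; apply: le_trans (nneseries_lim_ge k.+1 (fun i _ _ => u0 i)).
by rewrite big_nat_recr//= leeDr// sume_ge0.
Qed.

Lemma geometric_nneseries (K q : R) : 0 <= K -> 0 < q < 1 ->
  (\sum_(i <oo) (K * q ^+ i)%:E <= (K / (1 - q))%:E)%E.
Proof.
move=> K0 /andP[q0 q1]; apply: nneseries_le_bound.
  by move=> i; rewrite lee_fin mulr_ge0// exprn_ge0// ltW.
move=> n; rewrite sumEFin lee_fin; apply: (@geometric_le_lim R n K q) => //.
by rewrite ger0_norm// ltW.
Qed.

Lemma integral_interval (X r : R) : 0 < r ->
  (\int[mu]_x (if `|x - X| < r then 1 else 0)%:E = (2 * r)%:E)%E.
Proof.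
move=> r0.
transitivity (\int[mu]_x (\1_(`](X - r), (X + r)[%classic) x)%:E)%E.
  apply: eq_integral => x _; congr EFin; rewrite indicE mem_setE in_itv/=.
  by rewrite ltr_distl; case: ifP.
rewrite integral_indic//= setIT lebesgue_measure_itv/= lte_fin.
rewrite ifT; last by rewrite ltrBlDr -addrA ltrDl addr_gt0.
by rewrite -EFinB; congr EFin; lra.
Qed.

Lemma measurable_dist (X : R) : measurable_fun setT (fun x : R => `|x - X|).
Proof.
apply: (@measurableT_comp _ _ _ _ _ _ (@Num.Def.normr R R) setT (fun x : R => x - X)) => //.
exact: measurable_funB.
Qed.

(** The function is dominated by the sum of the steps [c k] on the intervals of radius [r k], whose
    integrals [2 * c k * r k] are bounded by a geometric sequence. Singular integrals reduce in this
    way to lengths of dyadic intervals. *)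
Lemma integral_le_geometric (f : R -> R) (X K q : R) (c r : nat -> R) :
  0 <= K -> 0 < q < 1 -> (forall x, 0 <= f x) ->
  (forall k, 0 <= c k) -> (forall k, 0 < r k) ->
  (forall k, c k * r k <= K * q ^+ k) ->
  (forall x, f x = 0 \/ exists k, `|x - X| < r k /\ f x <= c k) ->
  (\int[mu]_x (f x)%:E <= (2 * K / (1 - q))%:E)%E.
Proof.
move=> K0 q01 f0 c0 r0 crK fP.
pose g k x : R := c k * (if `|x - X| < r k then 1 else 0).
have g0 k x : (0 <= (g k x)%:E)%E by rewrite lee_fin /g; case: ifP; rewrite ?mulr1 ?mulr0.
have mi k : measurable_fun setT (fun x : R => if `|x - X| < r k then 1 else 0 : R).
  apply: measurable_fun_ifT => //; apply: measurable_fun_ltr => //.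
  exact: measurable_dist.
apply: (@le_trans _ _ (\int[mu]_x \sum_(k <oo) (g k x)%:E)%E).
  apply: le_integral_nonneg => [x|x]; first by rewrite lee_fin.
  have [->|[k [xk fk]]] := fP x; first by apply: nneseries_ge0.
  apply: le_trans (le_nneseries_term k (g0^~ x)).
  by rewrite lee_fin /g xk mulr1.
rewrite integral_nneseries//; last first.
  by move=> k; apply/measurable_EFinP; apply: measurable_funM; [exact: measurable_cst|exact: mi].
apply: le_trans (geometric_nneseries (mulr_ge0 _ K0) q01) => //.
apply: lee_nneseries => k; first by move=> *; exact: integral_ge0.
move=> _; rewrite /g; under eq_integral do rewrite EFinM.
rewrite ge0_integralZl_EFin//; last 2 first.
- by move=> x _; rewrite lee_fin; case: ifP.
- by apply/measurable_EFinP; exact: mi.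
rewrite integral_interval// -EFinM lee_fin mulrCA -mulrA ler_pM2l//.
Qed.

Lemma dyadic_small (r t : R) : 0 < t < r -> exists k, r / 2 ^+ k.+1 <= t < r / 2 ^+ k.
Proof.
move=> /andP[t0 tr].
have ex : exists k, r / 2 ^+ k <= t.
  exists (Num.trunc (r / t)).+1.
  have r0 : 0 < r by exact: lt_trans tr.
  rewrite ler_pdivrMr ?exprn_gt0// mulrC -ler_pdivrMr// ltW//.
  apply: lt_trans (truncnS_gt _) _.
  by rewrite -natrX ltr_nat ltn_expl.
case: (ex_minnP ex) => -[|k] kt kmin; first by move: kt; rewrite expr0 divr1 leNgt tr.
exists k; rewrite kt/= ltNge; apply/negP => /kmin; by rewrite ltnn.
Qed.

Lemma dyadic_large (r t : R) : 0 < r <= t -> exists k, r * 2 ^+ k <= t < r * 2 ^+ k.+1.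
Proof.
move=> /andP[r0 rt].
have ex : exists k, t < r * 2 ^+ k.
  exists (Num.trunc (t / r)).+1.
  rewrite mulrC -ltr_pdivrMr//; apply: lt_trans (truncnS_gt _) _.
  by rewrite -natrX ltr_nat ltn_expl.
case: (ex_minnP ex) => -[|k] kt kmin; first by move: kt; rewrite expr0 mulr1 ltNge rt.
exists k; rewrite kt/= andbT leNgt; apply/negP => /kmin; by rewrite ltnn.
Qed.

Lemma measurable_powR_comp d (T : measurableType d) (f : T -> R) (s : R) :
  measurable_fun setT f -> measurable_fun setT (fun x => f x `^ s).
Proof.
exact: (@measurableT_comp _ _ _ _ _ _ (fun y : R => y `^ s) setT f (measurable_powR s)).
Qed.

Lemma powRX2 (u : R) k : (2 ^+ k : R) `^ u = (2 `^ u) ^+ k.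
Proof.
by rewrite -(powR_mulrn k (ler0n R 2)) -powRrM mulrC powRrM powR_mulrn// powR_ge0.
Qed.

Lemma powR_inv_exp2 (u : R) k : (2 ^+ k)^-1 `^ u = (2 `^ (- u)) ^+ k.
Proof.
by rewrite -(powR_invn k (ler0n R 2)) -powRrM mulNr -mulrN mulrC powRrM powR_mulrn ?powR_ge0.
Qed.

Lemma powRD_gt0 (x u v : R) : 0 < x -> x `^ (u + v) = x `^ u * x `^ v.
Proof. by move=> x0; rewrite powRD// (gt_eqF x0) implybT. Qed.

Lemma powR_succ (x u : R) : 0 < x -> x `^ (u + 1) = x `^ u * x.
Proof. by move=> x0; rewrite powRD_gt0// powRr1// ltW. Qed.

Lemma powR2N_lt1 (u : R) : 0 < u -> 0 < (2 : R) `^ (- u) < 1.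
Proof.
move=> u0; rewrite powR_gt0//= powRN invf_lt1 ?powR_gt0//.
have {1}<- : (1 : R) `^ u = 1 by rewrite powR1.
by apply: gt0_ltr_powR; rewrite ?nnegrE ?ltr1n.
Qed.

Lemma le_powR (x y u : R) : 0 <= u -> 0 <= x -> x <= y -> x `^ u <= y `^ u.
Proof. by move=> u0 x0 xy; apply: ge0_ler_powR => //; rewrite nnegrE//; exact: le_trans xy. Qed.

Lemma le_powRN (x y u : R) : 0 <= u -> 0 < x -> x <= y -> y `^ (- u) <= x `^ (- u).
Proof.
move=> u0 x0 xy; have y0 := lt_le_trans x0 xy.
by rewrite !powRN lef_pV2 ?posrE ?powR_gt0//; apply: le_powR => //; exact: ltW.
Qed.

(** On the annulus [r / 2^(k+1) <= |x - X| < r / 2^k] the integrand is comparable to [(r / 2^k)^s];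
    the contributions decay with ratio [2^(-(s+1))], below 1 because [s > -1]. *)
Lemma integral_near (s : R) : -1 < s -> exists2 C : R, 0 <= C & forall X r : R, 0 < r ->
  (\int[mu]_x (if (`|x - X| < r)%R then `|x - X| `^ s else 0)%:E <= (C * r `^ (s + 1))%:E)%E.
Proof.
move=> s1; have s10 : 0 < s + 1 by lra.
have q01 := powR2N_lt1 s10; set q := 2 `^ (- (s + 1)) in q01.
exists (2 * 2 `^ `|s| / (1 - q)).
  by rewrite divr_ge0 ?mulr_ge0 ?powR_ge0// subr_ge0 ltW//; case/andP: q01.
move=> X r r0.
have rk k : 0 < r / 2 ^+ k by rewrite divr_gt0// exprn_gt0.
have -> : 2 * 2 `^ `|s| / (1 - q) * r `^ (s + 1) = 2 * (2 `^ `|s| * r `^ (s + 1)) / (1 - q).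
  by field; rewrite subr_eq0 gt_eqF//; case/andP: q01.
apply: (integral_le_geometric (X := X) (c := fun k => 2 `^ `|s| * (r / 2 ^+ k) `^ s)
  (r := fun k => r / 2 ^+ k)) => //.
- by rewrite mulr_ge0 ?powR_ge0.
- by move=> x; case: ifP => // _; exact: powR_ge0.
- by move=> k; rewrite mulr_ge0 ?powR_ge0.
- move=> k; rewrite -mulrA -powR_succ// powRM ?invr_ge0 ?exprn_ge0 ?(ltW r0)//.
  by rewrite powR_inv_exp2 mulrA.
- move=> x; case: ifPn => [xr|_]; last by left.
  (* The centre lies in no annulus. There [powR] takes the value 0, except for [s = 0], where the
     value 1 is covered by [k = 0]. *)
  have [x0|x0] := eqVneq `|x - X| 0.
    rewrite x0; have [->|sn0] := eqVneq s 0; last by left; rewrite powR0.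
    by right; exists 0%N; rewrite rk !powRr0 normr0 powRr0 mulr1.
  have /dyadic_small[k /andP[k1 k2]] : 0 < `|x - X| < r by rewrite lt_def x0 normr_ge0.
  right; exists k; split => //; apply: powR_comparable => //; first by rewrite ler1n.
    by move: k1; rewrite exprSr invfM mulrA.
  by rewrite (le_trans (ltW k2))// ler_peMl ?ler1n// ltW.
Qed.

Lemma measurable_if_lt d (T : measurableType d) (f g h k : T -> R) :
  measurable_fun setT f -> measurable_fun setT g -> measurable_fun setT h ->
  measurable_fun setT k -> measurable_fun setT (fun x => if f x < g x then h x else k x).
Proof. by move=> mf mg mh mk; apply: measurable_fun_ifT => //; exact: measurable_fun_ltr. Qed.

(** Cut at distance [E]. Inside, the second factor is at most [E^(-m)] and [integral_near] applies;
    outside, the integrand is at most [|x - X|^(s - m)], and the dyadic annuli have ratio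
    [2^(s + 1 - m) < 1]. *)
Lemma integral_far (s m : R) : -1 < s -> s + 1 < m -> exists2 C : R, 0 <= C & forall X E : R, 0 < E ->
  (\int[mu]_x (`|x - X| `^ s * (E + `|x - X|) `^ (- m))%:E <= (C * E `^ (s + 1 - m))%:E)%E.
Proof.
move=> s1 sm; have [C C0 near_s] := integral_near s1.
have m0 : 0 < m by lra.
have sm0 : 0 < m - (s + 1) by lra.
have q01 := powR2N_lt1 sm0; set q := 2 `^ (- (m - (s + 1))) in q01.
have q1 : 0 < 1 - q by rewrite subr_gt0; case/andP: q01.
exists (C + 4 / (1 - q)); first by rewrite addr_ge0// divr_ge0// ltW.
move=> X E E0.
pose f1 (x : R) : R := if `|x - X| < E then `|x - X| `^ s else 0.
pose f2 (x : R) : R := if `|x - X| < E then 0 else `|x - X| `^ (s - m).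
have f10 x : 0 <= f1 x by rewrite /f1; case: ifP => // _; exact: powR_ge0.
have f20 x : 0 <= f2 x by rewrite /f2; case: ifP => // _; exact: powR_ge0.
have mf1 : measurable_fun setT f1.
  apply: measurable_if_lt; [exact: measurable_dist|exact: measurable_cst| |exact: measurable_cst].
  by apply: measurable_powR_comp; exact: measurable_dist.
have mf2 : measurable_fun setT f2.
  apply: measurable_if_lt; [exact: measurable_dist|exact: measurable_cst|exact: measurable_cst|].
  by apply: measurable_powR_comp; exact: measurable_dist.
apply: (@le_trans _ _ (\int[mu]_x ((E `^ (- m))%:E * (f1 x)%:E + (f2 x)%:E))%E).
  apply: le_integral_nonneg => x; first by rewrite lee_fin mulr_ge0 ?powR_ge0.
  rewrite -EFinM -EFinD lee_fin /f1 /f2; case: ltP => xE.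
    rewrite addr0 mulrC ler_wpM2r ?powR_ge0//; apply: le_powRN => //; first exact: ltW.
    by rewrite lerDl.
  have x0 : 0 < `|x - X| by exact: lt_le_trans xE.
  rewrite mulr0 add0r powRD_gt0//.
  rewrite ler_wpM2l ?powR_ge0//; apply: le_powRN => //; first exact: ltW.
  by rewrite lerDr ltW.
rewrite ge0_integralD//; last 4 first.
- by move=> x _; rewrite -EFinM lee_fin mulr_ge0 ?powR_ge0.
- by apply/measurable_EFinP; apply: measurable_funM => //; exact: measurable_cst.
- by move=> x _; rewrite lee_fin.
- exact/measurable_EFinP.
rewrite ge0_integralZl_EFin ?powR_ge0//; last 2 first.
- by move=> x _; rewrite lee_fin.
- exact/measurable_EFinP.
rewrite mulrDl EFinD; apply: leeD.
  rewrite (_ : (C * _)%:E = (E `^ (- m))%:E * (C * E `^ (s + 1))%:E)%E; last first.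
    rewrite -EFinM mulrCA; congr (_ * _)%:E.
    by rewrite -powRD_gt0// addrC.
  by rewrite lee_pmul2l ?fin_numE// ?lte_fin ?powR_gt0//; exact: near_s.
have -> : 4 / (1 - q) * E `^ (s + 1 - m) = 2 * (2 * E `^ (s + 1 - m)) / (1 - q).
  by field; rewrite gt_eqF.
apply: (integral_le_geometric (X := X) (c := fun k => (E * 2 ^+ k) `^ (s - m))
  (r := fun k => E * 2 ^+ k.+1)) => //.
- by rewrite mulr_ge0 ?powR_ge0.
- by move=> k; exact: powR_ge0.
- by move=> k; rewrite mulr_gt0// exprn_gt0.
- move=> k; have E2 : 0 < E * 2 ^+ k by rewrite mulr_gt0// exprn_gt0.
  have -> : (E * 2 ^+ k) `^ (s - m) * (E * 2 ^+ k.+1) = 2 * ((E * 2 ^+ k) `^ (s - m) * (E * 2 ^+ k)).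
    by rewrite exprSr; ring.
  rewrite -powR_succ// (_ : s - m + 1 = s + 1 - m); last by lra.
  by rewrite powRM ?exprn_ge0 ?(ltW E0)// powRX2 /q opprB mulrA.
- move=> x; rewrite /f2; case: ltP => [_|Ex]; first by left.
  right; have /dyadic_large[k /andP[k1 k2]] : 0 < E <= `|x - X| by rewrite E0.
  exists k; split => //; rewrite -[s - m]opprK opprB; apply: le_powRN => //.
    by rewrite subr_ge0; lra.
  by rewrite mulr_gt0// exprn_gt0.
Qed.

(** [powR] does not vanish at a negative base; the truncation turns integrals over the whole space
    into integrals over balls. *)
Definition ppow (s x : R) : R := if 0 < x then x `^ s else 0.

Lemma ppow_ge0 s x : 0 <= ppow s x.
Proof. by rewrite /ppow; case: ifP => // _; exact: powR_ge0. Qed.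

Lemma measurable_ppow d (T : measurableType d) (s : R) (f : T -> R) :
  measurable_fun setT f -> measurable_fun setT (fun x => ppow s (f x)).
Proof.
move=> mf; apply: measurable_if_lt => //; exact: measurable_powR_comp.
Qed.

(** With [X = sqrt A], write [A - x^2 = (X + |x|) (X - |x|)]. The first factor lies between [X] and
    [2 X], and the second is the distance to the nearer of the endpoints [X] and [-X]. The powers
    [X^s] and [X^(s+1)] combine to [A^(s + 1/2)]. *)
Lemma integral_ball1 (s : R) : -1 < s -> exists2 C : R, 0 <= C & forall A : R,
  (\int[mu]_x (ppow s (A - x ^+ 2))%:E <= (C * ppow (s + 2^-1) A)%:E)%E.
Proof.
move=> s1; have [C C0 near_s] := integral_near s1.
exists (2 * 2 `^ `|s| * C * 2 `^ (s + 1)).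
  by rewrite !mulr_ge0 ?powR_ge0.
move=> A; have [A0|A0] := leP A 0.
  rewrite {2}/ppow ltNge A0/= mulr0 integral0_eq// => x _.
  by rewrite /ppow ifF// ltNge (le_trans _ A0)// gerBl sqr_ge0.
pose X : R := Num.sqrt A; have X0 : 0 < X by rewrite sqrtr_gt0.
have X2 : X ^+ 2 = A by rewrite sqr_sqrtr// ltW.
pose f (Y x : R) : R := if `|x - Y| < 2 * X then `|x - Y| `^ s else 0.
have f0 Y x : 0 <= f Y x by rewrite /f; case: ifP => // _; exact: powR_ge0.
have mf Y : measurable_fun setT (EFin \o f Y).
  apply/measurable_EFinP.
  apply: measurable_if_lt; [exact: measurable_dist|exact: measurable_cst| |exact: measurable_cst].
  by apply: measurable_powR_comp; exact: measurable_dist.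
have M0 : 0 <= 2 `^ `|s| * X `^ s by rewrite mulr_ge0 ?powR_ge0.
apply: (@le_trans _ _ (\int[mu]_x ((2 `^ `|s| * X `^ s)%:E * ((f X x)%:E + (f (- X) x)%:E)))%E).
  apply: le_integral_nonneg => x; first by rewrite lee_fin ppow_ge0.
  rewrite -EFinD -EFinM lee_fin /ppow; case: ifPn => [xA|_]; last by rewrite mulr_ge0// addr_ge0.
  have xX : `|x| < X.
    by rewrite -ltr_sqr ?nnegrE ?normr_ge0 ?(ltW X0)// real_normK ?num_real// X2 -subr_gt0.
  have key : (A - x ^+ 2) `^ s <= 2 `^ `|s| * X `^ s * (X - `|x|) `^ s.
    have -> : A - x ^+ 2 = (X + `|x|) * (X - `|x|).
      by rewrite -X2 -[x ^+ 2](real_normK (num_real x)); ring.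
    rewrite powRM ?subr_ge0 ?(ltW xX) ?addr_ge0 ?(ltW X0)//.
    rewrite ler_wpM2r ?powR_ge0//; apply: powR_comparable => //; first by rewrite ler1n.
      by rewrite (le_trans (_ : _ <= X))// ?lerDl// ler_pdivrMr// ler_peMr ?ler1n// ltW.
    by rewrite mulr_natl mulr2n lerD2l ltW.
  apply: (le_trans key); rewrite ler_wpM2l//.
  have [x0|x0] := leP 0 x; last first.
    rewrite [in leLHS]ltr0_norm// opprK -[leLHS]add0r lerD// /f opprK.
    move: xX; rewrite ltr_norml => /andP[Xx _].
    have -> : `|x + X| = X + x by rewrite ger0_norm addrC// ltW// -ltrBlDl sub0r.
    by rewrite ifT//; lra.
  rewrite [in leLHS]ger0_norm// -[leLHS]addr0 lerD// /f.
  move: xX; rewrite ger0_norm// => xX.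
  have -> : `|x - X| = X - x by rewrite distrC ger0_norm// subr_ge0 ltW.
  by rewrite ifT//; lra.
rewrite ge0_integralZl_EFin//; last 2 first.
- by move=> x _; rewrite -EFinD lee_fin addr_ge0.
- by apply: emeasurable_funD; exact: mf.
rewrite ge0_integralD; first last.
- exact: mf.
- by move=> x _; rewrite lee_fin.
- exact: mf.
- by move=> x _; rewrite lee_fin.
- exact: measurableT.
apply: (@le_trans _ _ ((2 `^ `|s| * X `^ s)%:E * ((C * (2 * X) `^ (s + 1))%:E + (C * (2 * X) `^ (s + 1))%:E))%E).
  by rewrite lee_wpmul2l ?lee_fin//; apply: leeD; apply: near_s; rewrite mulr_gt0.
rewrite -EFinD -EFinM lee_fin /ppow A0 powRM ?(ltW X0)//.
have -> : A `^ (s + 2^-1) = X `^ s * X `^ (s + 1).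
  rewrite -powRD_gt0// -X2 -powR_mulrn ?(ltW X0)// -powRrM; congr powR; lra.
rewrite le_eqVlt; apply/orP; left; apply/eqP. ring.
Qed.

End RealEstimates.

(** * Forelli-Rudin estimates *)

Section BallEstimates.
Variable R : realType.
Local Notation mu := (@lebesgue_measure R).
Implicit Types (w : nat -> R).

Lemma le_integral_lin2 (f g : R -> R) (a b A B : R) : 0 <= a -> 0 <= b ->
  (forall x, 0 <= f x) -> (forall x, 0 <= g x) ->
  measurable_fun setT f -> measurable_fun setT g ->
  (\int[mu]_x (f x)%:E <= A%:E)%E -> (\int[mu]_x (g x)%:E <= B%:E)%E ->
  (\int[mu]_x (a * f x + b * g x)%:E <= (a * A + b * B)%:E)%E.
Proof.
move=> a0 b0 f0 g0 mf mg fA gB.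
under eq_integral do rewrite EFinD !EFinM.
have mZ (c : R) (h : R -> R) : measurable_fun setT h ->
    measurable_fun setT (fun x => (c%:E * (h x)%:E)%E).
  by move=> mh; apply/measurable_EFinP; apply: measurable_funM => //; exact: measurable_cst.
rewrite ge0_integralD; first last.
- exact: mZ.
- by move=> x _; rewrite -EFinM lee_fin mulr_ge0.
- exact: mZ.
- by move=> x _; rewrite -EFinM lee_fin mulr_ge0.
- exact: measurableT.
rewrite !ge0_integralZl_EFin//; try exact/measurable_EFinP; try by move=> x _; rewrite lee_fin.
by rewrite EFinD !EFinM; apply: leeD; rewrite lee_wpmul2l// lee_fin.
Qed.

Lemma powR_invN (x l : R) : 0 <= x -> x^-1 `^ (- l) = x `^ l.
Proof. by move=> x0; rewrite -(powR_inv1 x0) -powRrM mulN1r opprK. Qed.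

Lemma Re_le_cmod (z : R[i]) : `|complex.Re z| <= cmod z.
Proof.
rewrite -ler_sqr ?nnegrE ?sqrtr_ge0// cmod2E real_normK ?num_real// lerDl; exact: sqr_ge0.
Qed.

Lemma Im_le_cmod (z : R[i]) : `|complex.Im z| <= cmod z.
Proof.
rewrite -ler_sqr ?nnegrE ?sqrtr_ge0// cmod2E real_normK ?num_real// lerDr; exact: sqr_ge0.
Qed.

Let ker (r x y : R) := cmod (1 - Complex x y * r%:C%C).

Let ker_Re r x y : `|1 - x * r| <= ker r x y.
Proof.
apply: le_trans (Re_le_cmod _).
by rewrite /= mulr0 subr0.
Qed.

Let ker_Im r x y : `|y * r| <= ker r x y.
Proof.
apply: le_trans (Im_le_cmod _).
by rewrite /= mulr0 !add0r normrN.
Qed.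

(** The kernel is small only near the point 1. If [x <= 0] or [|y| >= 1/2] it is at least 1/3, which
    gives the first term. Otherwise [1 - y^2 - x^2] is comparable to the distance of [x] to the
    right end [X] of its slice, and the kernel is at least a quarter of
    [(1 - r) + |y| + (X - x)]. *)
Lemma disc_kernel_le (s l r x y : R) : 0 <= l -> 0 <= r < 1 ->
  ppow s (1 - y ^+ 2 - x ^+ 2) * ker r x y `^ (- l) <=
  3 `^ l * ppow s (1 - y ^+ 2 - x ^+ 2) +
  2 `^ `|s| * 4 `^ l *
    (`|x - Num.sqrt (1 - y ^+ 2)| `^ s *
     ((1 - r + `|y|) + `|x - Num.sqrt (1 - y ^+ 2)|) `^ (- l)).
Proof.
move=> l0 /andP[r0 r1]; set X := Num.sqrt _.
have [xy|xy] := ltP 0 (1 - y ^+ 2 - x ^+ 2); last first.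
  by rewrite /ppow ltNge xy/= mul0r mulr0 add0r !mulr_ge0 ?powR_ge0.
have k0 : 0 <= ker r x y by exact: sqrtr_ge0.
have x1 : `|x| < 1.
  rewrite -ltr_sqr ?nnegrE// real_normK ?num_real// expr1n -subr_gt0.
  by rewrite (lt_le_trans xy)// lerD2r gerBl sqr_ge0.
have far : 3^-1 <= ker r x y -> ker r x y `^ (- l) <= 3 `^ l.
  by move=> k3; rewrite -(powR_invN l (ler0n R 3)); apply: le_powRN => //; rewrite invr_gt0.
have kRe := ker_Re r x y; have kIm := ker_Im r x y.
have F0 : 0 <= 2 `^ `|s| * 4 `^ l * (`|x - X| `^ s * ((1 - r + `|y|) + `|x - X|) `^ (- l)).
  by rewrite !mulr_ge0 ?powR_ge0.
have N0 : 0 <= 3 `^ l * ppow s (1 - y ^+ 2 - x ^+ 2) by rewrite mulr_ge0 ?powR_ge0 ?ppow_ge0.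
have farE : 3^-1 <= ker r x y -> ppow s (1 - y ^+ 2 - x ^+ 2) * ker r x y `^ (- l) <=
    3 `^ l * ppow s (1 - y ^+ 2 - x ^+ 2).
  by move=> /far k3; rewrite mulrC ler_wpM2r ?ppow_ge0.
have [x0|x0] := leP x 0.
  rewrite -[leLHS]addr0 lerD// farE//; apply: le_trans kRe; rewrite ger0_norm; nra.
have {}x1 : x < 1 by apply: le_lt_trans x1; exact: ler_norm.
have [y0|y0] := leP 2^-1 `|y|.
  rewrite -[leLHS]addr0 lerD// farE//.
  have [r2|r2] := leP (2 / 3) r.
    apply: le_trans kIm; rewrite normrM (ger0_norm r0); nra.
  apply: le_trans kRe; rewrite ger0_norm; nra.
rewrite -[leLHS]add0r lerD//.
have y2 : y ^+ 2 <= 4^-1.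
  rewrite -(real_normK (num_real y)); have := normr_ge0 y; nra.
have X2 : X ^+ 2 = 1 - y ^+ 2 by rewrite sqr_sqrtr//; lra.
have X0 : 0 <= X by exact: sqrtr_ge0.
have Xh : 2^-1 <= X by rewrite -(ler_pXn2r (n := 2)) ?nnegrE// X2; lra.
have X1 : X <= 1 by rewrite -(ler_pXn2r (n := 2)) ?nnegrE// X2 expr1n gerBl sqr_ge0.
have xX : x < X by rewrite -ltr_sqr ?nnegrE ?(ltW x0)// X2; lra.
have -> : `|x - X| = X - x by rewrite distrC ger0_norm// subr_ge0 ltW.
have S0 : 0 < 1 - r + `|y| + (X - x) by have := normr_ge0 y; lra.
have kS : (1 - r + `|y| + (X - x)) / 4 <= ker r x y.
  rewrite ler_pdivrMr//.
  have xr : 0 <= 1 - x * r by nra.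
  have k1 : 1 - x * r <= ker r x y by rewrite -(ger0_norm xr).
  have k2 : `|y| <= 2 * ker r x y.
    have [r2|r2] := leP 2^-1 r; last by nra.
    move: kIm; rewrite normrM (ger0_norm r0); have := normr_ge0 y; nra.
  nra.
have -> : 2 `^ `|s| * 4 `^ l * ((X - x) `^ s * (1 - r + `|y| + (X - x)) `^ (- l)) =
  (2 `^ `|s| * (X - x) `^ s) * ((1 - r + `|y| + (X - x)) / 4) `^ (- l).
  by rewrite powRM ?(ltW S0)// powR_invN//; ring.
apply: ler_pM; [exact: ppow_ge0|exact: powR_ge0| |by apply: le_powRN => //; rewrite divr_gt0].
rewrite /ppow xy; apply: powR_comparable; first by rewrite ler1n.
- by rewrite subr_gt0.
- by rewrite -X2 ler_pdivrMr//; nra.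
- by rewrite -X2; nra.
Qed.

(** Integration in [x] leaves a bounded-type term in [1 - y^2] and the power
    [(1 - r + |y|)^(-(1 + c))]; integration in [y] then produces [(1 - r)^(-c)]. *)
Lemma disc_estimate (s c : R) : -1 < s -> 0 < c -> exists2 C : R, 0 <= C & forall r : R, 0 <= r < 1 ->
  (\int[mu]_y \int[mu]_x
     (ppow s (1 - y ^+ 2 - x ^+ 2) * ker r x y `^ (- (2 + s + c)))%:E
   <= (C * (1 - r) `^ (- c))%:E)%E.
Proof.
move=> s1 c0; set l := 2 + s + c; have l0 : 0 <= l by rewrite /l; lra.
have [C1 C10 ball1] := integral_ball1 s1.
have s2 : -1 < s + 2^-1 by lra.
have [C2 C20 ball2] := integral_ball1 s2.
have sl : s + 1 < l by rewrite /l; lra.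
have [C3 C30 far1] := integral_far s1 sl.
have o1 : -1 < (0 : R) by lra.
have oc : 0 + 1 < 1 + c by lra.
have [C4 C40 far2] := integral_far o1 oc.
exists (3 `^ l * C1 * C2 + 2 `^ `|s| * 4 `^ l * C3 * C4).
  by rewrite addr_ge0// !mulr_ge0 ?powR_ge0.
move=> r r01; have /andP[r0 r1] := r01.
have e0 : 0 < 1 - r by rewrite subr_gt0.
have yE (y : R) : 0 < 1 - r + `|y| by rewrite ltr_wpDr.
(* The factor [|y - 0| ^ 0] equals 1 and puts the term in the form of [integral_far] with exponent 0
   and centre 0. *)
have inner (y : R) : (\int[mu]_x (ppow s (1 - y ^+ 2 - x ^+ 2) * ker r x y `^ (- l))%:E <=
    ((3 `^ l * C1) * ppow (s + 2^-1) (1 - y ^+ 2) +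
     (2 `^ `|s| * 4 `^ l * C3) * (`|y - 0| `^ 0 * (1 - r + `|y - 0|) `^ (- (1 + c))))%:E)%E.
  apply: le_trans (_ : (_ <= \int[mu]_x (_ * ppow s (1 - y ^+ 2 - x ^+ 2) + _ * (`|x - Num.sqrt (1 - y ^+ 2)| `^ s *
     ((1 - r + `|y|) + `|x - Num.sqrt (1 - y ^+ 2)|) `^ (- l)))%:E)%E) _.
    apply: le_integral_nonneg => x.
      by rewrite lee_fin mulr_ge0 ?ppow_ge0 ?powR_ge0.
    by rewrite lee_fin; exact: disc_kernel_le.
  rewrite subr0 powRr0 mul1r -!(mulrA _ C1) -(mulrA _ C3).
  apply: le_integral_lin2; rewrite ?mulr_ge0 ?powR_ge0//.
  - by move=> x; exact: ppow_ge0.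
  - by move=> x; rewrite mulr_ge0 ?powR_ge0.
  - apply: measurable_ppow; apply: measurable_funB; first exact: measurable_cst.
    exact: measurable_funX.
  - apply: measurable_funM; apply: measurable_powR_comp; first exact: measurable_dist.
    by apply: measurable_funD; [exact: measurable_cst|exact: measurable_dist].
  - have -> : - (1 + c) = s + 1 - l by rewrite /l; lra.
    exact: far1.
apply: (@le_trans _ _ (\int[mu]_y ((3 `^ l * C1) * ppow (s + 2^-1) (1 - y ^+ 2) +
     (2 `^ `|s| * 4 `^ l * C3) * (`|y - 0| `^ 0 * (1 - r + `|y - 0|) `^ (- (1 + c))))%:E)%E).
  apply: le_integral_nonneg => y; last exact: inner.
  by apply: integral_ge0 => x _; rewrite lee_fin mulr_ge0 ?ppow_ge0 ?powR_ge0.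
apply: (@le_trans _ _ ((3 `^ l * C1) * (C2 * 1) +
     (2 `^ `|s| * 4 `^ l * C3) * (C4 * (1 - r) `^ (0 + 1 - (1 + c))))%:E).
  apply: le_integral_lin2; rewrite ?mulr_ge0 ?powR_ge0//.
  - by move=> x; exact: ppow_ge0.
  - by move=> x; rewrite mulr_ge0 ?powR_ge0.
  - apply: measurable_ppow; apply: measurable_funB; first exact: measurable_cst.
    exact: measurable_funX.
  - apply: measurable_funM; apply: measurable_powR_comp; first exact: measurable_dist.
    by apply: measurable_funD; [exact: measurable_cst|exact: measurable_dist].
  - apply: le_trans (ball2 1) _; by rewrite /ppow ltr01 powR1.
  - exact: far2.
rewrite lee_fin (_ : 0 + 1 - (1 + c) = - c); last by lra.
rewrite mulrDl; apply: lerD; last by rewrite !mulrA.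
(* The constant contribution is absorbed because [(1 - r)^(-c) >= 1]. *)
rewrite mulr1 ler_peMr ?mulr_ge0 ?powR_ge0// powRN invf_ge1 ?powR_gt0//.
apply: (@le_trans _ _ ((1 - r) `^ 0)); last by rewrite powRr0.
by apply: ger_powR; rewrite ?e0 ?gerBl// ltW.
Qed.

End BallEstimates.

(** * Integrals over balls and boxes in several real coordinates *)

Section Ball.
Variable R : realType.
Local Notation mu := (@lebesgue_measure R).
Implicit Types (w : nat -> R).

Definition indep (s : seq nat) (A : (nat -> R) -> R) :=
  forall k, k \in s -> forall w x, A (rupd w k x) = A w.

Lemma indep_coord s k (f : R -> R) : k \notin s -> indep s (fun w => f (w k)).
Proof. by move=> ks i si w x; rewrite rupdNE//; apply: contraNneq ks => ->. Qed.

Lemma indep_cons k s A : indep (k :: s) A -> indep s A.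
Proof. by move=> kA i si; apply: kA; rewrite inE si orbT. Qed.

(** Each coordinate integrated out by [integral_ball1] raises the exponent by 1/2. [A] and [B] carry
    the dependence on the coordinates that remain. *)
Lemma iint_ball (s : seq nat) (u : R) : -1 < u -> uniq s ->
  exists2 C : R, 0 <= C & forall A B, indep s A -> indep s B -> (forall w, 0 <= B w) ->
  forall w, (iint s (fun w => (B w * ppow u (A w - \sum_(k <- s) w k ^+ 2))%:E) w <=
             (C * (B w * ppow (u + (size s)%:R / 2) (A w)))%:E)%E.
Proof.
move=> u1; elim: s => [_|k s IH] /=.
  by exists 1 => // A B iA iB B0 w; rewrite big_nil subr0 mul1r mul0r addr0.
move=> /andP[ks /IH[C1 C10 IH1]].
have us1 : -1 < u + (size s)%:R / 2 by rewrite (lt_le_trans u1)// lerDl divr_ge0.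
have [C2 C20 ball1] := integral_ball1 us1.
exists (C1 * C2); first by rewrite mulr_ge0.
move=> A B iA iB B0 w.
have kk : k \in k :: s by rewrite mem_head.
apply: (@le_trans _ _ (\int[mu]_x ((C1 * B w)%:E * (ppow (u + (size s)%:R / 2) (A w - x ^+ 2))%:E))%E).
  apply: le_integral_nonneg => x.
    by apply: iint_ge0 => w'; rewrite lee_fin mulr_ge0 ?ppow_ge0.
  have iA' : indep s (fun w => A w - w k ^+ 2).
    move=> i si w' y; rewrite (indep_cons iA)//.
    by rewrite (indep_coord (fun x => x ^+ 2) ks).
  have := IH1 _ _ iA' (indep_cons iB) B0 (rupd w k x).
  rewrite rupdE (iA _ kk) (iB _ kk) -EFinM mulrA; apply: le_trans.
  apply: le_iint => w'; first by rewrite lee_fin mulr_ge0 ?ppow_ge0.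
  by rewrite big_cons opprD addrA.
rewrite ge0_integralZl_EFin//; last 3 first.
- by move=> x _; rewrite lee_fin ppow_ge0.
- apply/measurable_EFinP; apply: measurable_ppow; apply: measurable_funB; first exact: measurable_cst.
  exact: measurable_funX.
- by rewrite mulr_ge0.
apply: le_trans (_ : ((C1 * B w)%:E * (C2 * ppow (u + (size s)%:R / 2 + 2^-1) (A w))%:E <= _)%E).
  by rewrite lee_wpmul2l ?lee_fin ?mulr_ge0.
rewrite -EFinM lee_fin -[(size s).+1%:R]natr1 mulrDl mul1r addrA.
by rewrite le_eqVlt; apply/orP; left; apply/eqP; ring.
Qed.

Lemma iint_box (s : seq nat) (c rho : nat -> R) : uniq s -> (forall k, 0 < rho k) ->
  forall B, indep s B -> (forall w, 0 <= B w) -> forall w,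
  (iint s (fun w => (B w * (all (fun k => `|w k - c k| < rho k) s)%:R)%:E) w =
   (B w * \prod_(k <- s) (2 * rho k))%:E)%E.
Proof.
move=> us rho0; elim: s us => [_ B iB B0 w|k s IH]; first by rewrite big_nil.
move=> /= /andP[ks us] B iB B0 w.
have kk : k \in k :: s by rewrite mem_head.
pose B' w := B w * (`|w k - c k| < rho k)%R%:R.
have iB' : indep s B'.
  move=> i si w' y; rewrite /B' (indep_cons iB)//.
  by rewrite (indep_coord (fun x => (`|x - c k| < rho k)%R%:R) ks).
have B'0 w' : 0 <= B' w' by rewrite mulr_ge0.
rewrite /cint (eq_iint _ (h := fun w => (B' w * (all (fun k => `|w k - c k| < rho k) s)%:R)%:E)); last first.
  by move=> w'; rewrite /B' -mulrA -natrM mulnb.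
have P0 : 0 <= \prod_(j <- s) (2 * rho j) by rewrite prodr_ge0// => j _; rewrite mulr_ge0// ltW.
transitivity (\int[mu]_x ((B w * \prod_(j <- s) (2 * rho j))%:E *
   (if (`|x - c k| < rho k)%R then 1 else 0)%:E))%E.
  apply: eq_integral => x _; rewrite IH// /B' rupdE (iB _ kk) -EFinM; congr EFin.
  by case: ifP => _; rewrite /= ?mulr1 ?mulr0 ?mul0r.
rewrite ge0_integralZl_EFin//; last 3 first.
- by move=> x _; case: ifP; rewrite lee_fin.
- apply/measurable_EFinP; apply: measurable_if_lt; [exact: measurable_dist|exact: measurable_cst..].
- by rewrite mulr_ge0.
by rewrite integral_interval// -EFinM big_cons; congr EFin; ring.
Qed.

Lemma coords_lt m k : k \in coords m -> (k < m.*2)%N.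
Proof.
elim: m => //= m IH; rewrite !inE doubleS => /or3P[/eqP->|/eqP->|/IH/ltnW/leqW//].
- exact: leqnSn.
- exact: leqnn.
Qed.

Lemma coords_uniq m : uniq (coords m).
Proof.
elim: m => //= m ->; rewrite inE negb_or neq_ltn ltnSn/= andbT; apply/andP; split.
  by apply/negP => /coords_lt; rewrite ltnn.
by apply/negP => /coords_lt; rewrite ltnNge leqnSn.
Qed.

Lemma size_coords m : size (coords m) = m.*2.
Proof. by elim: m => //= m ->; rewrite doubleS. Qed.

Lemma sqnorm_coords m w : sqnorm (vec w : 'I_m -> R[i]) = \sum_(k <- coords m) w k ^+ 2.
Proof.
rewrite /sqnorm; elim: m => [|m IH]; first by rewrite big_ord0 big_nil.
by rewrite big_ord_recr/= IH cmod2E/= !big_cons [RHS]addrA addrC.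
Qed.

Lemma sqnormS m w : sqnorm (vec w : 'I_m.+1 -> R[i]) =
  w m.*2 ^+ 2 + w m.*2.+1 ^+ 2 + \sum_(k <- coords m) w k ^+ 2.
Proof. by rewrite sqnorm_coords/= !big_cons addrA. Qed.

Lemma cinner_axis m (r : R) w :
  cinner (vec w) (fun k : 'I_m.+1 => if k == ord_max then r%:C%C else 0) =
  Complex (w m.*2) (w m.*2.+1) * r%:C%C.
Proof.
rewrite /cinner (bigD1 ord_max)//= eqxx big1 ?addr0; last first.
  by move=> k /negbTE ->; rewrite /cconj conjc0 mulr0.
by rewrite /cconj /vec/=; congr (_ * _); rewrite /conjc/= oppr0.
Qed.

Lemma sqnorm_axis m (r : R) :
  sqnorm (fun k : 'I_m.+1 => if k == ord_max then r%:C%C else 0) = r ^+ 2.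
Proof.
rewrite /sqnorm (bigD1 ord_max)//= eqxx big1 ?addr0; last first.
  by move=> k /negbTE ->; rewrite cmod2E/= expr0n addr0.
by rewrite cmod2E/= expr0n addr0.
Qed.

Lemma Re_cinner n w (a : 'I_n -> R[i]) : complex.Re (cinner (vec w) a) =
  \sum_(j < n) (w j.*2 * complex.Re (a j) + w j.*2.+1 * complex.Im (a j)).
Proof.
rewrite /cinner (big_morph (@complex.Re R) (op1 := +%R) (id1 := 0)) => [|[? ?] [? ?]|]//.
by apply: eq_bigr => j _; rewrite /vec /cconj; case: (a j) => x y /=; ring.
Qed.

Lemma Im_cinner n w (a : 'I_n -> R[i]) : complex.Im (cinner (vec w) a) =
  \sum_(j < n) (w j.*2.+1 * complex.Re (a j) - w j.*2 * complex.Im (a j)).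
Proof.
rewrite /cinner (big_morph (@complex.Im R) (op1 := +%R) (id1 := 0)) => [|[? ?] [? ?]|]//.
by apply: eq_bigr => j _; rewrite /vec /cconj; case: (a j) => x y /=; ring.
Qed.

Lemma tame_invariant n (phi : R -> R[i] -> \bar R) (a : 'I_n -> R[i]) :
  measurable_fun setT (fun p : R * R * R => phi p.1.1 (Complex p.1.2 p.2)) ->
  tame (fun w => phi (sqnorm (vec w : 'I_n -> R[i])) (cinner (vec w) a)).
Proof.
move=> mphi d T f mf.
pose N x := sqnorm (vec (f x) : 'I_n -> R[i]).
pose P x := complex.Re (cinner (vec (f x)) a).
pose Q x := complex.Im (cinner (vec (f x)) a).
have mN : measurable_fun setT N.
  rewrite /N; under eq_fun do rewrite sqnorm_coords.
  by apply: measurable_sum => k; exact: measurable_funX.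
have mP : measurable_fun setT P.
  rewrite /P; under eq_fun do rewrite Re_cinner.
  apply: measurable_sum => k; apply: measurable_funD; apply: measurable_funM => //;
  exact: measurable_cst.
have mQ : measurable_fun setT Q.
  rewrite /Q; under eq_fun do rewrite Im_cinner.
  apply: measurable_sum => k; apply: measurable_funB; apply: measurable_funM => //;
  exact: measurable_cst.
have := measurableT_comp mphi (measurable_fun_pair (measurable_fun_pair mN mP) mQ).
apply: eq_measurable_fun => x _ /=; congr phi.
by rewrite /P /Q; case: (cinner _ _).
Qed.

End Ball.

Section ForelliRudin.
Variable R : realType.
Local Notation mu := (@lebesgue_measure R).
Implicit Types (w : nat -> R).

Lemma cmod_ge0 (z : R[i]) : 0 <= cmod z.
Proof. exact: sqrtr_ge0. Qed.

Lemma measurable_cmod d (T : measurableType d) (f g : T -> R) :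
  measurable_fun setT f -> measurable_fun setT g ->
  measurable_fun setT (fun x => cmod (Complex (f x) (g x))).
Proof.
move=> mf mg; rewrite /cmod/=.
under eq_fun do rewrite -powR12_sqrt ?addr_ge0 ?sqr_ge0//.
by apply: measurable_powR_comp; apply: measurable_funD; exact: measurable_funX.
Qed.

Lemma measurable_coord1 : measurable_fun setT (fun p : R * R * R => p.1.1).
Proof. exact: (measurableT_comp measurable_fst measurable_fst). Qed.

Lemma measurable_coord2 : measurable_fun setT (fun p : R * R * R => p.1.2).
Proof. exact: (measurableT_comp measurable_snd measurable_fst). Qed.

Let fr_kernel (s l : R) (x : R) (y : R[i]) : \bar R :=
  (ppow s (1 - x) * cmod (1 - y) `^ (- l))%:E.

Lemma tame_fr n (s l : R) (a : 'I_n -> R[i]) :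
  tame (fun w => (ppow s (1 - sqnorm (vec w : 'I_n -> R[i])) *
                  cmod (1 - cinner (vec w) a) `^ (- l))%:E).
Proof.
apply: (@tame_invariant _ _ (fr_kernel s l)).
apply/measurable_EFinP; apply: measurable_funM.
  apply: measurable_ppow; apply: measurable_funB; [exact: measurable_cst|exact: measurable_coord1].
apply: measurable_powR_comp.
apply: (@measurable_cmod _ _ (fun p : R * R * R => 1 - p.1.2) (fun p : R * R * R => 0 - p.2)).
  by apply: measurable_funB; [exact: measurable_cst|exact: measurable_coord2].
by apply: measurable_funB; [exact: measurable_cst|exact: measurable_snd].
Qed.

Lemma ker_coord (r x y : R) :
  cmod (1 - Complex x y * r%:C%C) = cmod (Complex (1 - x * r) (- (y * r))).
Proof.
by congr cmod; apply/eqP; rewrite eq_complex/=; apply/andP; split; apply/eqP; ring.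
Qed.

Lemma forelli_rudin n (s c : R) : (0 < n)%N -> -1 < s -> 0 < c ->
  exists2 C : R, 0 <= C & forall a : 'I_n -> R[i], in_ball a ->
  (iint (coords n) (fun w => (ppow s (1 - sqnorm (vec w : 'I_n -> R[i])) *
       cmod (1 - cinner (vec w) a) `^ (- (n.+1%:R + s + c)))%:E) (fun=> 0)%R
   <= (C * (1 - sqnorm a) `^ (- c))%:E)%E.
Proof.
case: n => // m _ s1 c0; set l := _ + s + c.
have [C1 C10 ball1] := iint_ball s1 (coords_uniq m).
have s2 : -1 < s + m%:R by rewrite (lt_le_trans s1)// lerDl.
have [C2 C20 disc] := disc_estimate s2 c0.
exists (C1 * C2 * 2 `^ c); first by rewrite !mulr_ge0 ?powR_ge0.
move=> a a1; have [r r0 [na /(_ (fr_kernel s l))]] := equi_axis ord_max a.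
rewrite sqnorm_axis in na; rewrite /in_ball na in a1.
have r1 : r < 1 by rewrite -(ltr_pXn2r (n := 2)) ?nnegrE// expr1n.
rewrite /fr_kernel => -> //; last 2 first.
- by move=> x y; rewrite lee_fin mulr_ge0 ?ppow_ge0 ?powR_ge0.
- by move=> b; exact: tame_fr.
set g := (X in iint _ X); rewrite na.
have g0 w : (0 <= g w)%E by rewrite lee_fin mulr_ge0 ?ppow_ge0 ?powR_ge0.
have tg : tame g by exact: tame_fr.
(* The imaginary part of the last coordinate goes outermost and the remaining coordinates innermost,
   as in [disc_estimate]. *)
rewrite (@perm_iint _ _ [:: m.*2.+1, m.*2 & coords m] _ g0 tg); last first.
  exact: (permEl (perm_catCA [:: _] [:: _] _)).
set ker := fun r x y : R => cmod (1 - Complex x y * r%:C%C).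
have ker0 (r' x y : R) : 0 <= ker r' x y by exact: cmod_ge0.
pose h (y x : R) := ppow (s + m%:R) (1 - y ^+ 2 - x ^+ 2) * ker r x y `^ (- l).
have h0 (y x : R) : 0 <= h y x by rewrite mulr_ge0 ?ppow_ge0 ?powR_ge0.
have mh : measurable_fun setT (fun p : R * R => h p.1 p.2).
  apply: measurable_funM.
    apply: measurable_ppow; apply: measurable_funB; last exact: measurable_funX.
    apply: measurable_funB; [exact: measurable_cst|exact: measurable_funX].
  apply: measurable_powR_comp.
  rewrite /ker; under eq_fun do rewrite ker_coord.
  apply: measurable_cmod; [apply: measurable_funB|apply: measurable_funN]; try exact: measurable_cst;
    apply: measurable_funM; try exact: measurable_cst; [exact: measurable_snd|exact: measurable_fst].
(* Integrating out [m] complex coordinates turns [s] into [s + m], and [l] is exactly the planar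
   exponent for that value. *)
have kerE : l = 2 + (s + m%:R) + c by rewrite /l -[m.+2%:R]natr1 -[m.+1%:R]natr1; ring.
have -> : (C1 * C2 * 2 `^ c * (1 - r ^+ 2) `^ (- c))%:E =
   (C1%:E * (C2 * (2 `^ c * (1 - r ^+ 2) `^ (- c)))%:E)%E by rewrite -EFinM !mulrA.
apply: (@le_trans _ _ (C1%:E * \int[mu]_y \int[mu]_x (h y x)%:E)%E); last first.
  rewrite lee_wpmul2l ?lee_fin//.
  have r01 : 0 <= r < 1 by rewrite r0.
  have := disc r r01; rewrite -kerE => /le_trans; apply.
  rewrite lee_fin ler_wpM2l//.
  (* [(1 - r^2) / 2 <= 1 - r] accounts for the factor [2^c]. *)
  rewrite -(powR_invN c (ler0n R 2)) -powRM ?invr_ge0//; last by nra.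
  by apply: le_powRN; [exact: ltW|nra|nra].
rewrite -ge0_integralZl_EFin//; last 2 first.
- by move=> y _; apply: integral_ge0 => x _; rewrite lee_fin.
- apply: (@measurable_fun_fubini_tonelli_F _ _ (measurableTypeR R) (measurableTypeR R) R mu
    (fun p => (h p.1 p.2)%:E)) => //; first exact/measurable_EFinP.
  by move=> p; rewrite lee_fin.
apply: le_integral_nonneg => y; first by apply: integral_ge0 => x _; exact: iint_ge0.
rewrite -ge0_integralZl_EFin//; last 2 first.
- by move=> x _; rewrite lee_fin.
- apply/measurable_EFinP.
  exact: (@measurable_fun_pair2 _ _ _ _ _ _ (fun p : R * R => h p.1 p.2) y mh).
apply: le_integral_nonneg => x; first by exact: iint_ge0.
pose A w := 1 - (w m.*2.+1 ^+ 2) - (w m.*2 ^+ 2).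
pose B w := ker r (w m.*2) (w m.*2.+1) `^ (- l).
have nm k : k \in coords m -> (k != m.*2) && (k != m.*2.+1).
  by move=> /coords_lt km; rewrite !neq_ltn km (ltn_trans km).
have iA : indep (coords m) A.
  by move=> k /nm/andP[k1 k2] w z; rewrite /A !rupdNE// eq_sym.
have iB : indep (coords m) B.
  by move=> k /nm/andP[k1 k2] w z; rewrite /B !rupdNE// eq_sym.
have := ball1 A B iA iB (fun w => powR_ge0 _ _) (rupd (rupd (fun=> 0) m.*2.+1 y) m.*2 x).
rewrite {2}/A {2}/B !rupdE rupdNE ?neq_ltn ?ltnSn ?orbT// rupdE size_coords -EFinM.
rewrite (_ : (m.*2)%:R / 2 = m%:R); last by rewrite -muln2 natrM mulfK.
rewrite /h [ppow _ _ * _]mulrC; apply: le_trans.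
apply: le_iint => // w; rewrite lee_fin /A /B sqnormS cinner_axis mulrC.
rewrite (_ : 1 - (_ + _ + _) = 1 - w m.*2.+1 ^+ 2 - w m.*2 ^+ 2 - \sum_(k <- coords m) w k ^+ 2)//.
by rewrite !opprD !addrA; ring.
Qed.

End ForelliRudin.

(** * Non-isotropic neighbourhoods *)

Section Neighbourhood.
Variable R : realType.
Local Notation mu := (@lebesgue_measure R).
Implicit Types (w : nat -> R).

(* A non-isotropic neighbourhood of [a]: the second quantity is |z - a|^2. *)
Definition near_at n (a z : 'I_n -> R[i]) : bool :=
  (cmod (cinner z a - (sqnorm a)%:C%C) < (1 - sqnorm a) / 8) &&
  (sqnorm z - 2 * complex.Re (cinner z a) + sqnorm a < (1 - sqnorm a) / 64).

Let near_fun (S x : R) (y : R[i]) : \bar R :=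
  ((cmod (y - S%:C%C) < (1 - S) / 8) && (x - 2 * complex.Re y + S < (1 - S) / 64))%:R%:E.

Let measurable_near (S : R) :
  measurable_fun setT (fun p : R * R * R => near_fun S p.1.1 (Complex p.1.2 p.2)).
Proof.
apply/measurable_EFinP.
rewrite (_ : (fun _ => _) = (fun p : R * R * R =>
   if cmod (Complex (p.1.2 - S) (p.2 - 0)) < (1 - S) / 8 then
     if p.1.1 - 2 * p.1.2 + S < (1 - S) / 64 then 1 else 0 else 0)); last first.
  have andE (b1 b2 : bool) : (b1 && b2)%:R = if b1 then if b2 then 1 else 0 else 0 :> R.
    by case: b1 b2 => [] [].
  by apply/funext => p; exact: andE.
apply: measurable_if_lt; [|exact: measurable_cst| |exact: measurable_cst].
  apply: measurable_cmod; apply: measurable_funB; try exact: measurable_cst;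
    [exact: measurable_coord2|exact: measurable_snd].
apply: measurable_if_lt; [|exact: measurable_cst..].
apply: measurable_funD; [apply: measurable_funB|exact: measurable_cst].
  exact: measurable_coord1.
by apply: measurable_funM; [exact: measurable_cst|exact: measurable_coord2].
Qed.

Lemma tame_near n (a b : 'I_n -> R[i]) (S : R) : tame (fun w => near_fun S (sqnorm (vec w : 'I_n -> R[i])) (cinner (vec w) b)).
Proof. by apply: tame_invariant; exact: measurable_near. Qed.

Lemma tame_near_at n (a : 'I_n -> R[i]) : tame (fun w => (near_at a (vec w))%:R%:E).
Proof. exact: (tame_near a a). Qed.

(** After rotation to the axis, the neighbourhood contains a box of half-width [eta (1 - S)] in the
    complex direction of [a] and [eta sqrt (1 - S)] in the other [2 m] real coordinates. Its volume
    scales like [(1 - S)^(2 + m)], and [m + 2 = n + 1]. *)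
Lemma vol_near n : (0 < n)%N -> exists2 c : R, 0 < c & forall a : 'I_n -> R[i], in_ball a ->
  ((c * (1 - sqnorm a) ^+ n.+1)%:E <=
   iint (coords n) (fun w => (near_at a (vec w))%:R%:E) (fun=> 0)%R)%E.
Proof.
case: n => // m _.
(* Chosen so that the [2 (m + 1)] squares, each at most [eta^2 (1 - S)], add up to at most
   [(1 - S) / 128]. *)
pose eta : R := (16 * m.+1%:R)^-1.
have eta0 : 0 < eta by rewrite invr_gt0 mulr_gt0.
have etam : eta * m.+1%:R = 16^-1 by rewrite /eta invfM -mulrA mulVf ?mulr1.
have eta1 : eta <= 16^-1 by rewrite -etam ler_peMr ?ler1n// ltW.
exists ((2 * eta) ^+ (m.+1.*2)); first by rewrite exprn_gt0// mulr_gt0.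
move=> a a1; set S := sqnorm a.
have [r r0 [na /(_ (near_fun S))]] := equi_axis ord_max a.
rewrite sqnorm_axis in na; rewrite /in_ball -/S in a1; rewrite -/S in na.
rewrite -/(near_fun S _ _) => -> //; last 2 first.
- by move=> x y; rewrite lee_fin.
- by move=> b; exact: tame_near.
have r1 : r < 1 by rewrite -(ltr_pXn2r (n := 2)) ?nnegrE// expr1n -na.
have e0 : 0 < 1 - S by rewrite subr_gt0.
have e1 : 1 - S <= 1 by rewrite na gerBl sqr_ge0.
pose c k : R := if k == m.*2 then r else 0.
pose rho k : R := if (k < m.*2)%N then eta * Num.sqrt (1 - S) else eta * (1 - S).
have rho0 k : 0 < rho k by rewrite /rho; case: ifP => _; rewrite mulr_gt0// sqrtr_gt0.
have i1 : indep (coords m.+1) (fun=> 1 : R) by [].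
have box := iint_box c (coords_uniq m.+1) rho0 i1 (fun=> ler01) (fun=> 0).
apply: (@le_trans _ _ (1 * \prod_(k <- coords m.+1) (2 * rho k))%:E).
  rewrite lee_fin mul1r /= !big_cons /rho ltnn ltnNge leqnSn/=.
  rewrite big_seq (eq_bigr (fun=> 2 * (eta * Num.sqrt (1 - S)))); last first.
    by move=> k /coords_lt ->.
  rewrite -big_seq big_const_seq count_predT size_coords iter_mulr_1.
  have -> : (2 * (eta * Num.sqrt (1 - S))) ^+ m.*2 = (2 * eta) ^+ m.*2 * (1 - S) ^+ m.
    rewrite mulrA exprMn; congr (_ * _).
    by rewrite -mul2n exprM sqr_sqrtr// ltW.
  rewrite le_eqVlt; apply/orP; left; apply/eqP.
  rewrite doubleS !exprS; ring.
rewrite -box; apply: le_iint => w; first by rewrite lee_fin mul1r.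
rewrite lee_fin mul1r ler_nat /near_fun.
case: (boolP (all _ _)) => //= /and3P[hx hy hz].
rewrite sqnormS cinner_axis.
have cE k : k \in coords m -> w k ^+ 2 <= eta ^+ 2 * (1 - S).
  move=> km; have := allP hz k km; rewrite /c /rho (coords_lt km) (ltn_eqF (coords_lt km)) subr0 => wk.
  rewrite -[1 - S]sqr_sqrtr ?(ltW e0)// -exprMn -(real_normK (num_real (w k))).
  by rewrite ler_pXn2r ?nnegrE// ltW// mulr_gt0// sqrtr_gt0.
have sumE : \sum_(k <- coords m) w k ^+ 2 <= (2 * m%:R) * (eta ^+ 2 * (1 - S)).
  apply: (@le_trans _ _ (\sum_(k <- coords m) (eta ^+ 2 * (1 - S)))).
    by rewrite big_seq [leRHS]big_seq; apply: ler_sum.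
  rewrite big_const_seq count_predT size_coords iter_addr_0 -[_ *+ m.*2]mulr_natl -[m.*2]muln2 natrM.
  by rewrite [2 * _]mulrC.
move: hx hy; rewrite /c /rho eqxx ltnn ltnNge leqnSn/= gtn_eqF// subr0 => hx hy.
set x := w m.*2 in hx *; set y := w m.*2.+1 in hy *.
have x2 : (x - r) ^+ 2 <= (eta * (1 - S)) ^+ 2.
  by rewrite -(real_normK (num_real (x - r))) ler_pXn2r ?nnegrE// ?ltW// mulr_gt0.
have y2 : y ^+ 2 <= (eta * (1 - S)) ^+ 2.
  by rewrite -(real_normK (num_real y)) ler_pXn2r ?nnegrE// ?ltW// mulr_gt0.
have ee : (eta * (1 - S)) ^+ 2 <= eta ^+ 2 * (1 - S).
  by rewrite exprMn ler_wpM2l ?sqr_ge0// expr2 ler_piMr// ltW.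
have m0 : 0 <= m%:R :> R by [].
have total : (2 * m%:R) * (eta ^+ 2 * (1 - S)) + 2 * (eta ^+ 2 * (1 - S)) <= (1 - S) / 128.
  have -> : (2 * m%:R) * (eta ^+ 2 * (1 - S)) + 2 * (eta ^+ 2 * (1 - S)) =
    2 * (eta * m.+1%:R) * eta * (1 - S) by rewrite -[m.+1%:R]natr1; ring.
  rewrite etam; nra.
rewrite lt0b; apply/andP; split.
  rewrite -(ltr_pXn2r (n := 2)) ?nnegrE ?cmod_ge0 ?divr_ge0 ?(ltW e0)// cmod2E/=.
  rewrite !mulr0 !subr0 add0r {1}na.
  have -> : (x * r - r ^+ 2) ^+ 2 + (y * r) ^+ 2 = r ^+ 2 * ((x - r) ^+ 2 + y ^+ 2) by ring.
  have r2 : r ^+ 2 <= 1 by rewrite exprn_ile1 // ltW.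
  apply: (@le_lt_trans _ _ (1 * (2 * (eta * (1 - S)) ^+ 2))).
    by apply: ler_pM; rewrite ?sqr_ge0 ?addr_ge0 ?sqr_ge0//; lra.
  rewrite !exprMn mul1r mulrA [ltRHS]mulrC ltr_pM2r ?exprn_gt0//.
  by apply: (@le_lt_trans _ _ (2 * (16^-1) ^+ 2)); [nra|lra].
rewrite /= mulr0 subr0.
have -> : x ^+ 2 + y ^+ 2 + \sum_(k <- coords m) w k ^+ 2 - 2 * (x * r) + S =
  (x - r) ^+ 2 + y ^+ 2 + \sum_(k <- coords m) w k ^+ 2 by rewrite na; ring.
lra.
Qed.

End Neighbourhood.

(** * Comparison of kernels on the neighbourhoods *)

Section Geometry.
Variable R : realType.
Implicit Types (x y : R[i]).

Lemma cmodE x : (cmod x)%:C%C = `|x|.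
Proof. by case: x. Qed.

Lemma cmodM x y : cmod (x * y) = cmod x * cmod y.
Proof. by apply: (@complexI R); rewrite rmorphM/= !cmodE normrM. Qed.

Lemma ler_cmodD x y : cmod (x + y) <= cmod x + cmod y.
Proof. by rewrite -lecR rmorphD/= !cmodE ler_normD. Qed.

Lemma cmodN x : cmod (- x) = cmod x.
Proof. by apply: (@complexI R); rewrite !cmodE normrN. Qed.

Lemma ler_cmodB x y : cmod (x - y) <= cmod x + cmod y.
Proof. by rewrite -(cmodN y) ler_cmodD. Qed.

Lemma cmod_conj x : cmod (cconj x) = cmod x.
Proof. by case: x => a b; rewrite /cmod/= sqrrN. Qed.

Lemma cmodC (r : R) : cmod r%:C%C = `|r|.
Proof. by rewrite /cmod/= expr0n addr0 sqrtr_sqr. Qed.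

Lemma cmod0 : cmod (0 : R[i]) = 0.
Proof. by rewrite -[0]/(0%:C%C) cmodC normr0. Qed.

Lemma ler_cmod_sum (I : Type) (r : seq I) (P : pred I) (F : I -> R[i]) :
  cmod (\sum_(i <- r | P i) F i) <= \sum_(i <- r | P i) cmod (F i).
Proof.
elim/big_rec2 : _ => [|i u v _ uv]; first by rewrite cmod0.
by apply: le_trans (ler_cmodD _ _) _; rewrite lerD2l.
Qed.

Section Vectors.
Variable n : nat.
Implicit Types (u v w z a b : 'I_n -> R[i]).

Lemma sqnorm_ge0 z : 0 <= sqnorm z.
Proof. by apply: sumr_ge0 => j _; exact: sqr_ge0. Qed.

Lemma cinnerC z a : cinner a z = cconj (cinner z a).
Proof.
rewrite /cinner /cconj rmorph_sum; apply: eq_bigr => j _.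
by rewrite rmorphM/= conjcK mulrC.
Qed.

Lemma cinnerDl z w a : cinner (fun j => z j + w j) a = cinner z a + cinner w a.
Proof. by rewrite /cinner -big_split; apply: eq_bigr => j _; rewrite mulrDl. Qed.

Lemma cinnerBl z w a : cinner (fun j => z j - w j) a = cinner z a - cinner w a.
Proof.
rewrite /cinner -sumrB; apply: eq_bigr => j _; by rewrite mulrBl.
Qed.

Lemma cinnerBr z w a : cinner a (fun j => z j - w j) = cinner a z - cinner a w.
Proof. by rewrite cinnerC cinnerBl (cinnerC z a) (cinnerC w a) /cconj rmorphB. Qed.

Lemma cinnerxx z : cinner z z = (sqnorm z)%:C%C.
Proof.
rewrite /cinner /sqnorm rmorph_sum; apply: eq_bigr => j _.
rewrite cmod2E /cconj; case: (z j) => x y.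
by apply/eqP; rewrite eq_complex/=; apply/andP; split; apply/eqP; ring.
Qed.

Lemma sqnormE z : sqnorm z = complex.Re (cinner z z).
Proof. by rewrite cinnerxx. Qed.

Lemma Re_cconj x : complex.Re (cconj x) = complex.Re x.
Proof. by case: x. Qed.

Lemma ReB x y : complex.Re (x - y) = complex.Re x - complex.Re y.
Proof. by case: x y => ? ? [? ?]. Qed.

Lemma sqnormB z a : sqnorm (fun j => z j - a j) =
  sqnorm z - 2 * complex.Re (cinner z a) + sqnorm a.
Proof.
rewrite [LHS]sqnormE cinnerBr !cinnerBl !ReB -!sqnormE (cinnerC z a) Re_cconj; ring.
Qed.

(** Cauchy-Schwarz combined with the weighted arithmetic-geometric mean inequality; the free weight
    [t] replaces square roots. *)
Lemma cmod_cinner_le u v (t : R) : 0 < t ->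
  2 * cmod (cinner u v) <= sqnorm u / t + t * sqnorm v.
Proof.
move=> t0; rewrite /sqnorm mulr_suml mulr_sumr -big_split/=.
apply: (@le_trans _ _ (2 * \sum_(j < n) cmod (u j) * cmod (v j))).
  rewrite ler_pM2l//; apply: le_trans (ler_cmod_sum _ _ _) _.
  by apply: ler_sum => j _; rewrite cmodM cmod_conj.
rewrite mulr_sumr; apply: ler_sum => j _.
rewrite -subr_ge0.
have -> : cmod (u j) ^+ 2 / t + t * cmod (v j) ^+ 2 - 2 * (cmod (u j) * cmod (v j)) =
   (cmod (u j) - t * cmod (v j)) ^+ 2 / t by field; rewrite gt_eqF.
by rewrite divr_ge0 ?sqr_ge0// ltW.
Qed.

Lemma cmod1_cinnerC u v : cmod (1 - cinner u v) = cmod (1 - cinner v u).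
Proof.
by rewrite -cmod_conj (cinnerC u v) /cconj rmorphB rmorph1.
Qed.

(** Expand [|z - a|^2 >= 0] and use [|z| < 1]. *)
Lemma Re1_cinner_ge z a : in_ball z -> (1 - sqnorm a) / 2 <= 1 - complex.Re (cinner z a).
Proof.
rewrite /in_ball => z1; have := sqnorm_ge0 (fun j => z j - a j); rewrite sqnormB; lra.
Qed.

Lemma cmod1_cinner_ge z a : in_ball z -> (1 - sqnorm a) / 2 <= cmod (1 - cinner z a).
Proof.
move=> /(Re1_cinner_ge a)/le_trans; apply; apply: le_trans (Re_le_cmod _).
by rewrite ReB; exact: ler_norm.
Qed.

Lemma near_sqnorm a z : in_ball a -> near_at a z ->
  (1 - sqnorm a) / 2 <= 1 - sqnorm z <= 2 * (1 - sqnorm a).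
Proof.
rewrite /in_ball => a1 /andP[h1 h2].
have := le_lt_trans (Re_le_cmod _) h1; rewrite ReB/= ltr_norml => /andP[h3 h4].
have := sqnorm_ge0 (fun j => z j - a j); rewrite sqnormB => h5.
by apply/andP; split; lra.
Qed.

Lemma near_in_ball a z : in_ball a -> near_at a z -> in_ball z.
Proof. by move=> a1 az; have /andP[h _] := near_sqnorm a1 az; move: a1 h; rewrite /in_ball; lra. Qed.

(** This fixes the constants of [near_at]. Put [e = 1 - |a|^2], so [e <= 2 k], and split
    [<w, z - a> = <w - a, z - a> + <a, z - a>]. The last term is below [e / 8]. For the other one,
    [|z - a|^2 < e / 64], [|w - a|^2 <= 2 k] and the weight 1/8 give at most [e / 16 + k / 8]. The
    total is at most [k / 2]. *)
Lemma near_cinner a z w : in_ball a -> in_ball w -> near_at a z ->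
  cmod (cinner w z - cinner w a) <= cmod (1 - cinner w a) / 2.
Proof.
move=> a1 w1 /andP[h1 h2]; set k := cmod (1 - cinner w a).
have ek : 1 - sqnorm a <= 2 * k by have := cmod1_cinner_ge a w1; rewrite -/k; lra.
have k0 : 0 <= k by exact: cmod_ge0.
rewrite -cinnerBr.
have -> : cinner w (fun j => z j - a j) =
  cinner (fun j => w j - a j) (fun j => z j - a j) + cinner a (fun j => z j - a j).
  by rewrite cinnerBl subrK.
apply: le_trans (ler_cmodD _ _) _.
have A : cmod (cinner a (fun j => z j - a j)) < (1 - sqnorm a) / 8.
  by rewrite cinnerC cmod_conj cinnerBl cinnerxx.
have wa : sqnorm (fun j => w j - a j) <= 2 * k.
  rewrite sqnormB; have := Re_le_cmod (1 - cinner w a); rewrite ReB/= -/k => hk.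
  have := le_trans (ler_norm _) hk; move: a1 w1; rewrite /in_ball; lra.
have e8 : 0 < 8^-1 :> R by rewrite invr_gt0.
have := cmod_cinner_le (fun j => z j - a j) (fun j => w j - a j) e8.
rewrite -[cmod (cinner _ _)]cmod_conj -cinnerC invrK [sqnorm (fun j => z j - a j)]sqnormB.
move: h2 A wa ek; rewrite /k; lra.
Qed.

Lemma near_kernel a z w : in_ball a -> in_ball w -> near_at a z ->
  cmod (1 - cinner w a) / 2 <= cmod (1 - cinner w z) <= 2 * cmod (1 - cinner w a).
Proof.
move=> a1 w1 az; have h := near_cinner a1 w1 az; apply/andP; split.
  have := ler_cmodD (1 - cinner w z) (cinner w z - cinner w a); rewrite addrA subrK; lra.
have := ler_cmodB (1 - cinner w a) (cinner w z - cinner w a).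
rewrite opprB addrA subrK; have := cmod_ge0 (1 - cinner w a); lra.
Qed.

(** Compare kernels at [w = a] twice, passing from [b] to [z] and from [z] to [a]; each passage
    costs a factor 2. *)
Lemma near_overlap a b z : in_ball a -> in_ball b -> near_at a z -> near_at b z ->
  cmod (1 - cinner a b) <= 4 * (1 - sqnorm a).
Proof.
move=> a1 b1 az bz.
have /andP[h1 _] := near_kernel b1 a1 bz.
have /andP[_ h2] := near_kernel a1 a1 az.
move: h2; rewrite cinnerxx -[1]/(1%:C%C) -rmorphB/= cmodC ger0_norm; last by rewrite subr_ge0 ltW.
move: h1; rewrite -[1]/(1%:C%C); lra.
Qed.

End Vectors.

End Geometry.

(** * Discrete sums over a separated sequence *)

Section Sums.
Variable R : realType.

(** Young's inequality termwise, after normalising both sums to 1; the case of a vanishing sum is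
    separate. *)
Lemma hoelder_sum (p q : R) N (x y : nat -> R) : 0 < p -> 0 < q -> p^-1 + q^-1 = 1 ->
  (forall j, 0 <= x j) -> (forall j, 0 <= y j) ->
  (\sum_(0 <= j < N) x j * y j) `^ p <=
  (\sum_(0 <= j < N) x j `^ p) * (\sum_(0 <= j < N) y j `^ q) `^ (p / q).
Proof.
move=> p0 q0 pq x0 y0.
set A := \sum_(0 <= j < N) x j `^ p; set B := \sum_(0 <= j < N) y j `^ q.
have A0 : 0 <= A by apply: sumr_ge0 => j _; exact: powR_ge0.
have B0 : 0 <= B by apply: sumr_ge0 => j _; exact: powR_ge0.
have defA : A = \sum_(0 <= j < N) x j `^ p by [].
have defB : B = \sum_(0 <= j < N) y j `^ q by [].
clearbody A B.
have zero (z : nat -> R) (r : R) : r != 0 -> \sum_(0 <= j < N) z j `^ r = 0 ->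
    forall j, (j < N)%N -> z j = 0.
  move=> r0 /eqP; rewrite psumr_eq0; last by move=> *; exact: powR_ge0.
  by move=> /allP h j jN; have := h j; rewrite mem_index_iota jN => /(_ isT)/eqP/powR_eq0_eq0.
have [A_eq0|An0] := eqVneq A 0.
  rewrite big_nat_cond big1 ?powR0 ?gt_eqF ?mulr_ge0 ?powR_ge0// => j /andP[/andP[_ jN] _].
  rewrite defA in A_eq0; by rewrite (zero x p _ A_eq0 j jN) ?mul0r// gt_eqF.
have [B_eq0|Bn0] := eqVneq B 0.
  rewrite big_nat_cond big1 ?powR0 ?gt_eqF ?mulr_ge0 ?powR_ge0// => j /andP[/andP[_ jN] _].
  rewrite defB in B_eq0; by rewrite (zero y q _ B_eq0 j jN) ?mulr0// gt_eqF.
have {An0}A1 : 0 < A by rewrite lt_def An0.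
have {Bn0}B1 : 0 < B by rewrite lt_def Bn0.
have -> : A * B `^ (p / q) = (A `^ p^-1 * B `^ q^-1) `^ p.
  rewrite (powRM _ (powR_ge0 _ _) (powR_ge0 _ _)) -(powRrM A) -(powRrM B).
  by rewrite mulVf ?(gt_eqF p0)// (powRr1 A0) [q^-1 * p]mulrC.
apply: le_powR; first exact: ltW.
  by apply: sumr_ge0 => j _; rewrite mulr_ge0.
have AB0 : 0 < A `^ p^-1 * B `^ q^-1 by rewrite mulr_gt0 ?powR_gt0.
rewrite -[leRHS]mul1r -ler_pdivrMr// mulr_suml -pq.
have scaled (D r z : R) : 0 < D -> 0 < r -> 0 <= z -> (z / D `^ r^-1) `^ r = z `^ r / D.
  move=> D0 r0 z0; have i0 : 0 <= (D `^ r^-1)^-1 by rewrite invr_ge0; exact: powR_ge0.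
  rewrite (powRM _ z0 i0) -powRN -(powRrM D) mulNr mulVf ?(gt_eqF r0)//.
  by rewrite powRN (powRr1 (ltW D0)).
apply: (@le_trans _ _ (\sum_(0 <= j < N) (x j `^ p / A / p + y j `^ q / B / q))).
  apply: ler_sum => j _.
  have xA : 0 <= x j / A `^ p^-1 by rewrite divr_ge0// powR_ge0.
  have yB : 0 <= y j / B `^ q^-1 by rewrite divr_ge0// powR_ge0.
  have := conjugate_powR xA yB p0 q0 pq.
  rewrite (scaled A p _ A1 p0 (x0 j)) (scaled B q _ B1 q0 (y0 j)); apply: le_trans.
  by rewrite invfM mulrACA.
rewrite big_split/= -!mulr_suml -defA -defB !divff ?(gt_eqF A1) ?(gt_eqF B1)//.
by rewrite !mul1r.
Qed.

End Sums.

Section Separated.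
Variables (R : realType) (n : nat).
Hypothesis n0 : (0 < n)%N.
Variables (a : nat -> 'I_n -> R[i]) (r s K : R).
Hypothesis a1 : forall k, in_ball (a k).
Hypothesis r0 : 0 <= r.
Hypothesis s0 : 0 <= s.
Hypothesis aK : forall k N, \sum_(0 <= j < N | j != k) Kterm a r s k j <= K.

Lemma ball_gap (z : 'I_n -> R[i]) : in_ball z -> 0 < 1 - sqnorm z.
Proof. by rewrite subr_gt0. Qed.

Lemma cmod1_cinner_gt0 (z b : 'I_n -> R[i]) : in_ball z -> in_ball b -> 0 < cmod (1 - cinner z b).
Proof.
move=> z1 b1; apply: lt_le_trans (cmod1_cinner_ge b z1).
by rewrite divr_gt0// ball_gap.
Qed.

Lemma Kterm_ge0 k j : 0 <= Kterm a r s k j.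
Proof. by rewrite /Kterm divr_ge0// ?mulr_ge0// powR_ge0. Qed.

(** If the neighbourhoods meet, the kernel modulus is at most 4 times either gap, so the quotient
    [Kterm] is bounded below. *)
Lemma Kterm_near k j z : near_at (a k) z -> near_at (a j) z ->
  1 <= 4 `^ (r + s) * Kterm a r s k j.
Proof.
move=> kz jz; rewrite /Kterm.
have e1 := ball_gap (a1 k); have e2 := ball_gap (a1 j).
have c0 := cmod1_cinner_gt0 (a1 j) (a1 k).
have h1 := near_overlap (a1 j) (a1 k) jz kz.
have h2 := near_overlap (a1 k) (a1 j) kz jz.
rewrite cmod1_cinnerC in h2.
move: (cmod _) c0 h1 h2 => c c0 h1 h2.
move: (1 - sqnorm (a k)) (1 - sqnorm (a j)) e1 e2 h1 h2 => e f e1 e2 h1 h2.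
rewrite mulrA ler_pdivlMr ?powR_gt0// mul1r.
rewrite (powRD_gt0 _ _ c0) (powRD_gt0 r s (ltr0n _ 4)).
have -> : 4 `^ r * 4 `^ s * (e `^ r * f `^ s) = (4 * e) `^ r * (4 * f) `^ s.
  by rewrite (powRM _ (ler0n R 4) (ltW e1)) (powRM _ (ler0n R 4) (ltW e2)) mulrACA.
by apply: ler_pM; [exact: powR_ge0|exact: powR_ge0|exact: le_powR (ltW c0) h2|exact: le_powR (ltW c0) h1].
Qed.

(** Fix one [a k] near [z]. Every other [a j] near [z] contributes at least 1 to [4^(r + s)] times
    the row sum of [k]. *)
Lemma near_overlap_bound (z : 'I_n -> R[i]) N :
  \sum_(0 <= j < N) (near_at (a j) z)%:R <= 1 + 4 `^ (r + s) * K.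
Proof.
have K0 : 0 <= K by have := aK 0 0; rewrite big_geq.
have B0 : 0 <= 4 `^ (r + s) * K by rewrite mulr_ge0// powR_ge0.
have [[k kz]|none] := pselect (exists k, near_at (a k) z); last first.
  rewrite big1 ?addr_ge0// => j _; case: (boolP (near_at _ _)) => // h; by case: none; exists j.
rewrite (bigID (pred1 k))/=; apply: lerD.
  by rewrite big_nat1_eq; case: ifP => // _; case: near_at.
apply: le_trans (_ : 4 `^ (r + s) * \sum_(0 <= j < N | j != k) Kterm a r s k j <= _); last first.
  by rewrite ler_wpM2l ?powR_ge0.
rewrite mulr_sumr; apply: ler_sum => j _.
case: (boolP (near_at _ _)) => [jz|_]; first exact: Kterm_near kz jz.
by rewrite mulr_ge0 ?powR_ge0// Kterm_ge0.
Qed.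

(* The sum is compared with a Forelli-Rudin integral: each [a j] is surrounded by
   [near_at (a j)], of volume at least a multiple of [(1 - |a j|^2) ^+ n.+1], where the
   integrand is almost constant, and these neighbourhoods have bounded overlap. *)
Lemma separated_sum (u c : R) : -1 < u -> 0 < c -> exists2 C : R, 0 <= C &
  forall z : 'I_n -> R[i], in_ball z -> forall N,
  \sum_(0 <= j < N) (1 - sqnorm (a j)) `^ (n.+1%:R + u) *
     cmod (1 - cinner z (a j)) `^ (- (n.+1%:R + u + c)) <= C * (1 - sqnorm z) `^ (- c).
Proof.
move=> u1 c0; set l := _ + u + c.
have l0 : 0 <= l by rewrite /l -natr1; have := ler0n R n; lra.
have [v v0 vol] := vol_near R n0.
have [C C0 fr] := forelli_rudin n0 u1 c0.
pose M : R := 1 + 4 `^ (r + s) * K.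
have M0 : 0 <= M.
  have := near_overlap_bound (a 0) 0; rewrite big_geq//.
pose L : R := 2 `^ `|u| * 2 `^ `|- l|.
exists (v^-1 * (L * (M * C))).
  by rewrite !mulr_ge0 ?powR_ge0// invr_ge0 ltW.
move=> z z1 N.
pose F w : R := ppow u (1 - sqnorm (vec w : 'I_n -> R[i])) * cmod (1 - cinner (vec w) z) `^ (- l).
pose I j w : R := (near_at (a j) (vec w))%:R.
have F0 w : 0 <= F w by rewrite mulr_ge0 ?ppow_ge0 ?powR_ge0.
have I0 j w : 0 <= I j w by exact: ler0n.
have tF : tame (fun w => (F w)%:E) by exact: tame_fr.
have tI j : tame (fun w => (I j w)%:E) by exact: tame_near_at.
have tIF j : tame (fun w => (I j w * F w)%:E).
  move=> d T f mf; apply/measurable_EFinP.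
  have /measurable_EFinP m1 := tI j d T f mf; have /measurable_EFinP m2 := tF d T f mf.
  exact: (measurable_funM m1 m2).
pose S j : R := (1 - sqnorm (a j)) `^ (n.+1%:R + u) * cmod (1 - cinner z (a j)) `^ (- l).
have S0 j : 0 <= S j by rewrite mulr_ge0 ?powR_ge0.
have term j : ((v * S j)%:E <= L%:E * iint (coords n) (fun w => (I j w * F w)%:E) (fun=> 0)%R)%E.
  set X := (1 - sqnorm (a j)) `^ u * cmod (1 - cinner z (a j)) `^ (- l).
  have X0 : 0 <= X by rewrite mulr_ge0 ?powR_ge0.
  apply: (@le_trans _ _ (iint (coords n) (fun w => X%:E * (I j w)%:E) (fun=> 0)%R)%E).
    rewrite iintZ//; last by move=> w; rewrite lee_fin.
    apply: (@le_trans _ _ (X%:E * (v * (1 - sqnorm (a j)) ^+ n.+1)%:E)%E); last first.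
      by rewrite lee_wpmul2l ?lee_fin//; exact: vol.
    have e0 := ball_gap (a1 j).
    rewrite -EFinM lee_fin /S /X (powRD_gt0 _ _ e0) powR_mulrn ?(ltW e0)//.
    by rewrite le_eqVlt; apply/orP; left; apply/eqP; ring.
  rewrite -iintZ//; last 2 first.
  - by rewrite mulr_ge0 ?powR_ge0.
  - by move=> w; rewrite lee_fin mulr_ge0.
  apply: le_iint => w; first by rewrite -EFinM lee_fin mulr_ge0.
  rewrite -!EFinM lee_fin /I; case: (boolP (near_at _ _)) => [jw|_]; last by rewrite mulr0 mul0r mulr0.
  rewrite mulr1 mul1r /X /L /F.
  have /andP[e1 e2] := near_sqnorm (a1 j) jw.
  have w1 := near_in_ball (a1 j) jw.
  have /andP[k1 k2] := near_kernel (a1 j) z1 jw.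
  have e0 := ball_gap (a1 j); have f0 := ball_gap w1.
  have c1 := cmod1_cinner_gt0 z1 w1.
  rewrite (cmod1_cinnerC (vec w) z) /ppow f0 mulrACA.
  apply: ler_pM; [exact: powR_ge0|exact: powR_ge0| |]; apply: powR_comparable; rewrite ?ler1n//; lra.
have sumI w : (\sum_(j <oo) (I j w * F w)%:E <= M%:E * (F w)%:E)%E.
  apply: nneseries_le_bound => [j|m]; first by rewrite lee_fin mulr_ge0.
  by rewrite sumEFin lee_fin -mulr_suml ler_wpM2r//; exact: near_overlap_bound.
have total : ((\sum_(0 <= j < N) v * S j)%:E <= L%:E * (M * (C * (1 - sqnorm z) `^ (- c)))%:E)%E.
  rewrite -sumEFin.
  apply: (@le_trans _ _ (\sum_(0 <= j < N) L%:E * iint (coords n) (fun w => (I j w * F w)%:E) (fun=> 0)%R)%E).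
    by apply: lee_sum => j _; exact: term.
  rewrite -ge0_sume_distrr; last by move=> j _; apply: iint_ge0 => w; rewrite lee_fin mulr_ge0.
  rewrite lee_wpmul2l ?lee_fin ?mulr_ge0 ?powR_ge0//.
  apply: (@le_trans _ _ (\sum_(j <oo) iint (coords n) (fun w => (I j w * F w)%:E) (fun=> 0)%R)%E).
    by apply: nneseries_lim_ge => j _ _; apply: iint_ge0 => w; rewrite lee_fin mulr_ge0.
  rewrite -iint_series//; last by move=> j w; rewrite lee_fin mulr_ge0.
  apply: le_trans (le_iint _ _ sumI _) _.
    by move=> w; apply: nneseries_ge0 => j _ _; rewrite lee_fin mulr_ge0.
  rewrite iintZ//.
  by rewrite [(M * _)%:E]EFinM lee_wpmul2l ?lee_fin//; exact: fr.
move: total; rewrite -EFinM lee_fin -mulr_sumr => total.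
rewrite -(ler_pM2l v0); apply: le_trans total _.
by rewrite -!mulrA mulVKf ?gt_eqF.
Qed.

End Separated.

(** * From l^p coefficients to the Bergman norm *)

Section Synthesis.
Variables (R : realType) (n : nat).
Hypothesis n0 : (0 < n)%N.
Variables (a : nat -> 'I_n -> R[i]) (r s K : R).
Hypothesis a1 : forall k, in_ball (a k).
Hypothesis r0 : 0 <= r.
Hypothesis s0 : 0 <= s.
Hypothesis aK : forall k N, \sum_(0 <= j < N | j != k) Kterm a r s k j <= K.
Variables (p q l : R).
Hypothesis p0 : 0 < p.
Hypothesis q0 : 0 < q.
Hypothesis pq : p^-1 + q^-1 = 1.
Hypothesis ln : n%:R < l.

(** The even split of the exponent [l / q] of the gap into [l / (p q)] and [l / q^2] is shifted by
    [n / (p q)]. The dual sum then has gap exponent [l / q + n / p = n + (l - n) / q], and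
    [separated_sum] applies as soon as [l > n]; so does [forelli_rudin] to the other factor
    later. *)
Lemma synthesis_hoelder : exists2 C : R, 0 <= C & forall (u : nat -> R) z N,
  (forall j, 0 <= u j) -> in_ball z ->
  (\sum_(0 <= j < N) u j * ((1 - sqnorm (a j)) `^ (l / q) * cmod (1 - cinner z (a j)) `^ (- l))) `^ p <=
  C * (1 - sqnorm z) `^ (- ((l - n%:R) / q)) *
  \sum_(0 <= j < N) u j `^ p * ((1 - sqnorm (a j)) `^ ((l - n%:R) / q) * cmod (1 - cinner z (a j)) `^ (- l)).
Proof.
pose t : R := l / q + n%:R / p - n.+1%:R.
pose c : R := (l - n%:R) / p.
have pV : 0 < p^-1 by rewrite invr_gt0.
have qV : 0 < q^-1 by rewrite invr_gt0.
have qE : q^-1 = 1 - p^-1 by rewrite -pq [_ + q^-1]addrC addrK.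
have t1 : -1 < t.
  have : 0 < (l - n%:R) * q^-1 by rewrite mulr_gt0// subr_gt0.
  rewrite /t -[n.+1%:R]natr1 qE; lra.
have c0 : 0 < c by rewrite mulr_gt0// subr_gt0.
have [C C0 sep] := separated_sum n0 a1 r0 s0 aK t1 c0.
exists (C `^ (p / q)); first exact: powR_ge0.
move=> u z N u0 z1.
have lE : n.+1%:R + t + c = l by rewrite /t /c qE; ring.
have tE : n.+1%:R + t = l / q + n%:R / p by rewrite /t; ring.
have {sep} := sep z z1 N; rewrite lE tE => sep.
pose x j := u j * ((1 - sqnorm (a j)) `^ ((l - n%:R) / q / p) * cmod (1 - cinner z (a j)) `^ (- l / p)).
pose y j := (1 - sqnorm (a j)) `^ ((l / q + n%:R / p) / q) * cmod (1 - cinner z (a j)) `^ (- l / q).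
have x0 j : 0 <= x j by rewrite !mulr_ge0 ?powR_ge0.
have y0 j : 0 <= y j by rewrite !mulr_ge0 ?powR_ge0.
have e0 j := ball_gap (a1 j).
have k0 j := cmod1_cinner_gt0 z1 (a1 j).
have xy j : u j * ((1 - sqnorm (a j)) `^ (l / q) * cmod (1 - cinner z (a j)) `^ (- l)) = x j * y j.
  rewrite /x /y -[RHS]mulrA; congr (_ * _); rewrite [RHS]mulrACA -(powRD_gt0 _ _ (e0 j)) -(powRD_gt0 _ _ (k0 j)).
  congr (_ `^ _ * _ `^ _); first by rewrite qE; ring.
  by rewrite -mulrDr pq mulr1.
have xp j : x j `^ p = u j `^ p * ((1 - sqnorm (a j)) `^ ((l - n%:R) / q) * cmod (1 - cinner z (a j)) `^ (- l)).
  rewrite /x (powRM _ (u0 j)) ?mulr_ge0 ?powR_ge0// (powRM _ (powR_ge0 _ _) (powR_ge0 _ _)).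
  by rewrite -!powRrM !divfK ?gt_eqF.
have yq j : y j `^ q = (1 - sqnorm (a j)) `^ (l / q + n%:R / p) * cmod (1 - cinner z (a j)) `^ (- l).
  by rewrite /y (powRM _ (powR_ge0 _ _) (powR_ge0 _ _)) -!powRrM !divfK ?gt_eqF.
have h := hoelder_sum N p0 q0 pq x0 y0.
have -> : \sum_(0 <= j < N) u j * ((1 - sqnorm (a j)) `^ (l / q) * cmod (1 - cinner z (a j)) `^ (- l)) =
  \sum_(0 <= j < N) x j * y j by apply: eq_bigr => j _; exact: xy.
apply: (le_trans h); rewrite (eq_bigr _ (fun j _ => xp j)) (eq_bigr _ (fun j _ => yq j)) mulrC.
rewrite ler_wpM2r//.
  by apply: sumr_ge0 => j _; rewrite !mulr_ge0 ?powR_ge0.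
have d0 := ball_gap z1.
have -> : C `^ (p / q) * (1 - sqnorm z) `^ (- ((l - n%:R) / q)) = (C * (1 - sqnorm z) `^ (- c)) `^ (p / q).
  rewrite (powRM _ C0 (powR_ge0 _ _)) -powRrM; congr (_ * _ `^ _).
  by rewrite /c; field; rewrite !gt_eqF.
apply: le_powR => //; first by rewrite divr_ge0 ?ltW.
by apply: sumr_ge0 => j _; rewrite !mulr_ge0 ?powR_ge0.
Qed.

(** The last hypothesis says that [|f z|] is at most the sum of the moduli of the series, phrased
    through upper bounds of partial sums so that a divergent sum is allowed. *)
Lemma synthesis_bound (alpha : R) : l = n.+1%:R + alpha * p -> exists2 C : R, 0 <= C &
  forall (u : nat -> R) (V : R) (f : ('I_n -> R[i]) -> R[i]), (forall j, 0 <= u j) ->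
  (forall N, \sum_(0 <= j < N) u j `^ p <= V) ->
  (forall z B, in_ball z ->
    (forall N, \sum_(0 <= j < N) u j *
      ((1 - sqnorm (a j)) `^ (l / q) * cmod (1 - cinner z (a j)) `^ (- l)) <= B) ->
    cmod (f z) <= B) ->
  (Bnorm_p p alpha f <= (C * V)%:E)%E.
Proof.
move=> lE; pose t : R := alpha * p - (l - n%:R) / q.
pose c : R := (l - n%:R) / q.
have pV : 0 < p^-1 by rewrite invr_gt0.
have qV : 0 < q^-1 by rewrite invr_gt0.
have qE : q^-1 = 1 - p^-1 by rewrite -pq [_ + q^-1]addrC addrK.
have c0 : 0 < c by rewrite mulr_gt0// subr_gt0.
(* In fact [t = (l - n) / p - 1]. *)
have t1 : -1 < t.
  have : 0 < (l - n%:R) * p^-1 by rewrite mulr_gt0// subr_gt0.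
  have -> : t = (l - n%:R) * p^-1 - 1.
    have apE : alpha * p = l - n%:R - 1 by rewrite lE -[n.+1%:R]natr1; ring.
    by rewrite /t apE qE; ring.
  lra.
have tc : n.+1%:R + t + c = l by rewrite /t /c lE; ring.
have [C1 C10 hoelder_u] := synthesis_hoelder.
have [C2 C20 fr] := forelli_rudin n0 t1 c0; rewrite tc in fr.
exists (C1 * C2); first by rewrite mulr_ge0.
move=> u V f u0 uV fB.
have e0 j := ball_gap (a1 j).
pose b j := C1 * (u j `^ p * (1 - sqnorm (a j)) `^ c).
have b0 j : 0 <= b j by rewrite !mulr_ge0 ?powR_ge0.
pose F j z := ppow t (1 - sqnorm z) * cmod (1 - cinner z (a j)) `^ (- l).
have F0 j z : 0 <= F j z by rewrite mulr_ge0 ?ppow_ge0 ?powR_ge0.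
have tF j : tame (fun w => (F j (vec w))%:E) by exact: tame_fr.
have tbF j : tame (fun w => ((b j)%:E * (F j (vec w))%:E)%E).
  by move=> d T g mg; apply: emeasurable_funM; [exact: measurable_cst|exact: tF].
have bF0 j w : (0 <= (b j)%:E * (F j (vec w))%:E)%E by rewrite -EFinM lee_fin mulr_ge0.
have pointwise z : ((if in_ball z then
      (((1 - sqnorm z) `^ (alpha * p)) * (cmod (f z) `^ p))%:E else 0) <=
   \sum_(j <oo) (b j)%:E * (F j z)%:E)%E.
  have bFz j : (0 <= (b j)%:E * (F j z)%:E)%E by rewrite -EFinM lee_fin mulr_ge0.
  case: ifPn => [z1|_]; last by apply: nneseries_ge0.
  have d0 := ball_gap z1.
  have D0 : 0 < (1 - sqnorm z) `^ (alpha * p) by exact: powR_gt0.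
  case E : (\sum_(j <oo) _)%E => [T||]; last first.
  - by have := nneseries_ge0 (fun j _ _ => bFz j) : (0 <= \sum_(j <oo) (b j)%:E * (F j z)%:E)%E; rewrite E.
  - by rewrite leey.
  have T0 : 0 <= T by rewrite -lee_fin -E; exact: nneseries_ge0.
  have partial N : \sum_(0 <= j < N) b j * F j z <= T.
    rewrite -lee_fin -E -sumEFin; under eq_bigr do rewrite EFinM.
    by apply: nneseries_lim_ge => j _ _; exact: bFz.
  rewrite lee_fin -ler_pdivlMl//.
  have TD0 : 0 <= T / (1 - sqnorm z) `^ (alpha * p) by rewrite divr_ge0// ltW.
  rewrite [_^-1 * _]mulrC.
  have -> : T / (1 - sqnorm z) `^ (alpha * p) = ((T / (1 - sqnorm z) `^ (alpha * p)) `^ p^-1) `^ p.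
    by rewrite -powRrM mulVf ?gt_eqF// powRr1.
  apply: le_powR; [exact: ltW|exact: cmod_ge0|apply: (fB _ _ z1) => N].
  set X := \sum_(0 <= j < N) _.
  have X0 : 0 <= X by apply: sumr_ge0 => j _; rewrite !mulr_ge0 ?powR_ge0.
  have -> : X = (X `^ p) `^ p^-1 by rewrite -powRrM divff ?gt_eqF// powRr1.
  apply: le_powR; [exact: ltW|exact: powR_ge0|].
  apply: le_trans (hoelder_u u z N u0 z1) _.
  rewrite ler_pdivlMr//; apply: le_trans (partial N).
  rewrite mulr_sumr mulr_suml; apply: ler_sum => j _.
  rewrite /b /F /ppow d0 /t (powRD_gt0 _ _ d0) -/c.
  by rewrite le_eqVlt; apply/orP; left; apply/eqP; ring.
rewrite /Bnorm_p vol_integralE.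
apply: (@le_trans _ _ (iint (coords n) (fun w => \sum_(j <oo) (b j)%:E * (F j (vec w))%:E) (fun=> 0)%R)%E).
  apply: le_iint => w; last exact: pointwise.
  by case: ifP => // _; rewrite lee_fin mulr_ge0// powR_ge0.
rewrite iint_series//.
apply: nneseries_le_bound => [j|N]; first exact: iint_ge0.
apply: (@le_trans _ _ (\sum_(0 <= j < N) (C1 * C2 * u j `^ p)%:E)%E); last first.
  by rewrite sumEFin lee_fin -mulr_sumr ler_wpM2l// mulr_ge0.
apply: lee_sum => j _; rewrite iintZ//; last by move=> w; rewrite lee_fin.
apply: (@le_trans _ _ ((b j)%:E * (C2 * (1 - sqnorm (a j)) `^ (- c))%:E)%E).
  by apply: lee_wpmul2l; [rewrite lee_fin|exact: fr].
rewrite -EFinM lee_fin /b powRN le_eqVlt; apply/orP; left; apply/eqP.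
by field; rewrite gt_eqF// powR_gt0.
Qed.

End Synthesis.

(** * Complex powers and holomorphic sums of kernels *)

Section ComplexPower.
Variable R : realType.
Implicit Types (l x y t : R).

(* [w] to the power [-l], on the half-plane [0 < Re w]. *)
Definition cpow l (w : R[i]) : R[i] :=
  let N := complex.Re w ^+ 2 + complex.Im w ^+ 2 in
  let theta := l * atan (complex.Im w / complex.Re w) in
  Complex (N `^ (- l / 2) * cos theta) (- (N `^ (- l / 2) * sin theta)).

Lemma is_derive_fun_eq (f : R -> R) t (a b : R) :
  is_derive t 1 f a -> a = b -> is_derive t 1 f b.
Proof. by move=> fa <-. Qed.

(** In the right half-plane [atan (y / x)] is the argument of [w], so the claim is the addition
    formulas in polar coordinates. *)
Lemma cpow_mul l (w : R[i]) : 0 < complex.Re w -> cpow (l + 1) w * w = cpow l w.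
Proof.
case: w => x y /= x0; rewrite /cpow/=.
set N := x ^+ 2 + y ^+ 2; set th := atan (y / x).
have N0 : 0 < N by rewrite ltr_wpDr ?sqr_ge0// exprn_gt0.
have xE : x = N `^ 2^-1 * cos th.
  rewrite cos_atan powR12_sqrt ?(ltW N0)//.
  have -> : 1 + (y / x) ^+ 2 = N / x ^+ 2 by rewrite /N; field; rewrite gt_eqF.
  rewrite sqrtrM ?(ltW N0)// sqrtrV ?exprn_ge0 ?(ltW x0)// sqrtr_sqr ger0_norm ?(ltW x0)//.
  by rewrite invfM invrK mulVKf// gt_eqF// sqrtr_gt0.
have yE : y = N `^ 2^-1 * sin th.
  have c0 : cos th != 0.
    by apply/eqP => c0; move: x0; rewrite xE c0 mulr0 ltxx.
  have ty : sin th = y / x * cos th by rewrite -[y / x]atanK -/th /tan divfK.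
  by rewrite ty mulrCA -xE divfK// gt_eqF.
have NlE : N `^ (- (l + 1) / 2) * N `^ 2^-1 = N `^ (- l / 2).
  by rewrite -(powRD_gt0 _ _ N0); congr powR; field.
have -> : (l + 1) * th = l * th + th by ring.
rewrite cosD sinD; move: (cos (l * th)) (sin (l * th)) => cl sl.
have cs := cos2Dsin2 th.
apply/eqP; rewrite eq_complex/= -NlE; apply/andP; split; apply/eqP.
  transitivity (N `^ (- (l + 1) / 2) * N `^ 2^-1 * (cl * (cos th ^+ 2 + sin th ^+ 2))).
    rewrite {1}xE {1}yE; ring.
  by rewrite cs mulr1.
transitivity (- (N `^ (- (l + 1) / 2) * N `^ 2^-1 * (sl * (cos th ^+ 2 + sin th ^+ 2)))).
  rewrite {1}xE {1}yE; ring.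
by rewrite cs mulr1.
Qed.

Lemma cmod_cpow l (w : R[i]) : 0 < complex.Re w -> cmod (cpow l w) = cmod w `^ (- l).
Proof.
case: w => x y /= x0; rewrite {2}/cmod/=.
have N0 : 0 < x ^+ 2 + y ^+ 2 by rewrite ltr_wpDr ?sqr_ge0// exprn_gt0.
rewrite -powR12_sqrt ?(ltW N0)// -powRrM /cmod /cpow/= sqrrN !exprMn -mulrDr cos2Dsin2 mulr1.
by rewrite sqrtr_sqr ger0_norm ?powR_ge0//; congr powR; field.
Qed.

Lemma cpow_real l (x : R) : 0 < x -> cpow l x%:C%C = (x `^ (- l))%:C%C.
Proof.
move=> x0; rewrite /cpow/= expr0n/= addr0 mul0r atan0 mulr0 cos0 sin0 mulr0 mulr1 oppr0.
by rewrite -powR_mulrn ?(ltW x0)// -powRrM; congr (_ `^ _ +i* _)%C; field.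
Qed.

(** * Derivative of the complex power along a line *)

Section Path.
Variables (x y a b l : R).

Let X t := x + t * a.
Let Y t := y + t * b.
Let N t := X t ^+ 2 + Y t ^+ 2.

Let is_derive_affine (c d t : R) : is_derive t 1 (fun t => c + t * d) d.
Proof.
have h1 := is_deriveM (is_derive_id t 1) (is_derive_cst d t 1).
have h2 := is_deriveD (is_derive_cst c t 1) h1.
apply: (is_derive_fun_eq h2).
by rewrite scaler0 !add0r /GRing.scale/= mulr1.
Qed.

Let is_derive_N t : is_derive t 1 N (2 * (X t * a + Y t * b)).
Proof.
have h1 := is_deriveM (is_derive_affine x a t) (is_derive_affine x a t).
have h2 := is_deriveM (is_derive_affine y b t) (is_derive_affine y b t).
have h := is_deriveD h1 h2.
have NE : N = (X * X + Y * Y)%R.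
  by apply/funext => u; rewrite /N !expr2.
rewrite NE; apply: (is_derive_fun_eq h).
by rewrite /GRing.scale/= -/(X t) -/(Y t); ring.
Qed.

Let is_derive_theta t : 0 < X t ->
  is_derive t 1 (fun t => l * atan (Y t / X t)) (l * ((X t * b - Y t * a) / N t)).
Proof.
move=> X0; have Xn0 : X t != 0 by rewrite gt_eqF.
have N0 : N t != 0 by rewrite gt_eqF// ltr_wpDr ?sqr_ge0// exprn_gt0.
have dV := is_deriveV Xn0 (is_derive_affine x a t).
have dM := is_deriveM (is_derive_affine y b t) dV.
have dA := is_derive1_comp (is_derive1_atan _) dM.
have dZ := is_deriveM (is_derive_cst l t 1) dA.
apply: (is_derive_fun_eq dZ).
rewrite /GRing.scale/= mulr0 addr0; congr (_ * _).
have E u v : u != 0 -> u ^+ 2 + v ^+ 2 != 0 ->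
  (1 + (v / u) ^+ 2)^-1 * (v * (- u ^- 2 * a) + u^-1 * b) = (u * b - v * a) / (u ^+ 2 + v ^+ 2).
  by move=> u0 uv0; field; rewrite u0/= uv0.
exact: (E (X t) (Y t)).
Qed.

Let P t := N t `^ (- l / 2) * cos (l * atan (Y t / X t)).
Let Q t := - (N t `^ (- l / 2) * sin (l * atan (Y t / X t))).

Let is_derive_pow t : 0 < X t ->
  is_derive t 1 (fun t => N t `^ (- l / 2)) (- l * (N t `^ (- l / 2) * ((X t * a + Y t * b) / N t))).
Proof.
move=> X0.
have N0 : 0 < N t by rewrite ltr_wpDr ?sqr_ge0// exprn_gt0.
have d := is_derive1_comp (is_derive1_powR (- l / 2) N0) (is_derive_N t).
apply: (is_derive_fun_eq d).
have -> : N t `^ (- l / 2 - 1) = N t `^ (- l / 2) / N t.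
  by rewrite (powRD_gt0 _ _ N0) powR_inv1// ltW.
by field; rewrite gt_eqF.
Qed.

Let w t := Complex (X t) (Y t).

Lemma is_derive_cpow_Re t : 0 < complex.Re (w t) ->
  is_derive t 1 (fun t => complex.Re (cpow l (w t))) (- l * complex.Re (Complex a b * cpow (l + 1) (w t))).
Proof.
move=> X0; have dc := is_derive1_comp (is_derive_cos _) (is_derive_theta X0).
have d := is_deriveM (is_derive_pow X0) dc.
have N0 : 0 < N t by rewrite ltr_wpDr ?sqr_ge0// exprn_gt0.
apply: (is_derive_fun_eq d).
transitivity (- l * ((P t * (X t * a + Y t * b) - Q t * (X t * b - Y t * a)) / N t)).
  rewrite /GRing.scale/= /P /Q; ring.
have [-> ->] : P t = complex.Re (cpow l (w t)) /\ Q t = complex.Im (cpow l (w t)) by [].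
(* Writing [cpow l w] as [cpow (l + 1) w * w] cancels the denominator [|w|^2] and leaves the complex
   product. *)
rewrite -cpow_mul//; congr (_ * _); rewrite /w; case: (cpow _ _) => u v /=.
move: N0; rewrite /N; move: (X t) (Y t) => x' y' N0.
by field; rewrite gt_eqF.
Qed.

Lemma is_derive_cpow_Im t : 0 < complex.Re (w t) ->
  is_derive t 1 (fun t => complex.Im (cpow l (w t))) (- l * complex.Im (Complex a b * cpow (l + 1) (w t))).
Proof.
move=> X0; have dc := is_derive1_comp (is_derive_sin _) (is_derive_theta X0).
have d := is_deriveN (is_deriveM (is_derive_pow X0) dc).
have N0 : 0 < N t by rewrite ltr_wpDr ?sqr_ge0// exprn_gt0.
apply: (is_derive_fun_eq d).
transitivity (- l * ((P t * (X t * b - Y t * a) + Q t * (X t * a + Y t * b)) / N t)).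
  rewrite /GRing.scale/= /P /Q; ring.
have [-> ->] : P t = complex.Re (cpow l (w t)) /\ Q t = complex.Im (cpow l (w t)) by [].
rewrite -cpow_mul//; congr (_ * _); rewrite /w; case: (cpow _ _) => u v /=.
move: N0; rewrite /N; move: (X t) (Y t) => x' y' N0.
by field; rewrite gt_eqF.
Qed.

End Path.

(** Two mean value steps give [f 1 - f 0 - g 0 = g c - g 0 = k d * c] with [c <= 1]. It is applied
    to real and imaginary parts separately. *)
Lemma second_order_remainder (f g k : R -> R) (M : R) :
  (forall t, 0 <= t <= 1 -> is_derive t 1 f (g t)) ->
  (forall t, 0 <= t <= 1 -> is_derive t 1 g (k t)) ->
  (forall t, 0 <= t <= 1 -> `|k t| <= M) ->
  `|f 1 - f 0 - g 0| <= M.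
Proof.
move=> df dg kM.
have mvt (u v : R -> R) (c : R) : 0 < c <= 1 -> (forall t, 0 <= t <= 1 -> is_derive t 1 u (v t)) ->
    exists2 d, 0 < d < c & u c - u 0 = v d * c.
  move=> /andP[c0 c1] du; have [||d] := @MVT R u v 0 c c0.
  - by move=> t; rewrite in_itv/= => /andP[t0 tc]; apply: du; rewrite !ltW//= (lt_le_trans tc).
  - apply: derivable_within_continuous => t; rewrite in_itv/= => /andP[t0 tc].
    by apply: ex_derive; apply: du; rewrite t0 (le_trans tc).
  - by rewrite in_itv/= subr0 => dc E; exists d.
have i1 : 0 < (1 : R) <= 1 by rewrite ltr01 lexx.
have [c /andP[c0 c1] fc] := mvt f g 1 i1 df.
have ic : 0 < c <= 1 by rewrite c0 ltW.
have [d /andP[d0 d1] gd] := mvt g k c ic dg.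
rewrite fc mulr1 gd normrM (ger0_norm (ltW c0)).
apply: le_trans (_ : M * 1 <= _); last by rewrite mulr1.
apply: ler_pM => //; first exact: ltW.
  by apply: kM; apply/andP; split; apply: ltW => //; exact: lt_trans d1 c1.
exact: ltW.
Qed.

Lemma cmod_le_ReIm (z : R[i]) : cmod z <= `|complex.Re z| + `|complex.Im z|.
Proof.
rewrite -ler_sqr ?nnegrE ?cmod_ge0 ?addr_ge0// cmod2E sqrrD !real_normK ?num_real//.
by rewrite addrAC lerDl mulrn_wge0// mulr_ge0.
Qed.

(** The bound on [h] keeps the segment at distance at least [|w| / 2] from 0, whence [2^(l + 2)];
    [l (l + 1)] comes from the second derivative, and the leading 2 from adding real and imaginary
    parts. *)
Lemma cpow_taylor l : 0 <= l -> exists2 C : R, 0 <= C & forall w h : R[i],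
  0 < complex.Re w -> 0 < complex.Re (w + h) -> cmod h <= cmod w / 2 ->
  cmod (cpow l (w + h) - cpow l w + (l%:C%C * (h * cpow (l + 1) w))) <=
  C * (cmod h ^+ 2 * cmod w `^ (- (l + 2))).
Proof.
move=> l0; exists (2 * (l * (l + 1) * 2 `^ (l + 2))).
  by rewrite !mulr_ge0 ?powR_ge0// addr_ge0.
case=> x y [a b] x0 xa0 hw.
set M := l * (l + 1) * 2 `^ (l + 2) * (cmod (Complex a b) ^+ 2 * cmod (Complex x y) `^ (- (l + 2))).
pose w t := Complex (x + t * a) (y + t * b).
have wpos t : 0 <= t <= 1 -> 0 < complex.Re (w t).
  move=> /andP[t0 t1] /=; have -> : x + t * a = (1 - t) * x + t * (x + a) by ring.
  move: x0 xa0 => /= x0 xa0; have [t1'|t1'] := eqVneq t 1; first by rewrite t1' subrr mul0r add0r mul1r.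
  apply: ltr_wpDr; first by rewrite mulr_ge0// ltW.
  by rewrite mulr_gt0// subr_gt0 lt_neqAle t1'.
have c0 : 0 < cmod (Complex x y) by apply: lt_le_trans (Re_le_cmod _); rewrite /= gtr0_norm.
have bound t (z : R[i]) : 0 <= t <= 1 -> z = Complex a b * (Complex a b * cpow (l + 2) (w t)) ->
    l * (l + 1) * cmod z <= M.
  move=> t01 ->; have /andP[t0 t1] := t01.
  rewrite !cmodM cmod_cpow ?wpos// /M -!mulrA; do 2 (apply: ler_wpM2l; first by rewrite ?addr_ge0).
  rewrite [leLHS]mulrA [in leRHS](mulrA (cmod _)) [leRHS]mulrCA; apply: ler_wpM2l; first by rewrite mulr_ge0 ?cmod_ge0.
  rewrite -(powR_invN _ (ler0n R 2)) -powRM ?cmod_ge0//.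
  apply: le_powRN; [lra|by rewrite mulr_gt0|].
  have -> : w t = Complex x y + t%:C%C * Complex a b.
    by apply/eqP; rewrite eq_complex/=; apply/andP; split; apply/eqP; ring.
  have := ler_cmodB (Complex x y + t%:C%C * Complex a b) (t%:C%C * Complex a b).
  rewrite addrK cmodM cmodC (ger0_norm t0) [2^-1 * _]mulrC.
  have := ler_piMl (cmod_ge0 (Complex a b)) t1; lra.
have l1 : l + 1 + 1 = l + 2 by ring.
have dRe t : 0 <= t <= 1 -> is_derive t 1 (fun t => - l * complex.Re (Complex a b * cpow (l + 1) (w t)))
   (l * (l + 1) * complex.Re (Complex a b * (Complex a b * cpow (l + 2) (w t)))).
  move=> t01; have w0 := wpos t t01.
  have d1 : is_derive t 1 (fun t => complex.Re (cpow (l + 1) (w t)))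
    (- (l + 1) * complex.Re (Complex a b * cpow (l + 1 + 1) (w t))) := is_derive_cpow_Re (l + 1) w0.
  have d2 : is_derive t 1 (fun t => complex.Im (cpow (l + 1) (w t)))
    (- (l + 1) * complex.Im (Complex a b * cpow (l + 1 + 1) (w t))) := is_derive_cpow_Im (l + 1) w0.
  have d := is_deriveM (is_derive_cst (- l) t 1)
    (is_deriveB (is_deriveM (is_derive_cst a t 1) d1) (is_deriveM (is_derive_cst b t 1) d2)).
  apply: (is_derive_fun_eq d).
  rewrite /GRing.scale/= l1; case: (cpow (l + 2) (w t)) => u v /=; ring.
have dIm t : 0 <= t <= 1 -> is_derive t 1 (fun t => - l * complex.Im (Complex a b * cpow (l + 1) (w t)))
   (l * (l + 1) * complex.Im (Complex a b * (Complex a b * cpow (l + 2) (w t)))).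
  move=> t01; have w0 := wpos t t01.
  have d1 : is_derive t 1 (fun t => complex.Re (cpow (l + 1) (w t)))
    (- (l + 1) * complex.Re (Complex a b * cpow (l + 1 + 1) (w t))) := is_derive_cpow_Re (l + 1) w0.
  have d2 : is_derive t 1 (fun t => complex.Im (cpow (l + 1) (w t)))
    (- (l + 1) * complex.Im (Complex a b * cpow (l + 1 + 1) (w t))) := is_derive_cpow_Im (l + 1) w0.
  have d := is_deriveM (is_derive_cst (- l) t 1)
    (is_deriveD (is_deriveM (is_derive_cst a t 1) d2) (is_deriveM (is_derive_cst b t 1) d1)).
  apply: (is_derive_fun_eq d).
  rewrite /GRing.scale/= l1; case: (cpow (l + 2) (w t)) => u v /=; ring.
have ll0 : 0 <= l * (l + 1) by rewrite mulr_ge0// addr_ge0.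
have R1 : `|complex.Re (cpow l (w 1)) - complex.Re (cpow l (w 0)) -
    (- l * complex.Re (Complex a b * cpow (l + 1) (w 0)))| <= M.
  apply: (second_order_remainder (fun t t01 => is_derive_cpow_Re l (wpos t t01)) dRe) => t t01.
  rewrite normrM (ger0_norm ll0); apply: le_trans (bound t _ t01 erefl).
  by apply: ler_wpM2l => //; exact: Re_le_cmod.
have R2 : `|complex.Im (cpow l (w 1)) - complex.Im (cpow l (w 0)) -
    (- l * complex.Im (Complex a b * cpow (l + 1) (w 0)))| <= M.
  apply: (second_order_remainder (fun t t01 => is_derive_cpow_Im l (wpos t t01)) dIm) => t t01.
  rewrite normrM (ger0_norm ll0); apply: le_trans (bound t _ t01 erefl).
  by apply: ler_wpM2l => //; exact: Im_le_cmod.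
rewrite -mulrA -/M.
have w0 : w 0 = Complex x y by rewrite /w !mul0r !addr0.
have w1 : w 1 = Complex x y + Complex a b by rewrite /w !mul1r.
rewrite w0 w1 in R1 R2.
apply: le_trans (cmod_le_ReIm _) _; rewrite (_ : 2 * M = M + M); last by ring.
move: R1 R2; case: (cpow l (Complex x y + Complex a b)) => u1 v1.
case: (cpow l (Complex x y)) => u2 v2; case: (Complex a b * cpow (l + 1) (Complex x y)) => u3 v3 /=.
rewrite !mulNr !opprK !mul0r subr0 addr0 => R1 R2.
exact: lerD.
Qed.

End ComplexPower.

(** * Absolutely convergent complex series *)

Section ComplexSeries.
Variable R : realType.
Implicit Types (x y : nat -> R[i]).

Definition csum x : R[i] :=
  Complex (limn (series (fun j => complex.Re (x j)))) (limn (series (fun j => complex.Im (x j)))).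

(** Absolute convergence with an explicit bound, under which the [limn] in [csum] are genuine
    limits. *)
Definition summable_by x (S : R) := forall N, \sum_(0 <= j < N) cmod (x j) <= S.

Lemma ImB (z w : R[i]) : complex.Im (z - w) = complex.Im z - complex.Im w.
Proof. by case: z w => ? ? [? ?]. Qed.

Lemma Re_sum (I : Type) (s : seq I) (P : pred I) (F : I -> R[i]) :
  complex.Re (\sum_(i <- s | P i) F i) = \sum_(i <- s | P i) complex.Re (F i).
Proof. by apply: (big_morph (@complex.Re R)) => [[? ?] [? ?]|]. Qed.

Lemma Im_sum (I : Type) (s : seq I) (P : pred I) (F : I -> R[i]) :
  complex.Im (\sum_(i <- s | P i) F i) = \sum_(i <- s | P i) complex.Im (F i).
Proof. by apply: (big_morph (@complex.Im R)) => [[? ?] [? ?]|]. Qed.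

Lemma cvg_abs_series (u : nat -> R) (S : R) : (forall N, \sum_(0 <= j < N) `|u j| <= S) ->
  series u @ \oo --> limn (series u).
Proof.
move=> uS; apply: normed_cvg; apply: nondecreasing_is_cvgn.
  by apply: nondecreasing_series => j _ _; exact: normr_ge0.
by exists S => _ [N _ <-]; exact: uS.
Qed.

Lemma csum_approx x S : summable_by x S -> forall e, 0 < e ->
  exists N0, forall N, (N0 <= N)%N -> cmod (csum x - \sum_(0 <= j < N) x j) <= e.
Proof.
move=> xS e e0; have e2 : 0 < e / 2 by rewrite divr_gt0.
have bound (f : R[i] -> R) : (forall z, `|f z| <= cmod z) ->
    series (fun j => f (x j)) @ \oo --> limn (series (fun j => f (x j))).
  move=> fc; apply: (@cvg_abs_series _ S) => N; apply: le_trans (xS N).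
  by apply: ler_sum => j _; exact: fc.
have /cvgrPdist_le/(_ _ e2)[N1 _ h1] := bound _ (@Re_le_cmod R).
have /cvgrPdist_le/(_ _ e2)[N2 _ h2] := bound _ (@Im_le_cmod R).
exists (maxn N1 N2) => N; rewrite geq_max => /andP[N1N N2N].
apply: le_trans (cmod_le_ReIm _) _; rewrite (splitr e); apply: lerD.
  rewrite ReB Re_sum; exact: h1.
rewrite ImB Im_sum; exact: h2.
Qed.

Lemma cmod_small_eq0 (z : R[i]) : (forall e, 0 < e -> cmod z <= e) -> z = 0.
Proof.
move=> h; have : cmod z <= 0 by apply/ler_addgt0Pl => e e0; rewrite addr0 h.
rewrite le_eqVlt ltNge cmod_ge0 orbF => /eqP z0.
by apply/eqP; rewrite -normr_eq0 -cmodE z0.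
Qed.

Lemma csum_le x S : summable_by x S -> cmod (csum x) <= S.
Proof.
move=> xS; apply/ler_addgt0Pl => e e0.
have [N0 /(_ N0 (leqnn _)) h] := csum_approx xS e0.
rewrite -[csum x](subrK (\sum_(0 <= j < N0) x j)); apply: le_trans (ler_cmodD _ _) _.
by apply: lerD => //; apply: le_trans (xS N0); exact: ler_cmod_sum.
Qed.

Lemma summable_byD x y S T : summable_by x S -> summable_by y T ->
  summable_by (fun j => x j + y j) (S + T).
Proof.
move=> xS yT N; apply: le_trans (lerD (xS N) (yT N)); rewrite -big_split/=.
by apply: ler_sum => j _; exact: ler_cmodD.
Qed.

Lemma summable_byZ x S (c : R[i]) : summable_by x S -> summable_by (fun j => c * x j) (cmod c * S).
Proof.
move=> xS N; under eq_bigr do rewrite cmodM.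
by rewrite -mulr_sumr; apply: ler_wpM2l => //; exact: cmod_ge0.
Qed.

Lemma summable_byN x S : summable_by x S -> summable_by (fun j => - x j) S.
Proof. by move=> xS N; under eq_bigr do rewrite cmodN. Qed.

Lemma csumD x y S T : summable_by x S -> summable_by y T ->
  csum (fun j => x j + y j) = csum x + csum y.
Proof.
move=> xS yT; apply/eqP; rewrite -subr_eq0; apply/eqP; apply: cmod_small_eq0 => e e0.
have e3 : 0 < e / 3 by rewrite divr_gt0.
have [N1 h1] := csum_approx xS e3; have [N2 h2] := csum_approx yT e3.
have [N3 h3] := csum_approx (summable_byD xS yT) e3.
pose N := maxn N1 (maxn N2 N3).
have {}h1 := h1 N (leq_maxl _ _).
have {}h2 : _ <= _ := h2 N (leq_trans (leq_maxl _ _) (leq_maxr _ _)).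
have {}h3 : _ <= _ := h3 N (leq_trans (leq_maxr _ _) (leq_maxr _ _)).
move: h1 h2 h3; rewrite big_split/=.
move: (csum _) (csum x) (csum y) (\sum_(_ <= _ < _) x _) (\sum_(_ <= _ < _) y _) => z u v a b h1 h2 h3.
have -> : z - (u + v) = (z - (a + b)) - ((u - a) + (v - b)) by ring.
apply: le_trans (ler_cmodB _ _) _; have := ler_cmodD (u - a) (v - b); lra.
Qed.

Lemma csumZ x S (c : R[i]) : summable_by x S -> csum (fun j => c * x j) = c * csum x.
Proof.
move=> xS; apply/eqP; rewrite -subr_eq0; apply/eqP; apply: cmod_small_eq0 => e e0.
have c0 := cmod_ge0 c.
have e2 : 0 < e / 2 by rewrite divr_gt0.
have ec : 0 < e / 2 / (cmod c + 1) by rewrite divr_gt0// ltr_wpDl.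
have [N1 h1] := csum_approx xS ec; have [N2 h2] := csum_approx (summable_byZ c xS) e2.
have {}h1 := h1 _ (leq_maxl N1 N2); have {}h2 := h2 _ (leq_maxr N1 N2).
move: h1 h2; rewrite -mulr_sumr.
move: (csum _) (csum x) (\sum_(_ <= _ < _) x _) => z u a h1 h2.
have -> : z - c * u = (z - c * a) - c * (u - a) by ring.
apply: le_trans (ler_cmodB _ _) _; rewrite cmodM (splitr e); apply: lerD => //.
apply: le_trans (_ : (cmod c + 1) * (e / 2 / (cmod c + 1)) <= _); last first.
  by rewrite mulrC divfK// gt_eqF// ltr_wpDl.
by apply: ler_pM => //; [exact: cmod_ge0|rewrite lerDl].
Qed.

Lemma csumN x S : summable_by x S -> csum (fun j => - x j) = - csum x.
Proof.
move=> xS; rewrite -mulN1r -(csumZ _ xS); congr csum; apply/funext => j; by rewrite mulN1r.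
Qed.

Lemma csum0 : csum (fun=> 0) = 0.
Proof.
apply: cmod_small_eq0 => e e0; apply: le_trans (ltW e0).
by apply: csum_le => N; rewrite big1// => j _; exact: cmod0.
Qed.

Lemma csum_sum n (x : 'I_n -> nat -> R[i]) (c : 'I_n -> R[i]) (S : 'I_n -> R) :
  (forall i, summable_by (x i) (S i)) ->
  csum (fun j => \sum_(i < n) x i j * c i) = \sum_(i < n) csum (x i) * c i.
Proof.
move=> xS; suff : forall s : seq 'I_n,
    (exists T, summable_by (fun j => \sum_(i <- s) x i j * c i) T) /\
    csum (fun j => \sum_(i <- s) x i j * c i) = \sum_(i <- s) csum (x i) * c i.
  by move=> h; have [_] := h (index_enum 'I_n).
elim=> [|i s [[T sT] IH]].
  split; first by exists 0 => N; rewrite big1// => j _; rewrite big_nil cmod0.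
  transitivity (csum (fun=> 0 : R[i])); last by rewrite big_nil csum0.
  by congr csum; apply/funext => j; rewrite big_nil.
have xi := summable_byZ (c i) (xS i).
have xE : (fun j => \sum_(i <- i :: s) x i j * c i) = (fun j => c i * x i j + \sum_(i <- s) x i j * c i).
  by apply/funext => j; rewrite big_cons mulrC.
rewrite xE; split; first by exists (cmod (c i) * S i + T); exact: summable_byD.
by rewrite (csumD xi sT) (csumZ _ (xS i)) IH big_cons mulrC.
Qed.

End ComplexSeries.

(** * Holomorphy of sums of kernels *)

Section Holomorphy.
Variables (R : realType) (n : nat).
Implicit Types (z h b : 'I_n -> R[i]).

Lemma sqnormD z h : sqnorm (fun j => z j + h j) =
  sqnorm z + 2 * complex.Re (cinner z h) + sqnorm h.
Proof.
rewrite /sqnorm /cinner Re_sum mulr_sumr -!big_split/=; apply: eq_bigr => j _.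
rewrite !cmod2E /cconj; case: (z j) (h j) => x y [u v] /=; ring.
Qed.

(** The weighted inequality with weight [|h|], enlarged by [e] because [h] may vanish. *)
Lemma cmod_cinner_vnorm h b : sqnorm b <= 1 -> cmod (cinner h b) <= vnorm h.
Proof.
move=> b1; apply/ler_addgt0Pl => e e0; set t := vnorm h + e.
have v0 : 0 <= vnorm h by exact: sqrtr_ge0.
have t0 : 0 < t by rewrite ltr_wpDl.
have H1 := cmod_cinner_le h b t0.
have H2 : sqnorm h / t <= t.
  by rewrite ler_pdivrMr// -(sqr_sqrtr (sqnorm_ge0 h)) -expr2 ler_pXn2r ?nnegrE ?(ltW t0)// lerDl ltW.
have H3 : t * sqnorm b <= t by rewrite ler_piMr// ltW.
rewrite addrC -/t; lra.
Qed.

Lemma cmod_coord_le b j : sqnorm b <= 1 -> cmod (b j) <= 1.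
Proof.
move=> b1; rewrite -(ler_pXn2r (n := 2)) ?nnegrE ?cmod_ge0// expr1n; apply: le_trans b1.
by rewrite /sqnorm (bigD1 j)//= lerDl; apply: sumr_ge0 => k _; exact: sqr_ge0.
Qed.

Lemma Re_ker_ge z b : in_ball b -> (1 - sqnorm z) / 2 <= complex.Re (1 - cinner z b).
Proof. by move=> b1; rewrite ReB cinnerC Re_cconj; exact: Re1_cinner_ge. Qed.

Variables (a : nat -> 'I_n -> R[i]) (A : nat -> R[i]) (S l : R).
Hypothesis a1 : forall k, in_ball (a k).
Hypothesis AS : summable_by A S.
Hypothesis l0 : 0 <= l.

Lemma summable_bounded (x : nat -> R[i]) (M : R) : 0 <= M -> (forall j, cmod (x j) <= M) ->
  summable_by (fun j => A j * x j) (M * S).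
Proof.
move=> M0 xM N; apply: le_trans (ler_wpM2l M0 (AS N)); rewrite mulr_sumr.
by apply: ler_sum => j _; rewrite cmodM mulrC ler_wpM2r ?cmod_ge0.
Qed.

Lemma cmod_cpow_le (m : R) z j : 0 <= m -> in_ball z ->
  cmod (cpow m (1 - cinner z (a j))) <= ((1 - sqnorm z) / 2) `^ (- m).
Proof.
move=> m0 z1; have d0 : 0 < (1 - sqnorm z) / 2 by rewrite divr_gt0// ball_gap.
have Re_d := Re_ker_ge z (a1 j); have Re0 := lt_le_trans d0 Re_d.
rewrite cmod_cpow//; apply: le_powRN => //; apply: (le_trans Re_d).
by apply: le_trans (Re_le_cmod _); exact: ler_norm.
Qed.

Definition kernel_sum z : R[i] := csum (fun j => A j * cpow l (1 - cinner z (a j))).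

(** Expand term by term. All the numbers [1 - <z, a_j>] have real part at least
    [d = (1 - |z|^2) / 2], so the second-order remainders are bounded uniformly in [j] and can be
    summed against [A]. *)
Lemma holomorphic_kernel_sum : holomorphic_ball kernel_sum.
Proof.
move=> z z1.
have [C C0 taylor] := cpow_taylor l0.
pose d := (1 - sqnorm z) / 2.
have d0 : 0 < d by rewrite divr_gt0// ball_gap.
have S0 : 0 <= S by have := AS 0; rewrite big_geq.
have sq1 j : sqnorm (a j) <= 1 by exact/ltW/a1.
have l1 : 0 <= l + 1 by rewrite addr_ge0.
pose x (i : 'I_n) j := A j * (l%:C%C * cconj (a j i) * cpow (l + 1) (1 - cinner z (a j))).
pose Mx := l * d `^ (- (l + 1)).
have xS i : summable_by (x i) (Mx * S).
  apply: summable_bounded => [|j]; first by rewrite mulr_ge0 ?powR_ge0.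
  rewrite !cmodM cmodC (ger0_norm l0) cmod_conj -mulrA; apply: ler_wpM2l => //.
  rewrite -[leRHS]mul1r; apply: ler_pM; rewrite ?cmod_ge0//; first exact: cmod_coord_le.
  exact: cmod_cpow_le.
exists (fun i => csum (x i)) => eps eps0.
pose M := C * d `^ (- (l + 2)) * S.
have M0 : 0 <= M by rewrite !mulr_ge0 ?powR_ge0.
(* [d / 2] keeps [z + h] in the ball and makes the increments admissible for [cpow_taylor]; the
   other bound makes [M * |h| <= eps], with [M + 1] in place of a possibly zero [M]. *)
exists (Num.min (d / 2) (eps / (M + 1))).
  have M1 : 0 < M + 1 by rewrite ltr_wpDl.
  by rewrite lt_min; apply/andP; split; apply: divr_gt0.
move=> h; rewrite lt_min => /andP[hd heps]; set t := vnorm h in hd heps *.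
have t0 : 0 <= t by exact: sqrtr_ge0.
have t2 : t ^+ 2 = sqnorm h by rewrite sqr_sqrtr// sqnorm_ge0.
have zh1 : in_ball (fun j => z j + h j).
  rewrite /in_ball sqnormD -t2.
  have : complex.Re (cinner z h) <= t.
    rewrite cinnerC Re_cconj; apply: le_trans (ler_norm _) _; apply: le_trans (Re_le_cmod _) _.
    by apply: cmod_cinner_vnorm; exact: ltW.
  have := sqnorm_ge0 z; move: hd; rewrite /d; nra.
pose k j := cinner h (a j).
have kt j : cmod (k j) <= t by exact: cmod_cinner_vnorm.
have w0 j : d <= complex.Re (1 - cinner z (a j)) by exact: Re_ker_ge.
have wd j : d <= cmod (1 - cinner z (a j)).
  by apply: (le_trans (w0 j)); apply: le_trans (Re_le_cmod _); exact: ler_norm.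
have s1 := summable_bounded (powR_ge0 _ _) (fun j => cmod_cpow_le j l0 zh1).
have s2 := summable_bounded (powR_ge0 _ _) (fun j => cmod_cpow_le j l0 z1).
have remE : kernel_sum (fun j => z j + h j) - kernel_sum z - \sum_(i < n) csum (x i) * h i =
  csum (fun j => A j * (cpow l (1 - cinner z (a j) + - k j) - cpow l (1 - cinner z (a j)) +
     l%:C%C * (- k j * cpow (l + 1) (1 - cinner z (a j))))).
  have [T sT] : exists T, summable_by (fun j => \sum_(i < n) x i j * h i) T.
    exists (\sum_(i < n) Mx * S * cmod (h i)) => N.
    apply: le_trans (_ : \sum_(0 <= j < N) \sum_(i < n) cmod (x i j) * cmod (h i) <= _).
      apply: ler_sum => j _; apply: le_trans (ler_cmod_sum _ _ _) _.
      by apply: ler_sum => i _; rewrite cmodM.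
    rewrite exchange_big/=; apply: ler_sum => i _; rewrite -mulr_suml.
    by apply: ler_wpM2r; [exact: cmod_ge0|exact: xS].
  rewrite -(csum_sum h xS) /kernel_sum -(csumN s2) -(csumD s1 (summable_byN s2)).
  rewrite -(csumN sT) -(csumD (summable_byD s1 (summable_byN s2)) (summable_byN sT)).
  congr csum; apply/funext => j.
  have -> : cinner (fun j => z j + h j) (a j) = cinner z (a j) + k j by rewrite cinnerDl.
  have -> : \sum_(i < n) x i j * h i = A j * (l%:C%C * (k j * cpow (l + 1) (1 - cinner z (a j)))).
    rewrite /k /cinner mulr_suml !mulr_sumr; apply: eq_bigr => i _; rewrite /x; ring.
  by rewrite opprD addrA; ring.
have rem_le j : cmod (cpow l (1 - cinner z (a j) + - k j) - cpow l (1 - cinner z (a j)) +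
     l%:C%C * (- k j * cpow (l + 1) (1 - cinner z (a j)))) <= C * (t ^+ 2 * d `^ (- (l + 2))).
  apply: (le_trans (taylor _ _ _ _ _)).
  - exact: lt_le_trans (w0 j).
  - have -> : 1 - cinner z (a j) + - k j = 1 - cinner (fun j => z j + h j) (a j).
      by rewrite cinnerDl opprD addrA.
    apply: lt_le_trans (Re_ker_ge _ (a1 j)); by rewrite divr_gt0// ball_gap.
  - rewrite cmodN; have := kt j; have := wd j; lra.
  apply: ler_wpM2l => //; apply: ler_pM; [exact: sqr_ge0|exact: powR_ge0| |].
    by rewrite cmodN ler_pXn2r ?nnegrE ?cmod_ge0.
  by apply: le_powRN; rewrite ?addr_ge0.
rewrite remE; apply: le_trans (csum_le (summable_bounded _ rem_le)) _.
  by rewrite !mulr_ge0 ?powR_ge0.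
have -> : C * (t ^+ 2 * d `^ (- (l + 2))) * S = M * t * t by rewrite /M; ring.
apply: ler_wpM2r => //; move: heps; rewrite ltr_pdivlMr ?ltr_wpDl//; nra.
Qed.

End Holomorphy.

(** * Schur test and Neumann series on l^p *)

Section MatrixAction.
Variables (R : realType) (T : nat -> nat -> R[i]).

Definition apply_mx (x : nat -> R[i]) k : R[i] := csum (fun j => T k j * x j).

Lemma row_summable x (B L : R) k : (forall N, \sum_(0 <= j < N) cmod (T k j) <= L) ->
  0 <= B -> (forall j, cmod (x j) <= B) ->
  summable_by (fun j => T k j * x j) (L * B).
Proof.
move=> rowT B0 xB N; apply: le_trans (ler_wpM2r B0 (rowT N)); rewrite mulr_suml.
by apply: ler_sum => j _; rewrite cmodM ler_wpM2l ?cmod_ge0.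
Qed.

Lemma apply_mxB x y (A B L : R) k : (forall N, \sum_(0 <= j < N) cmod (T k j) <= L) ->
  0 <= A -> 0 <= B -> (forall j, cmod (x j) <= A) -> (forall j, cmod (y j) <= B) ->
  apply_mx (fun j => x j - y j) k = apply_mx x k - apply_mx y k.
Proof.
move=> rowT A0 B0 xA yB; rewrite /apply_mx.
have sx := row_summable rowT A0 xA; have sy := row_summable rowT B0 yB.
rewrite -(csumN sy) -(csumD sx (summable_byN sy)); congr csum.
by apply/funext => j; rewrite mulrBr.
Qed.

End MatrixAction.

Section Schur.
Variables (R : realType) (p q : R).
Hypothesis p0 : 0 < p.
Hypothesis q0 : 0 < q.
Hypothesis pq : p^-1 + q^-1 = 1.

(** [V] bounds the p-th power of the norm, so an operator of norm [rho] multiplies it by [rho^p]. *)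
Definition lp_by (x : nat -> R[i]) (V : R) := forall K, \sum_(0 <= k < K) cmod (x k) `^ p <= V.

Lemma lp_by_ge0 x V : lp_by x V -> 0 <= V.
Proof. by move=> /(_ 0%N); rewrite big_geq. Qed.

Lemma lp_by_sup x V k : lp_by x V -> cmod (x k) <= V `^ p^-1.
Proof.
move=> xV; have -> : cmod (x k) = (cmod (x k) `^ p) `^ p^-1.
  by rewrite -powRrM divff ?gt_eqF// powRr1// cmod_ge0.
apply: le_powR; [by rewrite invr_ge0 ltW|exact: powR_ge0|].
apply: le_trans (xV k.+1); rewrite big_nat_recr//= lerDr.
by apply: sumr_ge0 => j _; exact: powR_ge0.
Qed.

(* Passing to the limit costs a factor [theta < 1], which spares the continuity of [powR]. *)
Lemma lp_by_limit (x : nat -> nat -> R[i]) (z : nat -> R[i]) V (theta : R) : 0 < theta < 1 ->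
  (forall N, lp_by (x N) V) ->
  (forall k e, 0 < e -> exists N0, forall N, (N0 <= N)%N -> cmod (z k - x N k) <= e) ->
  lp_by z (V / theta `^ p).
Proof.
move=> /andP[t0 t1] xV xz K.
have [N hN] : exists N, forall k, (k < K)%N -> theta * cmod (z k) <= cmod (x N k).
  suff [N0 hN0] : exists N0, forall N, (N0 <= N)%N -> forall k, (k < K)%N -> theta * cmod (z k) <= cmod (x N k).
    by exists N0; exact: hN0.
  elim: K => [|K [N1 h1]]; first by exists 0%N.
  have [zK|zK] := eqVneq (cmod (z K)) 0.
    exists N1 => N N1N k; rewrite ltnS leq_eqVlt => /predU1P[->|]; last exact: h1.
    by rewrite zK mulr0 cmod_ge0.
  have zK0 : 0 < cmod (z K) by rewrite lt_def zK cmod_ge0.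
  have e0 : 0 < (1 - theta) * cmod (z K) by rewrite mulr_gt0// subr_gt0.
  have [N2 h2] := xz K _ e0.
  exists (maxn N1 N2) => N; rewrite geq_max => /andP[N1N N2N] k.
  rewrite ltnS leq_eqVlt => /predU1P[->|]; last exact: h1.
  have := h2 N N2N; have := ler_cmodD (z K - x N K) (x N K); rewrite subrK; lra.
rewrite ler_pdivlMr ?powR_gt0// mulr_suml; apply: le_trans (xV N K).
rewrite big_nat [leRHS]big_nat; apply: ler_sum => k /andP[_ kK].
rewrite -powRM ?cmod_ge0 ?(ltW t0)//; apply: le_powR; [exact: ltW| |].
  by rewrite mulr_ge0 ?cmod_ge0// ltW.
by rewrite mulrC; exact: hN.
Qed.

(** Convexity of the p-th power with weights [1 - r] and [r], used in place of Minkowski's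
    inequality. Since [p / q = p - 1], taking [r = rho] turns [rho^p W] into [rho W]. *)
Lemma le_powR_sum (r x y : R) : 0 < r < 1 -> 0 <= x -> 0 <= y ->
  (x + y) `^ p <= (1 - r) `^ (- (p / q)) * x `^ p + r `^ (- (p / q)) * y `^ p.
Proof.
move=> /andP[r0 r1'] x0 y0; have r1 : 0 < 1 - r by rewrite subr_gt0.
have split1 (s z : R) : 0 < s -> (z * s `^ (- q^-1)) * s `^ q^-1 = z.
  by move=> s0; rewrite -mulrA -(powRD_gt0 _ _ s0) addNr powRr0 mulr1.
have pow1 (s z : R) : 0 < s -> 0 <= z -> (z * s `^ (- q^-1)) `^ p = s `^ (- (p / q)) * z `^ p.
  by move=> s0 z0; rewrite (powRM _ z0 (powR_ge0 _ _)) -powRrM mulrC mulNr [q^-1 * p]mulrC.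
have root (s : R) : 0 < s -> (s `^ q^-1) `^ q = s.
  by move=> s0; rewrite -powRrM mulVf ?(gt_eqF q0)// (powRr1 (ltW s0)).
have := hoelder2 (mulr_ge0 x0 (powR_ge0 (1 - r) (- q^-1))) (mulr_ge0 y0 (powR_ge0 r (- q^-1)))
  (powR_ge0 (1 - r) q^-1) (powR_ge0 r q^-1) p0 q0 pq.
rewrite (split1 _ x r1) (split1 _ y r0) (pow1 _ _ r1 x0) (pow1 _ _ r0 y0) (root _ r1) (root _ r0).
rewrite subrK powR1 mulr1.
have : 0 <= (1 - r) `^ (- (p / q)) * x `^ p + r `^ (- (p / q)) * y `^ p.
  by rewrite addr_ge0// mulr_ge0// powR_ge0.
move: (_ + _ * y `^ p) => s s0 h.
have -> : s = (s `^ p^-1) `^ p by rewrite -powRrM mulVf ?(gt_eqF p0)// powRr1.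
by apply: le_powR => //; [exact: ltW|exact: addr_ge0].
Qed.

Variables (T : nat -> nat -> R[i]) (c1 c2 : R).
Hypothesis c10 : 0 < c1.
Hypothesis c20 : 0 < c2.
Hypothesis c12 : c1 * c2 < 1.
Hypothesis rowT : forall k N, \sum_(0 <= j < N) cmod (T k j) <= c1 `^ q.
Hypothesis colT : forall j N, \sum_(0 <= k < N) cmod (T k j) <= c2 `^ p.

(** Split [|T k j| |x j|] as [(|T k j|^(1/p) |x j|) |T k j|^(1/q)]. Hoelder with the row sums gives
    [(c1^q)^(p/q) = c1^p]; exchanging the sums brings in the column sums. *)
Lemma schur_partial x V N : lp_by x V ->
  lp_by (fun k => \sum_(0 <= j < N) T k j * x j) ((c1 * c2) `^ p * V).
Proof.
move=> xV K.
pose m k j := cmod (T k j).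
have m0 k j : 0 <= m k j by exact: cmod_ge0.
have x0 j : 0 <= cmod (x j) by exact: cmod_ge0.
have row k : cmod (\sum_(0 <= j < N) T k j * x j) `^ p <=
    c1 `^ p * \sum_(0 <= j < N) m k j * cmod (x j) `^ p.
  have split1 j : m k j * cmod (x j) = (m k j `^ p^-1 * cmod (x j)) * m k j `^ q^-1.
    have -> : m k j `^ p^-1 * cmod (x j) * m k j `^ q^-1 = m k j `^ p^-1 * m k j `^ q^-1 * cmod (x j).
      by rewrite mulrAC.
    have <- := @powRD _ (m k j) p^-1 q^-1; first by rewrite pq (powRr1 (m0 k j)).
    by rewrite pq oner_eq0.
  apply: (@le_trans _ _ ((\sum_(0 <= j < N) (m k j `^ p^-1 * cmod (x j)) * m k j `^ q^-1) `^ p)).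
    apply: le_powR; [exact: ltW|exact: cmod_ge0|].
    apply: le_trans (ler_cmod_sum _ _ _) _; apply: ler_sum => j _.
    by rewrite cmodM -split1.
  have h := hoelder_sum N p0 q0 pq (fun j => mulr_ge0 (powR_ge0 (m k j) p^-1) (x0 j))
    (fun j => powR_ge0 (m k j) q^-1).
  apply: (le_trans h); rewrite mulrC.
  have E1 j : (m k j `^ p^-1 * cmod (x j)) `^ p = m k j * cmod (x j) `^ p.
    by rewrite (powRM _ (powR_ge0 _ _) (x0 j)) -powRrM mulVf ?gt_eqF// powRr1.
  have E2 j : (m k j `^ q^-1) `^ q = m k j by rewrite -powRrM mulVf ?gt_eqF// powRr1.
  rewrite (eq_bigr _ (fun j _ => E1 j)) (eq_bigr _ (fun j _ => E2 j)).
  apply: ler_wpM2r; first by apply: sumr_ge0 => j _; rewrite mulr_ge0// powR_ge0.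
  have -> : c1 `^ p = (c1 `^ q) `^ (p / q) by rewrite -powRrM mulrCA divff ?mulr1// gt_eqF.
  apply: le_powR; [by rewrite divr_ge0 ?ltW|exact: sumr_ge0|exact: rowT].
apply: le_trans (ler_sum _ (fun k _ => row k)) _.
rewrite -mulr_sumr exchange_big/= (powRM _ (ltW c10) (ltW c20)) -mulrA.
apply: ler_wpM2l; first exact: powR_ge0.
apply: (@le_trans _ _ (c2 `^ p * \sum_(0 <= j < N) cmod (x j) `^ p)).
  rewrite mulr_sumr; apply: ler_sum => j _; rewrite -mulr_suml.
  by apply: ler_wpM2r; [exact: powR_ge0|exact: colT].
by apply: ler_wpM2l; [exact: powR_ge0|exact: xV].
Qed.

Lemma schur : exists2 rho : R, 0 < rho < 1 &
  forall x V, lp_by x V -> lp_by (apply_mx T x) (rho `^ p * V).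
Proof.
have c0 : 0 < c1 * c2 by exact: mulr_gt0.
(* [theta] lies strictly between [c1 c2] and 1, so that the loss in [lp_by_limit] still leaves a
   contraction factor. *)
have [theta t01 ct] : exists2 theta, 0 < theta < 1 & c1 * c2 < theta.
  by have := c12 => c1'; exists ((1 + c1 * c2) / 2); [apply/andP; split; lra|lra].
have t0 : 0 < theta by case/andP: t01.
exists (c1 * c2 / theta); first by rewrite divr_gt0// ltr_pdivrMr// mul1r.
move=> x V xV.
have -> : (c1 * c2 / theta) `^ p * V = (c1 * c2) `^ p * V / theta `^ p.
  rewrite (powRM _ (ltW c0)) ?invr_ge0 ?(ltW t0)//.
  have -> : theta^-1 `^ p = (theta `^ p)^-1 by rewrite -powRN -(powR_invN (- p) (ltW t0)) opprK.
  by rewrite mulrAC.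
apply: (lp_by_limit t01 (fun N => schur_partial N xV)) => k e e0.
exact: (csum_approx (row_summable (rowT k) (powR_ge0 _ _) (fun j => lp_by_sup j xV)) e0).
Qed.

End Schur.

Section Neumann.
Variables (R : realType) (p q : R).
Hypothesis p0 : 0 < p.
Hypothesis q0 : 0 < q.
Hypothesis pq : p^-1 + q^-1 = 1.
Variables (T : nat -> nat -> R[i]) (L rho : R).
Hypothesis rho01 : 0 < rho < 1.
Hypothesis rowT : forall k N, \sum_(0 <= j < N) cmod (T k j) <= L.
Hypothesis contracting : forall x V, lp_by p x V -> lp_by p (apply_mx T x) (rho `^ p * V).

Let rho0 : 0 < rho. Proof. by case/andP: rho01. Qed.
Let rho1 : rho < 1. Proof. by case/andP: rho01. Qed.

Lemma exists_small_power (D : R) e : 0 <= D -> 0 < e -> exists N, D * rho ^+ N <= e.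
Proof.
move=> D0 e0; have := @cvg_geometric R D rho; rewrite (ger0_norm (ltW rho0)) => /(_ rho1).
move=> /cvgrPdist_le/(_ _ e0)[N _ h]; exists N.
have := h N (leqnn N); rewrite sub0r normrN /geometric/= ger0_norm//.
by rewrite mulr_ge0// exprn_ge0// ltW.
Qed.

Lemma geometric_block (D : R) N M : 0 <= D ->
  \sum_(N <= i < N + M) D * rho ^+ i <= D / (1 - rho) * rho ^+ N.
Proof.
move=> D0; have r1 : 0 < 1 - rho by rewrite subr_gt0.
have -> : \sum_(N <= i < N + M) D * rho ^+ i = D * rho ^+ N / (1 - rho) * (1 - rho ^+ M).
  elim: M => [|M IH]; first by rewrite addn0 big_geq// expr0 subrr mulr0.
  rewrite addnS big_nat_recr ?leq_addr//= IH exprD exprS; field; exact: lt0r_neq0.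
rewrite [leRHS]mulrAC ler_piMr//; last by rewrite gerBl exprn_ge0// ltW.
by rewrite divr_ge0 ?mulr_ge0 ?exprn_ge0// ltW.
Qed.

(* Neumann series for [1 + T] on l^p, written as the iteration [u <- y - T u]. *)
Lemma neumann_solution (y : nat -> R[i]) V : lp_by p y V ->
  exists u W, lp_by p u W /\ forall k, u k + apply_mx T u k = y k.
Proof.
move=> yV; have V0 := lp_by_ge0 yV.
pose step x k := y k - apply_mx T x k.
pose u N := iter N step (fun=> 0).
have r1 : 0 < 1 - rho by rewrite subr_gt0.
have pqE : p / q = p - 1.
  have : p * (p^-1 + q^-1) = p by rewrite pq mulr1.
  by rewrite mulrDr divff ?gt_eqF// => h; apply/eqP; rewrite eq_sym subr_eq addrC h.
(* [W] is the fixed point of [W -> (1 - rho)^(-(p/q)) V + rho W], the bound propagated by one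
   iteration step. *)
have [W W0 WE] : exists2 W, 0 <= W & (1 - rho) `^ (- (p / q)) * V = W * (1 - rho).
  exists ((1 - rho) `^ (- (p / q)) * V / (1 - rho)); last by rewrite divfK// gt_eqF.
  by apply: divr_ge0; [apply: mulr_ge0 => //; exact: powR_ge0|exact: ltW].
have uW N : lp_by p (u N) W.
  elim: N => [|N IH] K.
    by rewrite big1// => k _; rewrite cmod0 powR0 ?gt_eqF.
  apply: (@le_trans _ _ (\sum_(0 <= k < K) ((1 - rho) `^ (- (p / q)) * cmod (y k) `^ p +
     rho `^ (- (p / q)) * cmod (apply_mx T (u N) k) `^ p))).
    apply: ler_sum => k _.
    apply: le_trans (le_powR_sum p0 q0 pq rho01 (cmod_ge0 _) (cmod_ge0 _)).
    by apply: le_powR; [exact: ltW|exact: cmod_ge0|exact: ler_cmodB].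
  rewrite big_split/= -2!mulr_sumr.
  apply: (@le_trans _ _ ((1 - rho) `^ (- (p / q)) * V + rho `^ (- (p / q)) * (rho `^ p * W))).
    apply: lerD; (apply: ler_wpM2l; first exact: powR_ge0); first exact: yV.
    exact: contracting IH K.
  rewrite WE [X in _ + X]mulrA -(powRD_gt0 _ _ rho0) pqE opprB subrK (powRr1 (ltW rho0)).
  by rewrite mulrBr mulr1 [rho * W]mulrC subrK.
pose d N k := u N.+1 k - u N k.
have [B B0 uB] : exists2 B, 0 <= B & forall N j, cmod (u N j) <= B.
  by exists (W `^ p^-1); [exact: powR_ge0|move=> N j; exact: (lp_by_sup p0 j (uW N))].
have dV N : lp_by p (d N) ((rho ^+ N) `^ p * V).
  elim: N => [|N IH].
    rewrite expr0 powR1 mul1r => K; apply: le_trans (yV K).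
    apply: ler_sum => k _; rewrite /d /= /step subr0.
    have -> : apply_mx T (u 0) k = 0; last by rewrite subr0.
    rewrite /apply_mx /u /=; transitivity (csum (fun=> 0 : R[i])); last exact: csum0.
    by congr csum; apply/funext => j; rewrite mulr0.
  have -> : (rho ^+ N.+1) `^ p * V = rho `^ p * ((rho ^+ N) `^ p * V).
    by rewrite exprS (powRM _ (ltW rho0) (exprn_ge0 _ (ltW rho0))) mulrA.
  move=> K; apply: le_trans (contracting IH K); apply: ler_sum => k _.
  have -> : d N.+1 k = - apply_mx T (d N) k; last by rewrite cmodN.
  by rewrite (apply_mxB (rowT k) B0 B0 (uB N.+1) (uB N)) /d /u /= /step; ring.
have [V' V'0 d_le] : exists2 V', 0 <= V' & forall N k, cmod (d N k) <= V' * rho ^+ N.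
  exists (V `^ p^-1) => [|N k]; first exact: powR_ge0.
  have rN : 0 <= rho ^+ N by rewrite exprn_ge0// ltW.
  have := lp_by_sup p0 k (dV N).
  by rewrite (powRM _ (powR_ge0 _ _) V0) -powRrM divff ?gt_eqF// (powRr1 rN) mulrC.
pose D := V' / (1 - rho).
have D0 : 0 <= D by rewrite divr_ge0// ltW.
have diff_le N M k : cmod (u (N + M)%N k - u N k) <= D * rho ^+ N.
  have -> : u (N + M)%N k - u N k = \sum_(N <= i < N + M) d i k.
    by rewrite (telescope_sumr (fun i => u i k)) ?leq_addr.
  apply: le_trans (ler_cmod_sum _ _ _) _; apply: le_trans (geometric_block N M V'0).
  by apply: ler_sum => i _; exact: d_le.
have u_sum N k : \sum_(0 <= i < N) d i k = u N k.
  by rewrite (telescope_sumr (fun i => u i k))// subr0.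
have d_sum k : summable_by (fun i => d i k) (D * rho ^+ 0).
  move=> N; apply: le_trans (geometric_block 0 N V'0); rewrite add0n.
  by apply: ler_sum => i _; exact: d_le.
pose z k := csum (fun i => d i k).
have zu k e : 0 < e -> exists N0, forall N, (N0 <= N)%N -> cmod (z k - u N k) <= e.
  by move=> e0; have [N0 h] := csum_approx (d_sum k) e0; exists N0 => N /h; rewrite u_sum.
have z_rate N k : cmod (z k - u N k) <= D * rho ^+ N.
  apply/ler_addgt0Pl => e e0; have [N0 h] := zu k e e0.
  have := h (N + N0)%N (leq_addl _ _); have := diff_le N N0 k.
  have := ler_cmodD (z k - u (N + N0)%N k) (u (N + N0)%N k - u N k); rewrite addrA subrK; lra.
have half : 0 < (2^-1 : R) < 1 by rewrite invr_gt0 ltr0n invf_lt1 ?ltr1n.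
have zW := lp_by_limit p0 half uW zu.
exists z, (W / 2^-1 `^ p); split => // k.
have zB j : cmod (z j) <= (W / 2^-1 `^ p) `^ p^-1 by exact: lp_by_sup zW.
have L0 : 0 <= L by have := rowT 0 0; rewrite big_geq.
apply/eqP; rewrite -subr_eq0; apply/eqP; apply: cmod_small_eq0 => e e0.
have DL0 : 0 <= D + L * D by rewrite addr_ge0// mulr_ge0.
have [N hN] := exists_small_power DL0 e0; apply: le_trans hN.
(* The defect of the limit [z] is expressed through its distance to the iterates, which decays like
   [rho^N]. *)
have -> : z k + apply_mx T z k - y k = (z k - u N.+1 k) + apply_mx T (fun j => z j - u N j) k.
  rewrite (apply_mxB (rowT k) (powR_ge0 _ _) B0 zB (uB N)) {2}/u /= /step -/(u N); ring.
apply: le_trans (ler_cmodD _ _) _; rewrite mulrDl; apply: lerD.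
  have rN : 0 <= rho ^+ N by rewrite exprn_ge0// ltW.
  apply: le_trans (z_rate _ _) _; rewrite exprS mulrCA ler_piMl//; last exact: ltW.
  exact: mulr_ge0.
rewrite -mulrA; apply: csum_le; apply: (row_summable (rowT k)) => [|j]; last exact: z_rate.
by rewrite mulr_ge0 ?exprn_ge0// ltW.
Qed.

End Neumann.

(** * Interpolation *)

Section Interpolation.
Variables (R : realType) (n : nat) (a : nat -> 'I_n -> R[i]).
Hypothesis a1 : forall k, in_ball (a k).

Lemma Kconst_partial (r s B : R) : (Kconst a r s <= B%:E)%E ->
  forall k N, \sum_(0 <= j < N | j != k) Kterm a r s k j <= B.
Proof.
move=> KB k N; rewrite -lee_fin; apply: le_trans KB.
apply: (@le_trans _ _ (\sum_(j <oo | j != k) (Kterm a r s k j)%:E)%E); last first.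
  by apply: ereal_sup_ubound; exists k.
rewrite -sumEFin; apply: nneseries_lim_ge => j _ _; rewrite lee_fin.
exact: Kterm_ge0.
Qed.

(** This turns the second hypothesis into a bound on column sums. *)
Lemma Kterm_sym (r s : R) k j : Kterm a r s k j = Kterm a s r j k.
Proof. by rewrite /Kterm cmod1_cinnerC [s + r]addrC [X in X / _]mulrC. Qed.

Lemma summable_delta (k : nat) (z : R[i]) : summable_by (fun j => if j == k then z else 0) (cmod z).
Proof.
move=> N; rewrite (eq_bigr (fun j => if j == k then cmod z else 0)); last first.
  by move=> j _; case: ifP => // _; exact: cmod0.
by rewrite -big_mkcond big_nat1_eq/=; case: ifP => // _; exact: cmod_ge0.
Qed.

Lemma csum_delta (k : nat) (z : R[i]) : csum (fun j => if j == k then z else 0) = z.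
Proof.
apply/eqP; rewrite -subr_eq0; apply/eqP; apply: cmod_small_eq0 => e e0.
have [N0 h] := csum_approx (summable_delta k z) e0; have := h (maxn N0 k.+1) (leq_maxl _ _).
by rewrite -big_mkcond big_nat1_eq/= leq_maxr.
Qed.

Variables (p q l : R).
Hypothesis l0 : 0 < l.
Hypothesis p0 : 0 < p.
Hypothesis q0 : 0 < q.
Hypothesis pq : p^-1 + q^-1 = 1.

Let gap k := 1 - sqnorm (a k).

Let lpq : l / p + l / q = l.
Proof. by rewrite -mulrDr pq mulr1. Qed.

Let Re_ker_gt0 z j : in_ball z -> 0 < complex.Re (1 - cinner z (a j)).
Proof. by move=> z1; apply: lt_le_trans (Re_ker_ge z (a1 j)); rewrite divr_gt0// ball_gap. Qed.

(** With the weights [l / p] on rows and [l / q] on columns, the full matrix has diagonal entries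
    [gap k ^ (l/p + l/q - l) = 1], so it is the identity plus [offdiag]. *)
Definition offdiag k j : R[i] :=
  if j == k then 0
  else (gap k `^ (l / p) * gap j `^ (l / q))%:C%C * cpow l (1 - cinner (a k) (a j)).

Lemma cmod_offdiag k j : cmod (offdiag k j) = if j != k then Kterm a (l / p) (l / q) k j else 0.
Proof.
rewrite /offdiag; case: eqP => _ /=; first exact: cmod0.
rewrite cmodM cmodC cmod_cpow ?Re_ker_gt0// ger0_norm ?mulr_ge0 ?powR_ge0//.
by rewrite /Kterm lpq cmod1_cinnerC powRN.
Qed.

Variables (c1 c2 : R).
Hypothesis c10 : 0 < c1.
Hypothesis c20 : 0 < c2.
Hypothesis c12 : c1 * c2 < 1.
Hypothesis K1 : forall k N, \sum_(0 <= j < N | j != k) Kterm a (l / p) (l / q) k j <= c1 `^ q.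
Hypothesis K2 : forall k N, \sum_(0 <= j < N | j != k) Kterm a (l / q) (l / p) k j <= c2 `^ p.

Lemma offdiag_row k N : \sum_(0 <= j < N) cmod (offdiag k j) <= c1 `^ q.
Proof. by under eq_bigr do rewrite cmod_offdiag; rewrite -big_mkcond; exact: K1. Qed.

Lemma offdiag_col j N : \sum_(0 <= k < N) cmod (offdiag k j) <= c2 `^ p.
Proof.
under eq_bigr do rewrite cmod_offdiag eq_sym Kterm_sym.
by rewrite -big_mkcond; exact: K2.
Qed.

(** In the row of [a 0] the kernel modulus is at most 2, so [gap j ^ (l/q)] is at most a constant
    times [Kterm] for every [j] other than 0; the summand 1 covers [j = 0]. It makes the
    coefficients [u j * gap j ^ (l/q)] summable for bounded [u]. *)
Lemma gap_sum : exists S, forall N, \sum_(0 <= j < N) gap j `^ (l / q) <= S.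
Proof.
have g0 := ball_gap (a1 0).
exists (1 + (gap 0 `^ (l / p))^-1 * 2 `^ l * c1 `^ q) => N.
have M0 : 0 <= (gap 0 `^ (l / p))^-1 * 2 `^ l by rewrite mulr_ge0 ?invr_ge0 ?powR_ge0.
rewrite (bigID (pred1 0%N))/=; apply: lerD.
  rewrite big_nat1_eq; case: ifP => // _.
  have -> : 1 = 1 `^ (l / q) :> R by rewrite powR1.
  apply: le_powR; [by rewrite divr_ge0 ?ltW|exact: ltW|by rewrite gerBl sqnorm_ge0].
apply: le_trans (ler_wpM2l M0 (K1 0 N)); rewrite mulr_sumr; apply: ler_sum => j _.
have k0 := cmod1_cinner_gt0 (a1 j) (a1 0).
have k2 : cmod (1 - cinner (a j) (a 0)) <= 2.
  apply: le_trans (ler_cmodB _ _) _; rewrite -[1]/(1%:C%C) cmodC normr1.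
  have := cmod_cinner_le (a j) (a 0) (ltr01 : 0 < 1); rewrite divr1 mul1r.
  have := a1 j; have := a1 0; rewrite /in_ball; lra.
have h : cmod (1 - cinner (a j) (a 0)) `^ l <= 2 `^ l by apply: le_powR => //; exact: ltW.
rewrite /Kterm lpq -/(gap 0) -/(gap j).
have g1 : 0 < gap 0 `^ (l / p) by exact: powR_gt0.
have kl : 0 < cmod (1 - cinner (a j) (a 0)) `^ l by exact: powR_gt0.
have e0 : 0 <= gap j `^ (l / q) by exact: powR_ge0.
move: (cmod _ `^ l) (gap 0 `^ _) (gap j `^ _) (2 `^ l) h g1 kl e0 => K G E P h g1 kl e0.
have -> : G^-1 * P * (G * E / K) = P / K * E by field; rewrite !gt_eqF.
by rewrite ler_peMl// ler_pdivlMr// mul1r.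
Qed.

Lemma kernel_sum_interpolates (u : nat -> R[i]) (S B : R) k :
  summable_by (fun j => u j * (gap j `^ (l / q))%:C%C) S -> 0 <= B -> (forall j, cmod (u j) <= B) ->
  (gap k `^ (l / p))%:C%C * kernel_sum a (fun j => u j * (gap j `^ (l / q))%:C%C) l (a k) =
  u k + apply_mx offdiag u k.
Proof.
move=> AS B0 uB.
have sK := summable_bounded AS (powR_ge0 _ _) (fun j => cmod_cpow_le a1 j (ltW l0) (a1 k)).
have sT := row_summable (offdiag_row k) B0 uB.
(* [u k] is written as the sum of a sequence concentrated at [k], so that both sides are series and
   compare termwise. *)
rewrite /kernel_sum -(csumZ _ sK) -[X in X + _](csum_delta k) /apply_mx.
rewrite -(csumD (summable_delta k (u k)) sT); congr csum; apply/funext => j.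
rewrite /offdiag; case: eqP => [->|_].
  rewrite mul0r addr0 cinnerxx -[1]/(1%:C%C) -rmorphB/= -/(gap k) cpow_real; last exact: ball_gap.
  rewrite mulrCA -mulrA -!rmorphM/= [X in X%:C%C](_ : _ = 1) ?mulr1//.
  have g0 := ball_gap (a1 k).
  rewrite -(powRD_gt0 _ _ g0) -(powRD_gt0 _ _ g0) addrA [l / q + _]addrC lpq.
  by rewrite subrr powRr0.
by rewrite add0r rmorphM/=; ring.
Qed.

Lemma interpolating_of_Kterm (alpha : R) : (0 < n)%N -> n%:R < l -> l = n.+1%:R + alpha * p ->
  interpolating p alpha a.
Proof.
move=> n0 ln lE v; have gE : n.+1%:R / p + alpha = l / p by rewrite lE mulrDl mulfK// gt_eqF.
rewrite /in_lpgamma gE => vlt.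
have t0 k : (0 <= ((gap k `^ (l / p) * cmod (v k)) `^ p)%:E)%E by rewrite lee_fin powR_ge0.
pose y k := (gap k `^ (l / p))%:C%C * v k.
have [V yV] : exists V, lp_by p y V.
  exists (fine (\sum_(k <oo) ((gap k `^ (l / p) * cmod (v k)) `^ p)%:E)%E) => K.
  rewrite -lee_fin fineK; last by rewrite ge0_fin_numE//; exact: nneseries_ge0.
  apply: (@le_trans _ _ (\sum_(0 <= k < K) ((gap k `^ (l / p) * cmod (v k)) `^ p)%:E)%E).
    rewrite sumEFin lee_fin; apply: ler_sum => k _.
    by rewrite /y cmodM cmodC ger0_norm ?powR_ge0.
  by apply: nneseries_lim_ge => k _ _; exact: t0.
have [rho rho01 contr] := schur p0 q0 pq c10 c20 c12 offdiag_row offdiag_col.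
have [u [W [uW uE]]] := neumann_solution p0 q0 pq rho01 offdiag_row contr yV.
have uB j : cmod (u j) <= W `^ p^-1 by exact: lp_by_sup.
have B0 : 0 <= W `^ p^-1 by exact: powR_ge0.
have [S gS] := gap_sum.
pose A j := u j * (gap j `^ (l / q))%:C%C.
have AS : summable_by A (W `^ p^-1 * S).
  move=> N; apply: le_trans (ler_wpM2l B0 (gS N)); rewrite mulr_sumr; apply: ler_sum => j _.
  by rewrite cmodM cmodC ger0_norm ?powR_ge0// ler_wpM2r ?powR_ge0.
exists (kernel_sum a A l); split; last first.
  move=> k; have g0 : (gap k `^ (l / p))%:C%C != 0 :> R[i].
    by rewrite -[0]/(0%:C%C) (inj_eq (@complexI R)) gt_eqF// powR_gt0// ball_gap.
  apply: (mulfI g0); rewrite (kernel_sum_interpolates k AS B0 uB); exact: uE.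
split; first exact: (holomorphic_kernel_sum a1 AS (ltW l0)).
have lp0 : 0 <= l / p by rewrite divr_ge0 ?ltW.
have lq0 : 0 <= l / q by rewrite divr_ge0 ?ltW.
have [C C0 synth] := synthesis_bound n0 a1 lp0 lq0 K1 p0 q0 pq ln lE.
apply: le_lt_trans (synth (fun j => cmod (u j)) W _ (fun j => cmod_ge0 _) uW _) (ltry _).
move=> z B z1 zB; apply: csum_le => N; apply: le_trans (zB N); apply: ler_sum => j _.
by rewrite !cmodM cmodC ger0_norm ?powR_ge0// cmod_cpow ?Re_ker_gt0// mulrA.
Qed.

End Interpolation.

Theorem theorem4p5 (R : realType) (n : nat) (p q alpha beta : R)
  (a : nat -> 'I_n -> R[i]) :
  (0 < n)%N ->
  1 < p -> 0 < q -> p^-1 + q^-1 = 1 ->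
  - p^-1 < alpha -> beta = alpha * p / q ->
  (forall k, in_ball (a k)) ->
  (exists c1 c2 : R, [/\ 0 < c1, 0 < c2, c1 * c2 < 1,
     (Kconst a ((n.+1)%:R / p + alpha) ((n.+1)%:R / q + beta) <= (c1 `^ q)%:E)%E
   & (Kconst a ((n.+1)%:R / q + beta) ((n.+1)%:R / p + alpha) <= (c2 `^ p)%:E)%E]) ->
  interpolating p alpha a.
Proof.
move=> n0 p1 q0 pq alphap betaE a1 [c1 [c2 [c10 c20 c12]]].
have p0 : 0 < p by exact: lt_trans p1.
pose l := n.+1%:R + alpha * p.
have -> : n.+1%:R / p + alpha = l / p by rewrite /l mulrDl mulfK// gt_eqF.
have -> : n.+1%:R / q + beta = l / q by rewrite /l betaE mulrDl.
move=> /Kconst_partial K1 /Kconst_partial K2.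
(* The bound [alpha > -1/p] is exactly [l > n], on which both Forelli-Rudin estimates rest. *)
have ap : -1 < alpha * p by rewrite -ltr_pdivrMr// mulN1r.
have ln : n%:R < l by rewrite /l -[n.+1%:R]natr1; lra.
have l0 : 0 < l by apply: le_lt_trans ln.
exact: (interpolating_of_Kterm a1 l0 p0 q0 pq c10 c20 c12 K1 K2 n0 ln).
Qed.
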